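(* There is an algorithm that solves \textsc{Weighted Vertex Integrity} in time $2^{O(\mathrm{mw})} n^{O(1)}$, where $\mathrm{mw}$ is the modular width of the input graph and $n$ is the size of the input, even when the vertex weights are encoded in binary.
   Context: Graphs are finite, simple and undirected. For $w: V(G) \to \mathbb{Z}^+$ and $X \subseteq V(G)$, $w(X) = \sum_{x\in X} w(x)$. The weighted vertex integrity is $\mathrm{wvi}(G) = \min_{S \subseteq V(G)} \{ w(S) + \max_{D} w(D) \}$, the maximum ranging over connected components $D$ of $G - S$. \textsc{Weighted Vertex Integrity}: given a graph $G$, vertex weights $w: V(G) \to \mathbb{Z}^+$ encoded in binary, and an integer $k$, decide whether $\mathrm{wvi}(G) \le k$. A module of $G$ is a set $M \subseteq V$ such that every vertex outside $M$ is adjacent to all of $M$ or to none of $M$. The modular width of $G=(V,E)$ is the smallest integer $k$ such that either $|V| \le k$, or $V$ can be partitioned into at most $k$ sets $V_1, \ldots, V_{k'}$ ($k' \le k$) such that each $V_i$ is a module of $G$ and each $G[V_i]$ has modular width at most $k$. *)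

(* Defs.v *)
From mathcomp Require Import all_boot.
Set Implicit Arguments. Unset Strict Implicit. Unset Printing Implicit Defensive.

(* Graphs: a finite simple graph is a symmetric irreflexive rel on a   *)
(* finType T.                                                          *)
Section Graph.
Variables (T : finType) (e : rel T).

Definition wt (w : T -> nat) (A : {set T}) : nat := \sum_(x in A) w x.

Definition del_rel (S : {set T}) : rel T :=
  [rel u v | e u v && (u \notin S) && (v \notin S)].

(* the connected component of G - S containing x (for x \notin S) *)
Definition comp (S : {set T}) (x : T) : {set T} :=
  [set y | connect (del_rel S) x y].

(* w(S) + max_D w(D), D ranging over the components of G - S
   (every component is comp S x for some x \notin S; max of nothing is 0) *)
Definition integrity_cost (w : T -> nat) (S : {set T}) : nat :=
  wt w S + \max_(x in ~: S) wt w (comp S x).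

(* weighted vertex integrity: minimum over all S; the default w(V) is
   attained at S = V and is an upper bound for every cost. *)
Definition wvi (w : T -> nat) : nat :=
  \big[minn/wt w setT]_(S : {set T}) integrity_cost w S.

Definition is_module (X M : {set T}) : bool :=
  (M \subset X) &&
  [forall x in X :\: M, [forall y in M, e x y] || [forall y in M, ~~ e x y]].

Inductive mw_le (k : nat) : {set T} -> Prop :=
| mw_small (X : {set T}) : #|X| <= k -> mw_le k X
| mw_split (X : {set T}) (P : {set {set T}}) :
    partition P X -> #|P| <= k ->
    (forall M, M \in P -> is_module X M) ->
    (forall M, M \in P -> mw_le k M) -> mw_le k X.

Lemma mw_le_exists : exists k, mw_le k setT.
Proof. exists #|[set: T]|; exact: mw_small. Qed.

Definition is_modular_width (mw : nat) : Prop :=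
  mw_le mw setT /\ forall j, mw_le j setT -> mw <= j.

End Graph.

Fixpoint bin_aux (f n : nat) : seq nat :=
  match f with
  | 0 => [::]
  | f'.+1 => if n == 0 then [::] else (n %% 2) :: bin_aux f' (n %/ 2)
  end.
Definition binary (n : nat) : seq nat := bin_aux n n.
(* self-delimiting binary encoding: bit b -> 1 b, terminator 0 *)
Definition enc_nat (n : nat) : seq nat :=
  flatten [seq [:: 1; b] | b <- binary n] ++ [:: 0].

Definition encode (N : nat) (e : rel 'I_N) (w : 'I_N -> nat) (k : nat)
  : seq nat :=
  nseq N 1 ++ [:: 0]
  ++ [seq nat_of_bool (e i j) | i <- enum 'I_N, j <- enum 'I_N]
  ++ flatten [seq enc_nat (w i) | i <- enum 'I_N]
  ++ enc_nat k.

(* Machine model: a unit-cost RAM with addition, truncated subtraction,*)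
(* indirect addressing and conditional jumps (no multiplication).      *)
Inductive instr : Type :=
| IConst (r c : nat)
| IAdd (r a b : nat)
| ISub (r a b : nat)
| ILoad (r a : nat)
| IStore (a r : nat)
| IJz (r l : nat)
| IHalt.

Definition program := seq instr.

Record state := State { pc : nat; mem : nat -> nat }.

Definition upd (m : nat -> nat) (a v : nat) : nat -> nat :=
  fun i => if i == a then v else m i.

(* one step; None when the machine has halted (Halt or pc out of range) *)
Definition step (P : program) (s : state) : option state :=
  let m := mem s in let p := pc s in
  match nth IHalt P p with
  | IConst r c => Some (State p.+1 (upd m r c))
  | IAdd r a b => Some (State p.+1 (upd m r (m a + m b)))
  | ISub r a b => Some (State p.+1 (upd m r (m a - m b)))
  | ILoad r a => Some (State p.+1 (upd m r (m (m a))))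
  | IStore a r => Some (State p.+1 (upd m (m a) (m r)))
  | IJz r l => Some (State (if m r == 0 then l else p.+1) m)
  | IHalt => None
  end.

Fixpoint run (P : program) (t : nat) (s : state) : option state :=
  match step P s with
  | None => Some s
  | Some s' => match t with 0 => None | t'.+1 => run P t' s' end
  end.

Definition init (inp : seq nat) : state :=
  State 0 (fun i => if i is j.+1 then nth 0 inp j else size inp).

Definition decides_within (P : program) (inp : seq nat) (t : nat) (b : bool)
  : Prop :=
  exists s, run P t (init inp) = Some s /\ mem s 0 = nat_of_bool b.

(* Main.v *)
(* Contract modules bottom up: in the graph induced on the current representatives, take a smallest
   set with two elements that is closed under splitters, i.e. a smallest module; its size is at most
   the modular width, because every induced subgraph has a module of size between 2 and mw. For a
   bound p on the component weights, the cost F(M) of the contracted module M is the minimum over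
   the at most 2^mw sets A of blocks of M that survive, where a block isolated in A contributes its
   own F, the other surviving blocks are kept whole and must form components of weight at most p,
   and the remaining blocks are deleted. For every p, some deletion set costs at most
   p + F(V). Conversely an optimal deletion set S of least cardinality has the property that
   each x in S has neighbours in two components of G - S; hence a module that is only partly deleted
   has no surviving neighbour outside, so the recursion finds S, and the heaviest component is V or a
   union of blocks of some contracted module. Thus at most n * 2^mw + 2 values of p matter.

   The algorithm is written in a small language of bounded loops that is compiled to the machine:
   a program runs in time polynomial in a common bound of its loop lengths, which here is
   2^mw times the input size. *)
Require Import Defs.
From mathcomp Require Import all_boot zify.
Set Implicit Arguments. Unset Strict Implicit. Unset Printing Implicit Defensive.

(** No decomposition tree is built: contracting one small module at a time gives [n.+1] identical
    rounds on one array of representatives, which suits loops whose lengths are fixed in advance.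
    The width is not part of the input either; the program measures the size [q] of the largest
    module that it contracts, and the time bound only uses [q <= mw]. The lower bound on the cost
    needs a deletion set that spares a partly surviving module altogether as soon as it has a
    surviving neighbour. An arbitrary optimal set may fail this (in a triangle with unit weights,
    deleting one vertex is optimal), hence the passage to canonical sets. With binary weights the
    range of [p] can be exponential in the input length and cannot be scanned. So [p] jumps from one
    candidate to the next larger one, and that one is found while the current [p] is evaluated,
    without a stored or sorted list. Every [p] yields a valid upper bound; the candidates only serve
    completeness. *)

(** * Timed executions and code fragments *)

Fixpoint steps (P : program) (n : nat) (s s' : state) : Prop :=
  if n is n'.+1 then exists2 s1, step P s = Some s1 & steps P n' s1 s' else s = s'.

Definition reach (P : program) (t : nat) (s s' : state) : Prop :=
  exists2 n, n <= t & steps P n s s'.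

Lemma reach_refl P t s : reach P t s s.
Proof. by exists 0. Qed.

Lemma reach_step P t s s1 s' :
  step P s = Some s1 -> reach P t s1 s' -> reach P t.+1 s s'.
Proof. by move=> h [n ln hn]; exists n.+1 => //; exists s1. Qed.

Lemma reach_le P t t' s s' : t <= t' -> reach P t s s' -> reach P t' s s'.
Proof. by move=> lt [n ln hn]; exists n => //; apply: leq_trans lt. Qed.

Lemma reach_trans P t1 t2 s1 s2 s3 :
  reach P t1 s1 s2 -> reach P t2 s2 s3 -> reach P (t1 + t2) s1 s3.
Proof.
case=> n ln hn [m lm hm]; exists (n + m); first exact: leq_add.
elim: n s1 {ln} hn => [|n IH] s1 /=; first by move=> ->.
by case=> s h /IH hs; exists s.
Qed.

Lemma reach_run P t s s' :
  reach P t s s' -> step P s' = None -> run P t s = Some s'.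
Proof.
case=> n ln hn hs'; elim: n t s ln hn => [|n IH] t s /=.
  by move=> _ ->; case: t => [|t] /=; rewrite hs'.
case: t => // t ln [s1 h1 /IH]; rewrite /= h1; exact.
Qed.

Definition code_at (P : program) (b : nat) (c : seq instr) : Prop :=
  forall i, i < size c -> nth IHalt P (b + i) = nth IHalt c i.

Lemma code_at_cat P b c1 c2 :
  code_at P b (c1 ++ c2) -> code_at P b c1 /\ code_at P (b + size c1) c2.
Proof.
move=> h; split=> i hi.
  by rewrite h ?size_cat ?nth_cat ?hi // ltn_addr.
rewrite -addnA h ?size_cat ?ltn_add2l // nth_cat ltnNge leq_addr /=.
by rewrite addKn.
Qed.

Lemma code_at_cons P b i c :
  code_at P b (i :: c) -> nth IHalt P b = i /\ code_at P b.+1 c.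
Proof.
by move=> h; split=> [|j hj]; [rewrite -[b]addn0 h | rewrite addSnnS h].
Qed.

(** * A language of bounded loops compiled to the machine *)

Inductive expr : Type :=
| EC (n : nat)
| EV (x : nat)
| EI (i : nat)
| EA (a : nat) (e : expr)
| EAdd (e1 e2 : expr)
| ESub (e1 e2 : expr)
| EIf (c e1 e2 : expr)
| ESum (x : nat) (e : expr).

Inductive cmd : Type :=
| CSet (x : nat) (e : expr)
| CArr (a x : nat) (e : expr)
| CSeq (c1 c2 : cmd)
| CFor (i x : nat) (c : cmd).

Record store := Store { sc : nat -> nat; ar : nat -> nat -> nat }.

Definition set_sc (s : store) (x v : nat) : store := Store (upd (sc s) x v) (ar s).

Definition set_ar (s : store) (a : nat) (f : nat -> nat) : store :=
  Store (sc s) (fun b => if b == a then f else ar s b).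

(* [EI i] is a de Bruijn level: [ESum x e], met under [d] binders, binds level [d]. *)
Fixpoint eval (s : store) (r : nat -> nat) (d : nat) (e : expr) : nat :=
  match e with
  | EC n => n
  | EV x => sc s x
  | EI i => r i
  | EA a e => ar s a (eval s r d e)
  | EAdd e1 e2 => eval s r d e1 + eval s r d e2
  | ESub e1 e2 => eval s r d e1 - eval s r d e2
  | EIf c e1 e2 => if eval s r d c != 0 then eval s r d e1 else eval s r d e2
  | ESum x e => \sum_(i < sc s x) eval s (upd r d i) d.+1 e
  end.

Definition r0 : nat -> nat := fun=> 0.

(** [CArr] computes all entries from the old store. The compiled code writes them one after the
    other, which agrees because [wf_c] forbids [e] to read [a]. After [CFor] the counter holds the
    bound, as on the machine. *)
Fixpoint den (c : cmd) (s : store) : store :=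
  match c with
  | CSet x e => set_sc s x (eval s r0 0 e)
  | CArr a x e =>
      set_ar s a (fun i => if i < sc s x then eval s (upd r0 0 i) 1 e else ar s a i)
  | CSeq c1 c2 => den c2 (den c1 s)
  | CFor i x c =>
      set_sc (foldl (fun s j => den c (set_sc s i j)) s (iota 0 (sc s x))) i (sc s x)
  end.

(* Scalars live below 48, indices of sums in 48-63, temporaries in 64-127; from 128 on, 16 arrays
   of unbounded length are interleaved. *)
Definition nS := 48.
Definition regI (i : nat) := 48 + i.
Definition regT (t : nat) := 64 + t.
Definition cell (a i : nat) := 128 + 16 * i + a.

Definition mov (x y : nat) := [:: IConst x 0; IAdd x x y].
Definition goto (t l : nat) := [:: IConst t 0; IJz t l].
Definition incr (x t : nat) := [:: IConst t 1; IAdd x x t].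
(* turns the index held by register [x] into the address of that entry of array [a] *)
Definition addr (a x t : nat) :=
  [:: IAdd x x x; IAdd x x x; IAdd x x x; IAdd x x x; IConst t (128 + a); IAdd x x t].

Arguments goto : simpl never.
Arguments incr : simpl never.
Arguments addr : simpl never.

Fixpoint sz_e (e : expr) : nat :=
  match e with
  | EC _ => 1
  | EV _ => 2
  | EI _ => 2
  | EA _ e => sz_e e + 7
  | EAdd e1 e2 | ESub e1 e2 => sz_e e1 + sz_e e2 + 1
  | EIf c e1 e2 => sz_e c + sz_e e1 + sz_e e2 + 3
  | ESum _ e => sz_e e + 9
  end.

(** Jumps are absolute, so the code depends on its start [b]; its size does not, and [sz_e] gives
    the targets before the code is known. The value lands in [regT t]; higher levels are scratch,
    and [regI d] holds the index of the next sum. *)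
Fixpoint comp_e (b d t : nat) (e : expr) : seq instr :=
  let T := regT t in let T1 := regT t.+1 in
  match e with
  | EC n => [:: IConst T n]
  | EV x => mov T x
  | EI i => mov T (regI i)
  | EA a e => comp_e b d t e ++ addr a T T1 ++ [:: ILoad T T]
  | EAdd e1 e2 =>
      comp_e b d t e1 ++ comp_e (b + sz_e e1) d t.+1 e2 ++ [:: IAdd T T T1]
  | ESub e1 e2 =>
      comp_e b d t e1 ++ comp_e (b + sz_e e1) d t.+1 e2 ++ [:: ISub T T T1]
  | EIf c e1 e2 =>
      let b1 := (b + sz_e c).+1 in let b2 := b1 + sz_e e1 + 2 in
      comp_e b d t c ++ [:: IJz T b2] ++ comp_e b1 d t e1 ++
      goto T1 (b2 + sz_e e2) ++ comp_e b2 d t e2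
  | ESum x e =>
      let I := regI d in
      [:: IConst T 0; IConst I 0; ISub T1 x I; IJz T1 (b + sz_e e + 9)] ++
      comp_e b.+4 d.+1 t.+1 e ++
      [:: IAdd T T T1] ++ incr I T1 ++ [:: IConst T1 0; IJz T1 b.+2]
  end.

Lemma size_comp_e b d t e : size (comp_e b d t e) = sz_e e.
Proof.
elim: e b d t => //= [a e IH|e1 IH1 e2 IH2|e1 IH1 e2 IH2|c IHc e1 IH1 e2 IH2|x e IH] b d t.
- by rewrite size_cat IH.
- by rewrite !size_cat IH1 IH2 /=; lia.
- by rewrite !size_cat IH1 IH2 /=; lia.
- by rewrite !(size_cat, IHc) /= !(size_cat, IH1) /= IH2; lia.
by rewrite size_cat IH /=; lia.
Qed.

(* [Ps] lists the scalars that may serve as loop bounds. *)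
Fixpoint wf_e (Ps : seq nat) (d t : nat) (e : expr) : bool :=
  (t < 60) && match e with
  | EC _ => true
  | EV x => x < nS
  | EI i => i < d
  | EA a e => (a < 16) && wf_e Ps d t e
  | EAdd e1 e2 | ESub e1 e2 => wf_e Ps d t e1 && wf_e Ps d t.+1 e2
  | EIf c e1 e2 => [&& wf_e Ps d t c, wf_e Ps d t e1 & wf_e Ps d t e2]
  | ESum x e => [&& x < nS, x \in Ps, d < 16 & wf_e Ps d.+1 t.+1 e]
  end.

(** Besides its body, a round of a sum takes 7 instructions: 2 for the test, 1 for the addition, 2
    for the increment, 2 to jump back. The 4 are the initialisation and the final test. A
    conditional is charged for both branches. *)
Fixpoint tb_e (B : nat) (e : expr) : nat :=
  match e with
  | EC _ => 1
  | EV _ => 2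
  | EI _ => 2
  | EA _ e => tb_e B e + 7
  | EAdd e1 e2 | ESub e1 e2 => tb_e B e1 + tb_e B e2 + 1
  | EIf c e1 e2 => tb_e B c + tb_e B e1 + tb_e B e2 + 3
  | ESum _ e => B * (tb_e B e + 7) + 4
  end.

Definition sim (s : store) (m : nat -> nat) : Prop :=
  (forall x, x < nS -> m x = sc s x) /\
  (forall a i, a < 16 -> m (cell a i) = ar s a i).

Definition sim_e (s : store) (r : nat -> nat) (d : nat) (m : nat -> nat) : Prop :=
  sim s m /\ forall i, i < d -> m (regI i) = r i.

(* the registers that code compiled at depth [d] and stack level [t] must preserve *)
Definition same (d t : nat) (m m' : nat -> nat) : Prop :=
  forall x, [|| x < regI d, (regI 16 <= x) && (x < regT t) | 128 <= x] -> m' x = m x.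

Lemma same_trans d t d' t' m m1 m2 : d <= d' -> t <= t' ->
  same d t m m1 -> same d' t' m1 m2 -> same d t m m2.
Proof.
move=> ld lt h1 h2 x hx; rewrite h2 ?h1 //.
move: hx; rewrite /regI /regT; lia.
Qed.

Lemma sim_e_same s r d t m m' : d <= 16 -> same d t m m' -> sim_e s r d m -> sim_e s r d m'.
Proof.
move=> ld h [[hs ha] hi]; split; first split.
- by move=> x hx; rewrite h ?hs // /regI; move: hx; rewrite /nS; lia.
- by move=> a i la; rewrite h ?ha // /cell; lia.
by move=> i ii; rewrite h ?hi // /regI; lia.
Qed.

Lemma updE m a v i : upd m a v i = if i == a then v else m i. Proof. by []. Qed.

Lemma upd_same d t m m' x v : same d t m m' ->
  ~~ [|| x < regI d, (regI 16 <= x) && (x < regT t) | 128 <= x] -> same d t m (upd m' x v).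
Proof.
move=> h hx y hy; rewrite updE; case: eqP => [E|_]; last exact: h.
by move: hx; rewrite -E hy.
Qed.

Fixpoint exec (c : seq instr) (m : nat -> nat) : nat -> nat :=
  match c with
  | [::] => m
  | IConst r v :: c => exec c (upd m r v)
  | IAdd r a b :: c => exec c (upd m r (m a + m b))
  | ISub r a b :: c => exec c (upd m r (m a - m b))
  | ILoad r a :: c => exec c (upd m r (m (m a)))
  | IStore a r :: c => exec c (upd m (m a) (m r))
  | _ :: c => exec c m
  end.

Definition straight (c : seq instr) : bool :=
  all (fun i => match i with IJz _ _ | IHalt => false | _ => true end) c.

Lemma exec_cat c1 c2 m : exec (c1 ++ c2) m = exec c2 (exec c1 m).
Proof. by elim: c1 m => //= -[]. Qed.

Lemma reach_exec P b c m : code_at P b c -> straight c ->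
  reach P (size c) (State b m) (State (b + size c) (exec c m)).
Proof.
elim: c b m => [|i c IH] b m /=; first by rewrite addn0 => _ _; apply: reach_refl.
case/code_at_cons=> hb ha /andP[hi hc]; rewrite addnS -addSn.
by case: i hi hb => // [r v|r x y|r x y|r x|x r] _ hb;
  (apply: reach_step; first by rewrite /step hb); apply: IH.
Qed.

Lemma reach_jz P b m r l t s' : nth IHalt P b = IJz r l ->
  reach P t (State (if m r == 0 then l else b.+1) m) s' -> reach P t.+1 (State b m) s'.
Proof. by move=> h; apply: reach_step; rewrite /step h. Qed.

Lemma reach_goto P b t l m T s' : code_at P b (goto t l) ->
  reach P T (State l (upd m t 0)) s' -> reach P T.+2 (State b m) s'.
Proof.
move=> /code_at_cons[h1 /code_at_cons[h2 _]] h.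
apply: reach_step; first by rewrite /step h1.
by apply: (reach_jz h2); rewrite updE eqxx.
Qed.

Ltac upds := rewrite ?updE; repeat (case: ifP => /eqP ?; try by rewrite /regI /regT /cell /= in *; lia).

Lemma updN m a v i : i != a -> upd m a v i = m i.
Proof. by rewrite updE => /negbTE->. Qed.

Ltac neq := by rewrite /regI /regT /cell; lia.

Lemma exec_addr a x t m : x != t ->
  exec (addr a x t) m x = cell a (m x) /\
  (forall y, y != x -> y != t -> exec (addr a x t) m y = m y).
Proof.
move=> /eqP h; rewrite /addr [exec _ _]/=; split=> [|y /eqP hy /eqP hy']; last by upds.
rewrite !updE !eqxx; case: ifP => [/eqP ?|_]; rewrite /cell; lia.
Qed.

Lemma comp_eP P B Ps s (hB : forall x, x \in Ps -> sc s x <= B) e b d t r m :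
  d <= 16 -> wf_e Ps d t e -> code_at P b (comp_e b d t e) -> sim_e s r d m ->
  exists m', [/\ reach P (tb_e B e) (State b m) (State (b + sz_e e) m'),
    same d t m m' & m' (regT t) = eval s r d e].
Proof.
elim: e b d t r m => [n|x|i|a e IH|e1 IH1 e2 IH2|e1 IH1 e2 IH2|c IHc e1 IH1 e2 IH2|x e IH]
  b d t r m ld /=.
- move=> lt hc hm; exists (exec [:: IConst (regT t) n] m); split; first by apply: (reach_exec m hc).
    by rewrite /=; apply: upd_same; last by rewrite /regI /regT; lia.
  by rewrite /= updE eqxx.
- case/andP=> lt lx hc hm; exists (exec (mov (regT t) x) m); split; first by apply: (reach_exec m hc).
    by rewrite /=; do 2!(apply: upd_same; last by rewrite /regI /regT; lia).
  by rewrite /= !updE eqxx; case: ifP => [/eqP E|_]; [move: lx; rewrite /nS /regT in E *; lia|rewrite hm.1.1].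
- case/andP=> lt li hc hm; exists (exec (mov (regT t) (regI i)) m); split; first by apply: (reach_exec m hc).
    by rewrite /=; do 2!(apply: upd_same; last by rewrite /regI /regT; lia).
  rewrite /= !updE eqxx; case: ifP => [/eqP E|_]; [|by rewrite hm.2].
  by rewrite /regI /regT in E *; lia.
- case/and3P=> lt la he /code_at_cat[h1 h2] hm.
  have [m1 [R1 S1 V1]] := IH _ _ _ _ _ ld he h1 hm.
  rewrite size_comp_e in h2; have R2 := reach_exec m1 h2 isT.
  have hT : regT t != regT t.+1 by rewrite /regT; lia.
  have [A1 A2] := exec_addr a m1 hT.
  exists (exec (addr a (regT t) (regT t.+1) ++ [:: ILoad (regT t) (regT t)]) m1); split.
  + by rewrite addnA; apply: reach_trans R1 R2.
  + apply: (same_trans (leqnn _) (leqnn _) S1); rewrite exec_cat.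
    set m2 := exec (addr _ _ _) _ in A1 A2 *; rewrite /=.
    apply: upd_same => [y hy|]; last by rewrite /regI /regT; lia.
    by apply: A2; apply/eqP; rewrite /regI /regT in hy *; lia.
  + rewrite exec_cat; set m2 := exec (addr _ _ _) _ in A1 A2 *.
    rewrite /= updE eqxx A1 V1 A2.
    * by have [[_ ->]] := sim_e_same ld S1 hm.
    * by rewrite /cell /regT; lia.
    * by rewrite /cell /regT; lia.
- case/and3P=> lt w1 w2 /code_at_cat[h1 /code_at_cat[h2 h3]] hm.
  have [m1 [R1 S1 V1]] := IH1 _ _ _ _ _ ld w1 h1 hm.
  rewrite !size_comp_e in h2 h3; have hm1 := sim_e_same ld S1 hm.
  have [m2 [R2 S2 V2]] := IH2 _ _ _ _ _ ld w2 h2 hm1.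
  exists (exec [:: IAdd (regT t) (regT t) (regT t.+1)] m2); split.
  + rewrite !addnA; apply: reach_trans (reach_exec m2 h3 isT) => //.
    exact: reach_trans R1 R2.
  + apply: upd_same; last by rewrite /regI /regT; lia.
    exact: (same_trans (leqnn _) (leqnSn _) S1).
  + by rewrite /= updE eqxx V2 S2 ?V1 // /regT /regI; lia.
- case/and3P=> lt w1 w2 /code_at_cat[h1 /code_at_cat[h2 h3]] hm.
  have [m1 [R1 S1 V1]] := IH1 _ _ _ _ _ ld w1 h1 hm.
  rewrite !size_comp_e in h2 h3; have hm1 := sim_e_same ld S1 hm.
  have [m2 [R2 S2 V2]] := IH2 _ _ _ _ _ ld w2 h2 hm1.
  exists (exec [:: ISub (regT t) (regT t) (regT t.+1)] m2); split.
  + rewrite !addnA; apply: reach_trans (reach_exec m2 h3 isT) => //.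
    exact: reach_trans R1 R2.
  + apply: upd_same; last by rewrite /regI /regT; lia.
    exact: (same_trans (leqnn _) (leqnSn _) S1).
  + by rewrite /= updE eqxx V2 S2 ?V1 // /regT /regI; lia.
- case/and4P=> lt wc w1 w2 /code_at_cat[hc /code_at_cons[hj /code_at_cat[h1 h2]]] hm.
  have {h2} [hg h2] := code_at_cat (c1 := goto _ _) h2.
  rewrite !size_comp_e in hj h1 hg h2.
  have [m0 [R0 S0 V0]] := IHc _ _ _ _ _ ld wc hc hm.
  have hm0 := sim_e_same ld S0 hm.
  have [E|E] := eqVneq (eval s r d c) 0 => /=.
    have [m2 [R2 S2 V2]] := IH2 _ _ _ _ _ ld w2 h2 hm0.
    exists m2; split=> //; last exact: same_trans S0 S2.
    have -> : tb_e B c + tb_e B e1 + tb_e B e2 + 3 =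
              tb_e B c + (tb_e B e2 + tb_e B e1 + 2).+1 by lia.
    apply: reach_trans R0 _; apply: (reach_jz hj); rewrite V0 E eqxx.
    have -> : b + (sz_e c + sz_e e1 + sz_e e2 + 3) = (b + sz_e c).+1 + sz_e e1 + 2 + sz_e e2 by lia.
    by apply: reach_le R2; lia.
  have [m1 [R1 S1 V1]] := IH1 _ _ _ _ _ ld w1 h1 hm0.
  exists (upd m1 (regT t.+1) 0); split.
  + have -> : tb_e B c + tb_e B e1 + tb_e B e2 + 3 =
              tb_e B c + (tb_e B e1 + (tb_e B e2).+2).+1 by lia.
    apply: reach_trans R0 _; apply: (reach_jz hj); rewrite V0 (negbTE E).
    apply: reach_trans R1 _; apply: (reach_goto hg).
    have -> : b + (sz_e c + sz_e e1 + sz_e e2 + 3) = (b + sz_e c).+1 + sz_e e1 + 2 + sz_e e2 by lia.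
    exact: reach_refl.
  + apply: upd_same; last by rewrite /regI /regT; lia.
    exact: same_trans S0 S1.
  + by rewrite updN //; neq.
- case/and5P=> lt lx xP d16 he.
  rewrite -[[:: _, _, _, _ & _]]/([:: IConst (regT t) 0; IConst (regI d) 0] ++
    [:: ISub (regT t.+1) x (regI d)] ++ [:: IJz (regT t.+1) (b + sz_e e + 9)] ++ _).
  move=> /code_at_cat[h1 /code_at_cat[h2 h3]] hm.
  have {h3} [h3 h4] := code_at_cons h3.
  have {h4} [h4 h5] := code_at_cat h4.
  have {h5} [h5 h6] := code_at_cat (c1 := [:: _; _; _]) h5.
  rewrite ?size_comp_e ?[size [:: _]]/= ?[size [:: _; _]]/= ?[size [:: _; _; _]]/= in h1 h2 h3 h4 h5 h6.
  rewrite !addn1 !addn2 in h2 h3 h4 h5 h6.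
  (* [k] counts the rounds that remain, so that the time bound is proportional to it. *)
  have loop k m0 : k <= sc s x -> sim_e s r d m0 -> m0 (regI d) = sc s x - k ->
      m0 (regT t) = \sum_(i < sc s x - k) eval s (upd r d i) d.+1 e ->
      exists m', [/\ reach P (k * (tb_e B e + 7) + 2) (State b.+2 m0) (State (b + sz_e e + 9) m'),
        same d t m0 m' & m' (regT t) = \sum_(i < sc s x) eval s (upd r d i) d.+1 e].
    elim: k m0 => [|k IHk] m0 lk r0' mI mT.
      exists (exec [:: ISub (regT t.+1) x (regI d)] m0); split.
      - apply: (reach_trans (t1 := 1)); first exact: (reach_exec m0 h2 isT).
        rewrite addn1; apply: (reach_jz h3).
        rewrite /= updE eqxx mI subn0 r0'.1.1 // subnn eqxx; exact: reach_refl.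
      - by apply: upd_same; last by rewrite /regI /regT; lia.
      - by rewrite /= updN ?mT ?subn0 //; neq.
    set j := sc s x - k.+1 in mI mT.
    have S1 : same d t.+1 m0 (exec [:: ISub (regT t.+1) x (regI d)] m0).
      by apply: upd_same; last by rewrite /regI /regT; lia.
    set m1 := exec _ _ in S1.
    have hm1 : sim_e s (upd r d j) d.+1 m1.
      have [H1 H2] := sim_e_same ld S1 r0'; split=> // i; rewrite ltnS leq_eqVlt updE.
      case: eqP => [-> _|_ /= hi]; last exact: H2.
      by rewrite -mI /m1 /= updN //; neq.
    have [m2 [R2 S2 V2]] := IH _ _ _ _ _ d16 he h4 hm1.
    have I2 : m2 (regI d) = j by rewrite S2 /m1 /= ?updN ?mI //; rewrite /regI /regT; lia.
    have T2 : m2 (regT t) = m0 (regT t) by rewrite S2 /m1 /= ?updN //; rewrite /regI /regT; lia.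
    pose c3 := [:: IAdd (regT t) (regT t) (regT t.+1); IConst (regT t.+1) 1;
                  IAdd (regI d) (regI d) (regT t.+1)].
    pose m4 := upd (exec c3 m2) (regT t.+1) 0.
    have S4 : same d t m0 m4.
      apply: upd_same; last by rewrite /regI /regT; lia.
      rewrite /=; do 3!(apply: upd_same; last by rewrite /regI /regT; lia).
      apply: (same_trans (leqnSn _) (leqnSn _) _ S2).
      by apply: upd_same; last by rewrite /regI /regT; lia.
    have I4 : m4 (regI d) = j.+1.
      rewrite /m4 /= updN; last by neq.
      by rewrite updE eqxx [X in _ + X]updE eqxx updN ?updN ?I2 ?addn1 //; neq.
    have T4 : m4 (regT t) = \sum_(i < j.+1) eval s (upd r d i) d.+1 e.
      rewrite /m4 /= updN; last by neq.
      rewrite updN; last by neq.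
      rewrite updN; last by neq.
      by rewrite updE eqxx T2 mT V2 big_ord_recr.
    have jk : j.+1 = sc s x - k by rewrite /j; lia.
    rewrite jk in I4 T4.
    have [m5 [R5 S5 V5]] := IHk m4 (ltnW lk) (sim_e_same ld S4 r0') I4 T4.
    exists m5; split=> //; last exact: same_trans S4 S5.
    have -> : k.+1 * (tb_e B e + 7) + 2 =
      1 + (tb_e B e + (3 + (k * (tb_e B e + 7) + 2).+2)).+1 by lia.
    apply: reach_trans; first exact: (reach_exec m0 h2 isT).
    rewrite addn1; apply: (reach_jz h3); rewrite -/m1.
    have -> : m1 (regT t.+1) == 0 = false.
      by rewrite /m1 /= updE eqxx mI r0'.1.1 // /j; lia.
    apply: reach_trans R2 _.
    apply: reach_trans; first exact: (reach_exec m2 h5 isT).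
    by apply: (reach_goto h6).
  set m0 := exec [:: IConst (regT t) 0; IConst (regI d) 0] m.
  have S0 : same d t m m0.
    by do 2!(apply: upd_same; last by rewrite /regI /regT; lia).
  have [||m' [R' S' V']] := loop _ m0 (leqnn _) (sim_e_same ld S0 hm); rewrite ?subnn.
  + by rewrite /m0 /= updE eqxx.
  + by rewrite /m0 /= updN ?updE ?eqxx ?big_ord0 //; neq.
  exists m'; split=> //; last exact: same_trans S0 S'.
  have R0 := reach_exec m h1 isT; rewrite [size _]/= addn2 in R0.
  rewrite addnA; apply: reach_le (reach_trans R0 R'); rewrite /=.
  have := leq_mul (hB _ xP) (leqnn (tb_e B e + 7)); lia.
Qed.

(** * Commands and their compilation *)

Fixpoint reads (a : nat) (e : expr) : bool :=
  match e with
  | EA b e => (b == a) || reads a e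
  | EAdd e1 e2 | ESub e1 e2 => reads a e1 || reads a e2
  | EIf c e1 e2 => [|| reads a c, reads a e1 | reads a e2]
  | ESum _ e => reads a e
  | _ => false
  end.

Fixpoint wr_sc (c : cmd) : seq nat :=
  match c with
  | CSet x _ => [:: x]
  | CArr _ _ _ => [::]
  | CSeq c1 c2 => wr_sc c1 ++ wr_sc c2
  | CFor i _ c => i :: wr_sc c
  end.

Fixpoint wr_ar (c : cmd) : seq nat :=
  match c with
  | CSet _ _ => [::]
  | CArr a _ _ => [:: a]
  | CSeq c1 c2 => wr_ar c1 ++ wr_ar c2
  | CFor _ _ c => wr_ar c
  end.

Lemma den_sc c s x : x \notin wr_sc c -> sc (den c s) x = sc s x.
Proof.
elim: c s => [y e|a y e|c1 IH1 c2 IH2|i y c IH] s //=.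
- by rewrite inE => /updN->.
- by rewrite mem_cat negb_or => /andP[h1 h2]; rewrite IH2 ?IH1.
rewrite inE negb_or => /andP[h1 h2]; rewrite updN //.
by move: (iota _ _) => l; elim: l s => //= j l IHl s; rewrite IHl IH //= updN.
Qed.

Lemma den_ar c s a : a \notin wr_ar c -> ar (den c s) a = ar s a.
Proof.
elim: c s => [y e|b y e|c1 IH1 c2 IH2|i y c IH] s //=.
- by rewrite inE => /negbTE->.
- by rewrite mem_cat negb_or => /andP[h1 h2]; rewrite IH2 ?IH1.
by move=> h; move: (iota _ _) => l; elim: l s => //= j l IHl s; rewrite IHl IH.
Qed.

Lemma eval_set_ar s a f r d e : ~~ reads a e -> eval (set_ar s a f) r d e = eval s r d e.
Proof.
elim: e r d => [n|x|i|b e IH|e1 IH1 e2 IH2|e1 IH1 e2 IH2|c IHc e1 IH1 e2 IH2|x e IH] r d //=;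
  rewrite ?negb_or.
- by case/andP=> /negbTE h /IH->; rewrite h.
- by case/andP=> /IH1-> /IH2->.
- by case/andP=> /IH1-> /IH2->.
- by case/and3P=> /IHc-> /IH1-> /IH2->.
by move=> h; apply: eq_bigr => i _; apply: IH.
Qed.

(** Scalars in [Ps] bound loops and are never assigned, so a bound [B] on them at the start of a
    command stays valid throughout it. The body of a loop must not write the counter, since the
    machine counts with it. *)
Fixpoint wf_c (Ps : seq nat) (c : cmd) : bool :=
  match c with
  | CSet x e => [&& x < nS, x \notin Ps & wf_e Ps 0 0 e]
  | CArr a x e => [&& a < 16, x < nS, x \in Ps, wf_e Ps 1 0 e & ~~ reads a e]
  | CSeq c1 c2 => wf_c Ps c1 && wf_c Ps c2
  | CFor i x c => [&& i < nS, x < nS, x \in Ps, i \notin Ps, i \notin wr_sc c & wf_c Ps c]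
  end.

Lemma wf_c_wr Ps c x : wf_c Ps c -> x \in Ps -> x \notin wr_sc c.
Proof.
elim: c => [y e|a y e|c1 IH1 c2 IH2|i y c IH] //=.
- by case/and3P=> _ /negP h _ hx; rewrite inE; apply/eqP=> E; rewrite E in hx.
- by case/andP=> h1 h2 hx; rewrite mem_cat negb_or IH1 ?IH2.
case/and5P=> _ _ _ /negP h /andP[_ hc] hx; rewrite inE negb_or IH // andbT.
by apply/eqP=> E; rewrite E in hx.
Qed.

Fixpoint sz_c (c : cmd) : nat :=
  match c with
  | CSet _ e => sz_e e + 2
  | CArr _ _ e => sz_e e + 16
  | CSeq c1 c2 => sz_c c1 + sz_c c2
  | CFor _ _ c => sz_c c + 7
  end.

Fixpoint comp_c (b : nat) (c : cmd) : seq instr :=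
  let T := regT 0 in let T1 := regT 1 in let I := regI 0 in
  match c with
  | CSet x e => comp_e b 0 0 e ++ mov x T
  | CArr a x e =>
      [:: IConst I 0; ISub T x I; IJz T (b + (sz_e e + 16))] ++ comp_e b.+3 1 0 e ++
      (mov T1 I ++ addr a T1 (regT 2) ++ [:: IStore T1 T] ++ incr I T1) ++ goto T1 b.+1
  | CSeq c1 c2 => comp_c b c1 ++ comp_c (b + sz_c c1) c2
  | CFor i x c =>
      [:: IConst i 0; ISub T x i; IJz T (b + (sz_c c + 7))] ++ comp_c b.+3 c ++
      incr i T ++ goto T b.+1
  end.

Lemma size_comp_c b c : size (comp_c b c) = sz_c c.
Proof.
elim: c b => [x e|a x e|c1 IH1 c2 IH2|i x c IH] b /=; rewrite ?size_cat ?size_comp_e //=.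
- by lia.
- by rewrite IH1 IH2.
by rewrite IH /=; lia.
Qed.

Fixpoint tb_c (B : nat) (c : cmd) : nat :=
  match c with
  | CSet _ e => tb_e B e + 2
  | CArr _ _ e => B * (tb_e B e + 15) + 3
  | CSeq c1 c2 => tb_c B c1 + tb_c B c2
  | CFor _ _ c => B * (tb_c B c + 6) + 3
  end.

Lemma sim_same s m m' : (forall x, (x < nS) || (128 <= x) -> m' x = m x) -> sim s m -> sim s m'.
Proof.
move=> h [h1 h2]; split=> [x hx|a i ha]; first by rewrite h ?hx ?h1.
by rewrite h ?h2 // /cell; lia.
Qed.

Lemma same_sim s d t m m' : d <= 16 -> same d t m m' -> sim s m -> sim s m'.
Proof. by move=> ld h; apply: sim_same => x hx; apply: h; move: hx; rewrite /regI /nS; lia. Qed.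

Lemma sim_upd s m x v : x < nS -> sim s m -> sim (set_sc s x v) (upd m x v).
Proof.
move=> lx [h1 h2]; split=> [y hy|a i ha] /=; first by rewrite /upd; case: eqP => // _; apply: h1.
by rewrite updN ?h2 // /cell; move: lx; rewrite /nS; lia.
Qed.

Lemma sim_upd_tmp s m x v : nS <= x < 128 -> sim s m -> sim s (upd m x v).
Proof.
by move=> hx; apply: sim_same => y hy; rewrite updN //; move: hx hy; rewrite /nS; lia.
Qed.

Lemma cell_eq a b i j : a < 16 -> b < 16 -> (cell a i == cell b j) = (a == b) && (i == j).
Proof. by rewrite /cell; lia. Qed.

Lemma comp_cP P B Ps c b s m :
  (forall x, x \in Ps -> sc s x <= B) ->
  wf_c Ps c -> code_at P b (comp_c b c) -> sim s m ->
  exists2 m', reach P (tb_c B c) (State b m) (State (b + sz_c c) m') & sim (den c s) m'.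
Proof.
elim: c b s m => [x e|a x e|c1 IH1 c2 IH2|i x c IH] b s m hB /=.
- case/and3P=> lx xP we /code_at_cat[h1 h2] hm.
  have [//|m1 [R1 S1 V1]] := comp_eP hB (leq0n _) we h1 (r := r0) (m := m).
  rewrite size_comp_e in h2.
  exists (exec (mov x (regT 0)) m1).
    by rewrite addnA; apply: reach_trans R1 (reach_exec m1 h2 isT).
  have hm1 := same_sim (leq0n _) S1 hm.
  have := sim_upd (eval s r0 0 e) lx hm1; rewrite -V1; apply: sim_same => y _ /=.
  have nx : regT 0 != x by move: lx; rewrite /nS /regT; lia.
  by rewrite /upd eqxx (negbTE nx); case: eqP.
- case/and5P=> la lx xP we nr /code_at_cons[h0].
  rewrite -[[:: _, _ & _]]/([:: ISub (regT 0) x (regI 0)] ++ _) => /code_at_cat[h1].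
  move=> /code_at_cons[h2 /code_at_cat[h3 h4]] hm.
  pose c4 := mov (regT 1) (regI 0) ++ addr a (regT 1) (regT 2) ++
    [:: IStore (regT 1) (regT 0)] ++ incr (regI 0) (regT 1).
  have {h4} [h4 h5] := code_at_cat (c1 := c4) h4.
  rewrite size_comp_e ?[size _]/= in h3 h4 h5; rewrite !addn1 in h2 h3 h4 h5.
  (* [S j] is the store after [j] entries are written; [e] has the same value there as in [s]. *)
  set S := fun j => set_ar s a (fun i => if i < j then eval s (upd r0 0 i) 1 e else ar s a i).
  have loop k m0 : k <= sc s x -> sim (S (sc s x - k)) m0 -> m0 (regI 0) = sc s x - k ->
    exists2 m', reach P (k * (tb_e B e + 15) + 2) (State b.+1 m0) (State (b + (sz_e e + 16)) m')
      & sim (S (sc s x)) m'.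
    elim: k m0 => [|k IHk] m0 lk hS hI.
      exists (exec [:: ISub (regT 0) x (regI 0)] m0).
        apply: (reach_trans (t1 := 1)); first exact: (reach_exec m0 h1 isT).
        rewrite addn1; apply: (reach_jz h2).
        by rewrite /= updE eqxx hI (hS.1 x lx) subn0 subnn eqxx; apply: reach_refl.
      by rewrite subn0 in hS; apply: sim_upd_tmp.
    set j := sc s x - k.+1 in hS hI.
    have hS1 := sim_upd_tmp (m0 x - m0 (regI 0)) (isT : nS <= regT 0 < 128) hS.
    have [|m2 [R2 S2 V2]] := @comp_eP P B Ps (S j) hB e b.+3 1 0 (upd r0 0 j)
      (exec [:: ISub (regT 0) x (regI 0)] m0) isT we h3.
      by split; first exact: hS1; case=> // _; rewrite updN // hI.
    rewrite eval_set_ar // in V2.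
    have hS2 := same_sim (isT : 1 <= 16) S2 hS1.
    have I2 : m2 (regI 0) = j by rewrite S2 // updN.
    have hT : regT 1 != regT 2 by [].
    have [A1 A2] := exec_addr a (exec (mov (regT 1) (regI 0)) m2) hT.
    set ma := exec (addr _ _ _) _ in A1 A2.
    have {}A1 : ma (regT 1) = cell a j by rewrite A1 /= updE eqxx updE updN // I2.
    have {}A2 y : y != regT 1 -> y != regT 2 -> ma y = m2 y.
      by move=> y1 y2; rewrite A2 //= !updN.
    have E4 : exec c4 m2 = upd (upd (upd ma (cell a j) (ma (regT 0))) (regT 1) 1) (regI 0) j.+1.
      rewrite /c4 exec_cat exec_cat -/ma [exec _ _]/= A1 /=; congr (upd _ _ _).
      have cI : regI 0 != cell a j by neq.
      by rewrite updN // updN // A2 // updE eqxx I2 addn1.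
    have r4 : sim (S j.+1) (upd (exec c4 m2) (regT 1) 0).
      rewrite E4; do 3!apply: sim_upd_tmp => //.
      split=> [y hy|a' i ha] /=.
        rewrite updN; last by rewrite /cell; move: hy; rewrite /nS; lia.
        by rewrite A2 ?hS2.1 //; move: hy; rewrite /nS /regT; lia.
      rewrite updE cell_eq // (eq_sym a').
      have [E|N] := eqVneq a a'; last first.
        rewrite /= A2; [|by neq|by neq]; rewrite hS2.2 //=.
        by rewrite eq_sym (negbTE N).
      rewrite -E A2 // V2 /= ltnS leq_eqVlt; case: eqP => [->//|_] /=.
      by rewrite A2; [|neq|neq]; rewrite hS2.2 //= eqxx.
    have jk : j.+1 = sc s x - k by rewrite /j; lia.
    rewrite jk in r4; have [|m5 R5 r5] := IHk _ (ltnW lk) r4.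
      by rewrite updN // E4 updE eqxx.
    exists m5 => //.
    have -> : k.+1 * (tb_e B e + 15) + 2 =
      1 + (tb_e B e + (11 + (k * (tb_e B e + 15) + 2).+2)).+1 by lia.
    apply: reach_trans; first exact: (reach_exec m0 h1 isT).
    rewrite addn1; apply: (reach_jz h2).
    have -> : exec [:: ISub (regT 0) x (regI 0)] m0 (regT 0) == 0 = false.
      by rewrite /= updE eqxx hI (hS.1 x lx) /= /j; lia.
    apply: reach_trans R2 _.
    apply: reach_trans; first exact: (reach_exec m2 h4 isT).
    by apply: (reach_goto h5).
  have [|//|m' R' r'] := loop _ (upd m (regI 0) 0) (leqnn _).
  - rewrite subnn; apply: sim_upd_tmp => //; case: hm => H1 H2; split=> // a' i ha /=.
    by rewrite H2 //; case: eqP => // ->.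
  - by rewrite subnn.
  exists m' => //; apply: reach_le (reach_step _ R'); last by rewrite /step h0.
  by have := leq_mul (hB _ xP) (leqnn (tb_e B e + 15)); lia.
- case/andP=> w1 w2 /code_at_cat[h1 h2] hm; rewrite size_comp_c in h2.
  have [m1 R1 S1] := IH1 _ _ _ hB w1 h1 hm.
  have [|m2 R2 S2] := IH2 _ _ _ _ w2 h2 S1.
    by move=> x hx; rewrite den_sc ?hB //; apply: wf_c_wr hx.
  by exists m2 => //; rewrite addnA; apply: reach_trans R1 R2.
case/and5P=> li lx xP iP /andP[iw wc] /code_at_cons[h0].
rewrite -[[:: _, _ & _]]/([:: ISub (regT 0) x i] ++ _) => /code_at_cat[h1].
move=> /code_at_cons[h2 /code_at_cat[h3 h4]] hm.
have {h4} [h4 h5] := code_at_cat (c1 := incr _ _) h4.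
rewrite size_comp_c ?[size _]/= in h3 h4 h5; rewrite !addn1 in h2 h3 h4 h5.
(* [S j] is the store after [j] bodies, in which the counter still holds the previous index; the
   invariant therefore sets it to [j] on top. *)
set S := fun j => foldl (fun s j => den c (set_sc s i j)) s (iota 0 j).
have Ssc y j : y \in Ps -> sc (S j) y = sc s y.
  move=> hy; have iy : y != i by apply: contraNneq iP => <-.
  have yw := wf_c_wr wc hy.
  by rewrite /S; elim: j => // j IHj; rewrite -addn1 iotaD foldl_cat /= den_sc //= updN.
have loop k m0 : k <= sc s x -> sim (set_sc (S (sc s x - k)) i (sc s x - k)) m0 ->
    exists2 m', reach P (k * (tb_c B c + 6) + 2) (State b.+1 m0) (State (b + (sz_c c + 7)) m')
      & sim (set_sc (S (sc s x)) i (sc s x)) m'.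
  have xi : x != i by apply: contraNneq iP => <-.
  elim: k m0 => [|k IHk] m0 lk r0'; have Ex : m0 x = sc s x by rewrite r0'.1 //= updN // Ssc.
    have Ei : m0 i = sc s x by rewrite r0'.1 //= updE eqxx subn0.
    exists (exec [:: ISub (regT 0) x i] m0).
      apply: (reach_trans (t1 := 1)); first exact: (reach_exec m0 h1 isT).
      rewrite addn1; apply: (reach_jz h2).
      by rewrite /= updE eqxx Ex Ei subnn eqxx; apply: reach_refl.
    by rewrite subn0 in r0'; apply: sim_upd_tmp.
  set j := sc s x - k.+1 in r0'.
  have Ei : m0 i = j by rewrite r0'.1 //= updE eqxx.
  have Sj : S j.+1 = den c (set_sc (S j) i j) by rewrite /S -addn1 iotaD foldl_cat.
  have r1 := sim_upd_tmp (m0 x - m0 i) (isT : nS <= regT 0 < 128) r0'.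
  have [|m2 R2 r2] := IH _ _ _ _ wc h3 r1.
    move=> y hy; rewrite /= updN ?Ssc ?hB //; by apply: contraNneq iP => <-.
  rewrite -Sj in r2.
  pose m3 := exec (incr i (regT 0)) m2.
  have r4 : sim (set_sc (S j.+1) i j.+1) (upd m3 (regT 0) 0).
    apply: sim_upd_tmp => //.
    have /(sim_upd j.+1 li) := sim_upd_tmp 1 (isT : nS <= regT 0 < 128) r2.
    apply: sim_same => y _; rewrite /m3 /=; congr (upd _ _ _ y).
    have it : i != regT 0 by move: li; rewrite /nS /regT; lia.
    by rewrite updE (negbTE it) updE eqxx (r2.1 i li) Sj den_sc //= updE eqxx addn1.
  have jk : j.+1 = sc s x - k by rewrite /j; lia.
  rewrite jk in r4; have [m5 R5 r5] := IHk _ (ltnW lk) r4.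
  exists m5 => //.
  have -> : k.+1 * (tb_c B c + 6) + 2 =
    1 + (tb_c B c + (2 + (k * (tb_c B c + 6) + 2).+2)).+1 by lia.
  apply: reach_trans; first exact: (reach_exec m0 h1 isT).
  rewrite addn1; apply: (reach_jz h2).
  have -> : exec [:: ISub (regT 0) x i] m0 (regT 0) == 0 = false.
    by rewrite /= updE eqxx Ex Ei /j; lia.
  apply: reach_trans R2 _.
  apply: reach_trans; first exact: (reach_exec m2 h4 isT).
  by apply: (reach_goto h5).
have [|m' R' r'] := loop _ (upd m i 0) (leqnn _); first by rewrite subnn; apply: sim_upd.
exists m' => //; apply: reach_le (reach_step _ R'); last by rewrite /step h0.
by have := leq_mul (hB _ xP) (leqnn (tb_c B c + 6)); lia.
Qed.

(** * Polynomial bounds on running times *)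

Definition poly (f : nat -> nat) : Prop := exists K D, forall B, f B <= K * B.+1 ^ D.

Lemma poly_const n : poly (fun=> n).
Proof. by exists n, 0 => B; rewrite muln1. Qed.

Lemma poly_add f g : poly f -> poly g -> poly (fun B => f B + g B).
Proof.
move=> [K1 [D1 h1]] [K2 [D2 h2]]; exists (K1 + K2), (D1 + D2) => B.
rewrite mulnDl; apply: leq_add; [apply: leq_trans (h1 B) _|apply: leq_trans (h2 B) _];
  by rewrite leq_mul2l leq_pexp2l ?leq_addr ?leq_addl ?orbT.
Qed.

Lemma poly_mul f : poly f -> poly (fun B => B * f B).
Proof.
move=> [K [D h]]; exists K, D.+1 => B.
by rewrite expnS mulnCA; apply: leq_mul.
Qed.

Lemma poly_tb_e e : poly (fun B => tb_e B e).
Proof.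
by elim: e => /= *; do ?[exact: poly_const | assumption | apply: poly_add | apply: poly_mul].
Qed.

(** In a fixed program loops nest to a fixed depth, and each contributes one factor [B]. *)
Lemma poly_tb_c c : poly (fun B => tb_c B c).
Proof.
by elim: c => /= *;
  do ?[exact: poly_const | exact: poly_tb_e | assumption | apply: poly_add | apply: poly_mul].
Qed.

(* Moving the input away from the registers starts with cell 1 as the only free one (its content is
   known to be 1), so the other low cells are first saved beyond every address that the move writes. *)
Definition save_addr (r : nat) := IConst 1 (r + 128) :: nseq 17 (IAdd 1 1 0).

Definition boot_save (rs : seq nat) : seq instr :=
  flatten [seq save_addr r ++ [:: IStore 1 r] | r <- rs].

(** The input cells are moved from the last one down to cell 128. Entry [i] goes up to [cell 0 i],
    which exceeds [i], so no write hits a cell still to be read. Cells 2 to 6 are free for use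
    because they have been saved. *)
Definition boot_move (b : nat) : seq instr :=
  [:: IConst 2 0; IAdd 2 2 0; IConst 3 127; ISub 3 2 3; IJz 3 (b + 19)] ++
  ([:: ILoad 4 2] ++ mov 5 2 ++ addr 0 5 6 ++ [:: IStore 5 4; IConst 3 1; ISub 2 2 3]) ++
  goto 3 b.+2.

Definition boot_restore (rs : seq nat) : seq instr :=
  flatten [seq save_addr r ++ [:: ILoad 2 1; IConst 3 (cell 0 r); IStore 3 2] | r <- rs].

Lemma exec_save_addr r m : exec (save_addr r) m 1 = 128 + 17 * m 0 + r /\
  forall x, x != 1 -> exec (save_addr r) m x = m x.
Proof.
have adds n m0 : exec (nseq n (IAdd 1 1 0)) m0 1 = m0 1 + n * m0 0 /\
    forall x, x != 1 -> exec (nseq n (IAdd 1 1 0)) m0 x = m0 x.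
  elim: n m0 => [|n IH] m0 /=; first by rewrite addn0.
  have [-> h] := IH (upd m0 1 (m0 1 + m0 0)); split=> [|x hx]; last by rewrite h // updN.
  by rewrite updE updN //=; lia.
suff main n : exec (IConst 1 (r + 128) :: nseq n (IAdd 1 1 0)) m 1 = 128 + n * m 0 + r /\
    forall x, x != 1 -> exec (IConst 1 (r + 128) :: nseq n (IAdd 1 1 0)) m x = m x.
  exact: (main 17).
rewrite -[exec _ _]/(exec (nseq n (IAdd 1 1 0)) (upd m 1 (r + 128))).
have [-> h] := adds n (upd m 1 (r + 128)).
by split=> [|x hx]; [rewrite updE updN //=; lia | rewrite [LHS]h // updN].
Qed.

Lemma straight_save_addr r : straight (save_addr r). Proof. by []. Qed.

Opaque save_addr.

Lemma exec_boot_save rs m : all (fun r => 1 < r < 128) rs ->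
  let m' := exec (boot_save rs) m in
  (forall x, x != 1 -> (forall r, r \in rs -> x != 128 + 17 * m 0 + r) -> m' x = m x) /\
  (forall r, r \in rs -> m' (128 + 17 * m 0 + r) = m r).
Proof.
elim: rs m => [|r rs IH] m // /andP[hr hrs].
cbv zeta; rewrite -[boot_save (r :: rs)]/((save_addr r ++ [:: IStore 1 r]) ++ boot_save rs) !exec_cat; have [E1 E2] := exec_save_addr r m.
move: (exec (save_addr r) m) E1 E2 => m0 E1 E2.
rewrite [exec [:: _] _]/=; set m1 := upd m0 _ _.
have H0 : m1 0 = m 0 by rewrite /m1 E1 updN ?E2.
have H1 x : x != 1 -> x != 128 + 17 * m 0 + r -> m1 x = m x.
  by move=> h1 h2; rewrite /m1 E1 updN // E2.
have [A1 A2] := IH m1 hrs; rewrite H0 in A1 A2; split=> [x hx hxr|r'].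
  rewrite A1 //; first by rewrite H1 // hxr // mem_head.
  by move=> r' hr'; apply: hxr; rewrite inE hr' orbT.
rewrite inE; have [hr' _|hr' /= /orP[/eqP Er|//]] := boolP (r' \in rs).
  rewrite A2 // H1 //; have := allP hrs _ hr'; lia.
rewrite A1; last by move=> y hy; apply: contraNneq hr' => E; have <- : y = r' by lia.
  by rewrite Er /m1 E1 updE eqxx E2 //; lia.
by lia.
Qed.

Ltac cl := rewrite ?/cell; lia.

(** On a short input the writes may reach saved cells. The increasing order makes this harmless: for
    [r' < r <= L] the address [cell 0 r'] is below [128 + 17 * L + r]. Beyond [L] the restored
    entries may be garbage, and nothing is claimed of them. *)
Lemma exec_boot_restore L (v : nat -> nat) a k m : 1 < a -> m 0 = L ->
  (forall r, a <= r < a + k -> r <= L -> m (128 + 17 * L + r) = v r) ->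
  let m' := exec (boot_restore (iota a k)) m in
  (forall x, 3 < x \/ x = 0 -> (forall r, a <= r < a + k -> x != cell 0 r) -> m' x = m x) /\
  (forall r, a <= r < a + k -> r <= L -> m' (cell 0 r) = v r).
Proof.
elim: k a m => [|k IH] a m ha h0 hv; first by split=> // r; lia.
cbv zeta; rewrite -[boot_restore (iota a k.+1)]/((save_addr a ++ [:: ILoad 2 1; IConst 3 (cell 0 a); IStore 3 2]) ++
  boot_restore (iota a.+1 k)) !exec_cat.
have [E1 E2] := exec_save_addr a m.
move: (exec (save_addr a) m) E1 E2 => m0 E1 E2.
rewrite [exec [:: _; _; _] _]/= E1 h0.
rewrite (updE _ 3 _ 3) eqxx (updE _ 3 _ 2) [2 == 3]/= (updE _ 2 _ 2) eqxx.
set m1 := upd _ (cell 0 a) _.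
have H1 x : 3 < x \/ x = 0 -> x != cell 0 a -> m1 x = m x.
  move=> h1 h2; rewrite /m1 updN // updN; last by lia.
  by rewrite updN ?E2 //; lia.
have [||r hr rL|] := IH a.+1 m1; first by lia.
- by rewrite H1 //; cl.
- by rewrite H1 ?hv //; cl.
move=> A1 A2; split=> [x hx hxr|r hr rL].
  rewrite A1 //; first by rewrite H1 // hxr //; lia.
  by move=> r hr; apply: hxr; lia.
have [->|hra] := eqVneq r a; last by apply: A2 => //; lia.
rewrite A1; [|by cl|by move=> y hy; cl].
rewrite /m1 updE eqxx E2; last by lia.
by apply: hv; lia.
Qed.

Lemma boot_moveP P b L m : code_at P b (boot_move b) -> m 0 = L ->
  exists m', [/\ reach P (17 * L + 5) (State b m) (State (b + 19) m'), m' 0 = L,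
    (forall i, 127 < i <= L -> m' (cell 0 i) = m i) &
    (forall x, 128 <= x -> (forall i, 127 < i <= L -> x != cell 0 i) -> m' x = m x)].
Proof.
rewrite /boot_move => h1 m0L.
have {h1} [h1 h2] := code_at_cat (c1 := [:: IConst 2 0; IAdd 2 2 0]) h1.
have {h2} [h2 h3] := code_at_cat (c1 := [:: IConst 3 127; ISub 3 2 3]) h2.
have {h3} [h3 h4] := code_at_cons h3.
have {h4} [h4 h5] := code_at_cat (c1 := [:: ILoad 4 2] ++ mov 5 2 ++ addr 0 5 6 ++ _) h4.
rewrite ?[size _]/= in h2 h3 h4 h5; rewrite !addn2 in h2 h3 h4 h5.
have loop k m0 : m0 0 = L -> m0 2 <= L -> k = m0 2 - 127 ->
  exists m', [/\ reach P (17 * k + 3) (State b.+2 m0) (State (b + 19) m'), m' 0 = L,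
    (forall i, 127 < i <= m0 2 -> m' (cell 0 i) = m0 i) &
    (forall x, 128 <= x -> (forall i, 127 < i <= m0 2 -> x != cell 0 i) -> m' x = m0 x)].
  elim: k m0 => [|k IH] m0 z0 lj ek.
    exists (exec [:: IConst 3 127; ISub 3 2 3] m0); split.
    - apply: (reach_trans (t1 := 2)); first exact: (reach_exec m0 h2 isT).
      rewrite [size _]/= addn2; apply: (reach_jz h3).
      rewrite /= !updE /= -ek; exact: reach_refl.
    - by rewrite /= !updN.
    - by move=> i hi; lia.
    - by move=> x hx _; rewrite /= !updN //; lia.
  set j := m0 2 in lj ek.
  pose ma := exec [:: ILoad 4 2; IConst 5 0; IAdd 5 5 2] (exec [:: IConst 3 127; ISub 3 2 3] m0).
  have [A1 A2] := exec_addr 0 ma (isT : 5 != 6).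
  set mb := exec _ ma in A1 A2.
  have Ama x : x \notin [:: 3; 4; 5] -> ma x = m0 x.
    by rewrite !inE !negb_or => /and3P[? ? ?]; rewrite /ma /= !updN.
  pose m1 := upd (exec [:: IStore 5 4; IConst 3 1; ISub 2 2 3] mb) 3 0.
  have b5 : mb 5 = cell 0 j by rewrite A1 /ma /= !updE.
  have b4 : mb 4 = m0 j by rewrite A2 // /ma /= !updE /= !ifN //; rewrite -/j; lia.
  have b2 : mb 2 = j by rewrite A2 // Ama.
  have b1 x : 6 < x \/ x = 0 -> mb x = m0 x.
    by move=> hx; rewrite A2 ?Ama // ?inE; lia.
  have c1 x : 6 < x \/ x = 0 -> x != cell 0 j -> m1 x = m0 x.
    by move=> hx hc; rewrite /m1 /= b5 !updN ?b1 //; lia.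
  have c2 : m1 2 = j.-1.
    by rewrite /m1 /= !updE /= b5 /= b2 subn1.
  have c3 : m1 (cell 0 j) = m0 j.
    rewrite /m1 /= b5; do 3!(rewrite updN; last by cl).
    by rewrite updE eqxx b4.
  have [||| m' [R z M U]] := IH m1; rewrite ?c2; try lia.
    by rewrite c1 ?z0 //; cl.
  exists m'; split=> //.
  - have -> : 17 * k.+1 + 3 = 2 + (12 + (17 * k + 3).+2).+1 by lia.
    apply: reach_trans; first exact: (reach_exec m0 h2 isT).
    rewrite [size _]/= addn2; apply: (reach_jz h3).
    rewrite [exec _ _ 3]/= !updE /= ifN; last by rewrite -/j; lia.
    apply: reach_trans; first exact: (reach_exec _ h4 isT).
    by apply: (reach_goto h5); move: R; rewrite /m1 /mb /ma.
  - move=> i hi; have [->|ij] := eqVneq i j.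
      by rewrite U ?c3 // => y; rewrite ?c2 /cell; lia.
    rewrite M ?c2; last by lia.
    by rewrite c1 //; cl.
  - move=> x hx hxi; rewrite U //; last by move=> i hi; apply: hxi; rewrite c2 in hi; lia.
    by rewrite c1 //; [|apply: hxi]; lia.
pose m1 := exec [:: IConst 2 0; IAdd 2 2 0] m.
have [|||m' [R z M U]] := loop (L - 127) m1; rewrite /m1 /= ?updE /= ?updE /= ?m0L //.
exists m'; rewrite /m1 /= ?updE /= ?updE /= ?m0L in M U; split=> //.
- apply: reach_le (reach_trans (reach_exec m h1 isT) _); last by rewrite addn2; exact: R.
  by rewrite /=; lia.
- by move=> i hi; rewrite M // !updN //; lia.
- by move=> x hx hxi; rewrite U // !updN //; lia.
Qed.

Definition low_regs := iota 2 126.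

Definition boot (b : nat) : seq instr :=
  let b1 := b + size (boot_save low_regs) in
  boot_save low_regs ++ boot_move b1 ++ boot_restore low_regs ++
  [:: IConst 1 (cell 0 1); IConst 2 1; IStore 1 2].

Lemma straight_boot_save rs : straight (boot_save rs).
Proof. by elim: rs => //= r rs IH; rewrite /straight !all_cat straight_save_addr. Qed.

Lemma straight_boot_restore rs : straight (boot_restore rs).
Proof. by elim: rs => //= r rs IH; rewrite /straight !all_cat straight_save_addr. Qed.

Lemma size_boot_move b : size (boot_move b) = 19. Proof. by []. Qed.

Opaque low_regs boot_save boot_move boot_restore.

Lemma size_boot b : size (boot b) =
  size (boot_save low_regs) + (19 + (size (boot_restore low_regs) + 3)).
Proof.
by rewrite /boot size_cat; congr addn; rewrite size_cat size_boot_move; congr addn; rewrite size_cat.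
Qed.


Definition boot_time : nat :=
  size (boot_save low_regs) + 5 + size (boot_restore low_regs) + 3.

Lemma bootP P b L m : code_at P b (boot b) -> m 0 = L -> m 1 = 1 ->
  exists s m', [/\ reach P (17 * L + boot_time) (State b m) (State (b + size (boot b)) m'),
    sim s m', sc s 0 = L & forall j, 0 < j <= L -> ar s 0 j = m j].
Proof.
move=> h mL m1; have {h} [h1 h] := code_at_cat h.
have {h} [h2 h] := code_at_cat h; have {h} [h3 h4] := code_at_cat h.
have [A1 A2] := @exec_boot_save low_regs m isT; cbv zeta in A1, A2.
have R1 := reach_exec m h1 (straight_boot_save _).
rewrite mL in A1 A2; move: (exec _ m) A1 A2 R1 => ma A1 A2 R1.
have [|mb [R2 z2 M2 U2]] := boot_moveP h2 (L := L) (m := ma).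
  by rewrite A1 // => r _; lia.
have R3 := reach_exec mb h3 (straight_boot_restore _).
have memP r : (r \in low_regs) = (2 <= r < 2 + 126) by rewrite mem_iota.
have [|B1 B2] := @exec_boot_restore L m 2 126 mb isT z2.
  move=> r hr rL; rewrite U2; [|by lia|by move=> i hi; rewrite /cell; lia].
  by rewrite A2 // memP.
rewrite -/low_regs in B1 B2; cbv zeta in B1, B2.
move: (exec _ mb) B1 B2 R3 => mc B1 B2 R3.
have R4 := reach_exec mc h4 isT; pose md := exec [:: IConst 1 (cell 0 1); IConst 2 1; IStore 1 2] mc.
have mdE x : x != 1 -> x != 2 -> md x = if x == cell 0 1 then 1 else mc x.
  by move=> x1 x2; rewrite /md /= !updE /= (negbTE x1) (negbTE x2).
(* The store takes over whatever the memory holds, leftovers of the move included. Only scalar 0 and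
   the input entries are specified, so the commands cannot assume zeros. *)
exists (Store md (fun a i => md (cell a i))), md; split; [|by []| |].
- have -> : 17 * L + boot_time = size (boot_save low_regs) + (17 * L + 5 +
    (size (boot_restore low_regs) + 3)) by rewrite /boot_time; lia.
  apply: reach_trans R1 _; apply: reach_trans R2 _; apply: reach_trans R3 _.
  move: R4; congr (reach _ _ (State _ _) (State _ _)).
  by rewrite size_boot size_boot_move [size [:: _; _; _]]/=; lia.
- by rewrite /= mdE //= B1 ?z2 // => *; rewrite /cell; lia.
move=> j /andP[j0 jL] /=; rewrite mdE; [|by rewrite /cell; lia ..].
rewrite cell_eq //=; have [->|j1] := eqVneq j 1; first by rewrite m1.
have [j128|j128] := ltnP j 128; first by rewrite B2 //; lia.
rewrite B1; [|by left; rewrite /cell; lia|by move=> r hr; rewrite /cell; lia].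
by rewrite M2 ?A1 // => *; lia.
Qed.

Opaque boot boot_time.

(* The leading test handles the empty graph, whose encoding alone starts with [0]. *)
Definition assemble (c1 c2 c3 : cmd) : program :=
  let b1 := (size (boot 1)).+1 in
  let b2 := b1 + sz_c c1 in let b3 := b2 + sz_c c2 in
  IJz 1 (b3 + sz_c c3).+1 :: boot 1 ++ comp_c b1 c1 ++ comp_c b2 c2 ++ comp_c b3 c3 ++
  [:: IHalt; IConst 0 1; IHalt].

Lemma assemble_code c1 c2 c3 : let P := assemble c1 c2 c3 in
  let b1 := (size (boot 1)).+1 in
  let b2 := b1 + sz_c c1 in let b3 := b2 + sz_c c2 in
  [/\ code_at P 1 (boot 1), code_at P b1 (comp_c b1 c1), code_at P b2 (comp_c b2 c2),
    code_at P b3 (comp_c b3 c3) & code_at P (b3 + sz_c c3) [:: IHalt; IConst 0 1; IHalt]].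
Proof.
move=> P b1 b2 b3; have h0 : code_at P 0 P by [].
have [_ h1] := code_at_cons h0.
have {h1} [h1 h2] := code_at_cat h1; have {h2} [h2 h3] := code_at_cat h2.
have {h3} [h3 h4] := code_at_cat h3; have {h4} [h4 h5] := code_at_cat h4.
by rewrite !size_comp_c add1n -/b1 -/b2 -/b3 in h1 h2 h3 h4 h5; split.
Qed.

Lemma assemble_empty c1 c2 c3 m : m 1 = 0 ->
  exists2 s, run (assemble c1 c2 c3) 2 (State 0 m) = Some s & Defs.mem s 0 = 1.
Proof.
move=> m1; have [_ _ _ _ h] := assemble_code c1 c2 c3.
have [_ h'] := code_at_cons h; have [h2 h3] := code_at_cons h'.
have [h4 _] := code_at_cons h3.
exists (State ((size (boot 1)).+1 + sz_c c1 + sz_c c2 + sz_c c3).+2 (upd m 0 1)); last by [].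
apply: reach_run; last by rewrite /step h4.
apply: (reach_jz (r := 1) (l := ((size (boot 1)).+1 + sz_c c1 + sz_c c2 + sz_c c3).+1)).
  by [].
rewrite m1; apply: reach_step; first by rewrite /step h2.
exact: reach_refl.
Qed.

(** A command may not assign the bounds of its own loops, hence a program in phases, where each
    phase computes bounds for the next. [B] only has to bound them in the store in which their phase
    starts. *)
Lemma assembleP c1 c2 c3 Ps1 Ps2 Ps3 :
  wf_c Ps1 c1 -> wf_c Ps2 c2 -> wf_c Ps3 c3 ->
  exists K D, forall m L, m 0 = L -> m 1 = 1 ->
  exists s, [/\ sc s 0 = L, forall j, 0 < j <= L -> ar s 0 j = m j &
    let s1 := den c1 s in let s2 := den c2 s1 in
    forall B, (forall x, x \in Ps1 -> sc s x <= B) ->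
      (forall x, x \in Ps2 -> sc s1 x <= B) -> (forall x, x \in Ps3 -> sc s2 x <= B) ->
    exists2 s', run (assemble c1 c2 c3) (K * (L + B).+1 ^ D) (State 0 m) = Some s' &
      Defs.mem s' 0 = sc (den c3 s2) 0].
Proof.
move=> w1 w2 w3.
have [K [D hKD]] : poly (fun B => (17 * B + boot_time).+1 + tb_c B c1 + tb_c B c2 + tb_c B c3).
  do 3!(apply: poly_add; last exact: poly_tb_c).
  exists (18 + boot_time), 1 => B; rewrite expn1; lia.
exists K, D => m L mL m1.
have [h1 h2 h3 h4 h5] := assemble_code c1 c2 c3.
have [s [m0 [R0 S0 sL sar]]] := bootP h1 mL m1.
exists s; split=> // s1 s2 B hB1 hB2 hB3.
have [m2 R2 S2] := comp_cP hB1 w1 h2 S0.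
have [m3 R3 S3] := comp_cP hB2 w2 h3 S2.
have [m4 R4 S4] := comp_cP hB3 w3 h4 S3.
have [h6 _] := code_at_cons h5.
exists (State ((size (boot 1)).+1 + sz_c c1 + sz_c c2 + sz_c c3) m4); last first.
  by rewrite /= S4.1.
apply: reach_run; last by rewrite /step h6.
(* The boot depends on [L] and the phases on [B]; monotonicity lets one polynomial in [L + B] cover
   both. *)
have mono c : tb_c B c <= tb_c (L + B) c.
  have mono_e e : tb_e B e <= tb_e (L + B) e.
    elim: e => //= [a e IH|e1 IH1 e2 IH2|e1 IH1 e2 IH2|c0 IHc e1 IH1 e2 IH2|x e IH];
      rewrite ?leq_add2r //; do ?exact: leq_add.
    - by rewrite !leq_add.
    - by rewrite leq_mul ?leq_addl ?leq_add2r.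
  elim: c => /= [x e|a x e|c IHc c' IHc'|i x c IHc].
  - by rewrite leq_add2r.
  - by rewrite leq_add2r leq_mul ?leq_addl ?leq_add2r.
  - exact: leq_add.
  - by rewrite leq_add2r leq_mul ?leq_addl ?leq_add2r.
apply: (reach_le (t := (17 * L + boot_time + tb_c B c1 + tb_c B c2 + tb_c B c3).+1)).
  apply: leq_trans (hKD (L + B)).
  by have := mono c1; have := mono c2; have := mono c3; lia.
apply: reach_jz; first by []; rewrite m1.
apply: reach_trans R4; apply: reach_trans R3; apply: reach_trans R2; exact: R0.
Qed.

(** * Deletion sets and modules *)

Notation component := Defs.comp.

Lemma bigminn_leP (I : finType) x0 (P : pred I) (F : I -> nat) k :
  reflect (x0 <= k \/ exists2 i, P i & F i <= k) (\big[minn/x0]_(i | P i) F i <= k).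
Proof.
suff h (r : seq I) : (\big[minn/x0]_(i <- r | P i) F i <= k) =
    (x0 <= k) || has (fun i => P i && (F i <= k)) r.
  rewrite h; apply: (iffP orP) => -[hx|]; try by left.
    by case/hasP=> i _ /andP[Pi Fi]; right; exists i.
  case=> i Pi Fi; right; apply/hasP; exists i; rewrite ?mem_index_enum //.
  by rewrite Pi.
elim: r => [|i r IH]; first by rewrite big_nil orbF.
rewrite big_cons /=; case: (P i) => //=.
by rewrite geq_min IH orbCA.
Qed.

Section Graphs.
Variables (T : finType) (e : rel T) (w : T -> nat).
Hypothesis e_sym : symmetric e.
Implicit Types (S X Y M R A D Z : {set T}).

Lemma comp_min S x Z : x \in Z ->
  (forall u v, u \in Z -> e u v -> u \notin S -> v \notin S -> v \in Z) ->
  component e S x \subset Z.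
Proof.
move=> xZ cl; apply/subsetP => y; rewrite inE => /connectP[q hq ->].
elim: q x xZ hq => //= v q IH x xZ /andP[/andP[/andP[exv xS] vS]]; apply: IH.
exact: cl exv xS vS.
Qed.

Lemma comp_refl S x : x \in component e S x.
Proof. by rewrite inE connect0. Qed.

Lemma comp_step S x u v : u \in component e S x -> e u v -> u \notin S -> v \notin S ->
  v \in component e S x.
Proof.
rewrite !inE => h euv uS vS; apply: connect_trans h (connect1 _).
by rewrite /del_rel /= euv uS vS.
Qed.

Lemma comp_sym S x y : (y \in component e S x) = (x \in component e S y).
Proof.
rewrite !inE; apply: sym_connect_sym => u v.
by rewrite /del_rel /= e_sym -!andbA; congr andb; rewrite andbC.
Qed.

Lemma comp_trans S x y z : y \in component e S x -> z \in component e S y -> z \in component e S x.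
Proof. by rewrite !inE; apply: connect_trans. Qed.

Lemma comp_notin S x y : x \notin S -> y \in component e S x -> y \notin S.
Proof.
move=> xS /(subsetP (comp_min (Z := ~: S) _ _)) h; rewrite -in_setC h ?inE //.
by move=> u v _ _ _; rewrite inE.
Qed.

Lemma wt_sub X Y : X \subset Y -> wt w X <= wt w Y.
Proof.
move=> h; rewrite /wt [leqRHS](big_setID X) /= (setIidPr h); exact: leq_addr.
Qed.

Lemma wt_indicator X : wt w X = \sum_x (x \in X) * w x.
Proof. by rewrite /wt big_mkcond; apply: eq_bigr => x _; case: (_ \in _); rewrite ?mul1n. Qed.

Lemma wvi_le k : (wvi e w <= k) <-> exists S, integrity_cost e w S <= k.
Proof.
apply: (iff_trans (iff_sym (rwP (bigminn_leP _ _ _ _)))); split=> [[h|[S _ h]]|[S h]].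
(* The default of the minimum is the cost of deleting every vertex. *)
- exists setT; apply: leq_trans h; rewrite /integrity_cost big_pred0 ?addn0 //.
  by move=> x; rewrite !inE.
- by exists S.
by right; exists S.
Qed.

(* Any further vertex returned to the graph would merge two components. *)
Definition canonical S := forall x, x \in S ->
  exists y z, [/\ y \notin S, z \notin S, e x y, e x z & z \notin component e S y].

Definition maxcomp S := \max_(x in ~: S) wt w (component e S x).

Lemma maxcomp_ge S x : x \notin S -> wt w (component e S x) <= maxcomp S.
Proof. by move=> xS; apply: (@leq_bigmax_cond _ _ (fun x => wt w (component e S x))); rewrite inE. Qed.

(** When the surviving neighbours of [x] share a component, returning [x] merges nothing: it adds at
    most [w x] to the heaviest component, which is what the weight of [S] loses. *)
Lemma cost_del1 S x : x \in S ->
  (forall y z, y \notin S -> z \notin S -> e x y -> e x z -> z \in component e S y) ->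
  integrity_cost e w (S :\ x) <= integrity_cost e w S.
Proof.
move=> xS h; rewrite /integrity_cost.
have -> : wt w S = w x + wt w (S :\ x) by rewrite /wt (big_setD1 x).
rewrite addnAC addnC leq_add2r -/(maxcomp S).
apply/bigmax_leqP => v; rewrite !inE negb_and negbK => hv.
(* [D] is the union of the components next to [x], by [h] a single one or empty. After the return of
   [x], a component lies in [x |: D] or in an old component. *)
pose D := [set z | [exists y, [&& y \notin S, e x y & z \in component e S y]]].
have inD u : u \notin S -> e x u -> u \in D.
  by move=> uS xu; rewrite inE; apply/existsP; exists u; rewrite uS xu comp_refl.
have wD : wt w (x |: D) <= w x + maxcomp S.
  have xD : x \notin D.
    rewrite inE; apply/existsP=> -[y /and3P[yS _ /(comp_notin yS)]]; by rewrite xS.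
  rewrite /wt big_setU1 //= leq_add2l.
  have [->|[d]] := set_0Vmem D; first by rewrite big_set0.
  rewrite inE => /existsP[y /and3P[yS xy _]]; apply: leq_trans (maxcomp_ge yS).
  apply: wt_sub; apply/subsetP => z; rewrite inE => /existsP[y' /and3P[y'S xy' hz]].
  exact: comp_trans (h _ _ yS y'S xy xy') hz.
have Dstep u u' : u \in D -> e u u' -> u' \notin S -> u' \in D.
  rewrite !inE => /existsP[y /and3P[yS xy hu]] euu' u'S; apply/existsP; exists y.
  by rewrite yS xy; apply: comp_step hu euu' (comp_notin yS hu) u'S.
have [vD|vD] := boolP (v \in x |: D).
  apply: leq_trans wD; apply: wt_sub; apply: comp_min => // u u'; rewrite !(in_setU1, in_setD1).
  case/orP=> [/eqP->|uD] eu _; have [//|u'x /= u'S] := eqVneq u' x; first exact: inD.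
  exact: Dstep uD eu u'S.
have vS : v \notin S by move: hv vD; rewrite in_setU1; case: eqP => //= _.
apply: leq_trans (leq_trans (maxcomp_ge vS) (leq_addl _ _)).
apply: wt_sub; apply: comp_min; first exact: comp_refl.
move=> u u' hu eu _; have uS := comp_notin vS hu.
have [E|u'x] := eqVneq u' x; last first.
  by rewrite in_setD1 u'x /= => u'S; apply: comp_step hu eu uS u'S.
case/negP: vD; rewrite in_setU1 orbC.
have : u \in D by apply: inD => //; rewrite e_sym -E.
rewrite !inE => /existsP[y /and3P[yS xy hy]]; apply/orP; left; apply/existsP; exists y.
by rewrite yS xy /=; apply: comp_trans hy _; rewrite comp_sym.
Qed.

(** Take an optimal set of least cardinality: a vertex that violates the condition could be returned
    by [cost_del1], leaving a smaller optimal set. *)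
Lemma canonical_optimum : exists2 S, canonical S &
  forall S', integrity_cost e w S <= integrity_cost e w S'.
Proof.
pose S0 := [arg min_(S < (setT : {set T})) integrity_cost e w S].
have opt S' : integrity_cost e w S0 <= integrity_cost e w S'.
  by rewrite /S0; case: arg_minnP => // S _; apply.
pose P S := integrity_cost e w S <= integrity_cost e w S0.
case: (@arg_minnP _ S0 P (fun S => #|S|)); first exact: leqnn.
rewrite {}/P => S hS hmin; exists S; last by move=> S'; apply: leq_trans hS (opt S').
move=> x xS; pose Q y z := [&& y \notin S, z \notin S, e x y, e x z & z \notin component e S y].
have [/existsP[y /existsP[z /and5P[]]]|no] := boolP [exists y, exists z, Q y z].
  by exists y, z.
suff /hmin : integrity_cost e w (S :\ x) <= integrity_cost e w S0.
  by rewrite (cardsD1 x S) xS ltnn.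
apply: leq_trans hS; apply: cost_del1 => // y z yS zS xy xz.
apply: contraNT no => hz; apply/existsP; exists y; apply/existsP; exists z.
by rewrite /Q yS zS xy xz.
Qed.

Definition uniform R M := forall z u v, z \in R -> z \notin M -> u \in M -> v \in M -> e z u = e z v.

(** Suppose [x] in [X] is deleted. A surviving neighbour of [x] inside [X] is adjacent to [z]; one
    outside [X] is adjacent to [u], hence linked to [z]. So they all lie in the component of [z],
    against [canonical]. *)
Lemma canonical_module S X z u : canonical S -> uniform setT X ->
  z \notin X -> z \notin S -> u \in X -> u \notin S -> e z u -> [disjoint X & S].
Proof.
move=> can mod zX zS uX uS zu; apply/pred0P=> x /=; apply/negP=> /andP[xX xS].
have [y1 [y2 [y1S y2S xy1 xy2 /negP]]] := can x xS; apply.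
have near y : y \notin S -> e x y -> y \in component e S z.
  move=> yS xy; have [yX|yX] := boolP (y \in X).
    by apply: (comp_step (comp_refl S z)) => //; rewrite (mod z y u).
  have hu := comp_step (comp_refl S z) zu zS uS.
  by apply: comp_step hu _ uS yS; rewrite e_sym (mod y u x) // e_sym.
by apply: comp_trans (near _ y2S xy2); rewrite comp_sym near.
Qed.

End Graphs.

(** * Quotients by modules and the cost of a contracted module *)

Section Contraction.
Variables (T : finType) (e : rel T) (w : T -> nat).
Hypotheses (e_sym : symmetric e) (e_irr : irreflexive e).
Implicit Types (S X Y M R A D Z : {set T}) (blk : T -> {set T}) (W F : T -> nat).

(* [R] is a set of representatives of a partition of the vertices into the modules [blk r]. *)
Record quotient R blk : Prop := Quotient {
  q_rep : forall r, r \in R -> r \in blk r;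
  q_cover : forall x, exists2 r, r \in R & x \in blk r;
  q_inj : forall r r' x, r \in R -> r' \in R -> x \in blk r -> x \in blk r' -> r = r';
  q_adj : forall r r' x y, r \in R -> r' \in R -> r != r' -> x \in blk r -> y \in blk r' ->
    e x y = e r r' }.

Definition union blk A : {set T} := \bigcup_(a in A) blk a.

Definition merge_blk M blk (v : T) : {set T} := if v \in M then union blk M else blk v.

Lemma quotient_single : quotient setT (fun v => [set v]).
Proof.
split=> [r _|x|r r' x _ _|r r' x y _ _ _]; rewrite ?inE //.
- by exists x; rewrite inE.
- by move=> /eqP-> /eqP->.
by move=> /eqP-> /eqP->.
Qed.

Lemma unionP blk A x : reflect (exists2 a, a \in A & x \in blk a) (x \in union blk A).
Proof. exact: bigcupP. Qed.

Lemma wt_union R blk A : quotient R blk -> A \subset R ->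
  wt w (union blk A) = \sum_(a in A) wt w (blk a).
Proof.
move=> q /subsetP AR; rewrite wt_indicator.
under [RHS]eq_bigr do rewrite wt_indicator.
rewrite exchange_big; apply: eq_bigr => x _; rewrite -big_distrl /=; congr muln.
have [/unionP[a aA xa]|no] := boolP (_ \in _); last first.
  rewrite big1 // => a aA; apply/eqP; rewrite eqb0; apply: contra no => h.
  by apply/unionP; exists a.
rewrite (bigD1 a) //= xa big1 // => b /andP[bA ba]; apply/eqP; rewrite eqb0.
by apply: contra ba => xb; apply/eqP; apply: (q_inj q) xb xa; apply: AR.
Qed.

Lemma blk_uniform R blk r : quotient R blk -> r \in R -> uniform e setT (blk r).
Proof.
move=> q rR z u v _ zr ur vr; have [r' r'R zr'] := q_cover q z.
have nr : r' != r by apply: contraNneq zr => <-.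
by rewrite (q_adj q r'R rR nr zr' ur) (q_adj q r'R rR nr zr' vr).
Qed.

(** The hypotheses on [R'] leave open which element of [M] stays as the representative of the merged
    block. *)
Lemma quotient_merge R R' M blk : quotient R blk -> M \subset R -> uniform e R M ->
  R' \subset R -> (forall v, v \in R -> v \notin M -> v \in R') ->
  (forall m, m \in M -> exists2 r, r \in M & r \in R') ->
  (forall r r', r \in M -> r' \in M -> r \in R' -> r' \in R' -> r = r') ->
  quotient R' (merge_blk M blk).
Proof.
move=> q /subsetP MR mod /subsetP R'R old new uniq; rewrite /merge_blk; split.
- move=> r rR'; case: ifP => [rM|_]; last exact/(q_rep q)/R'R.
  by apply/unionP; exists r => //; apply/(q_rep q)/R'R.
- move=> x; have [r rR xr] := q_cover q x; have [rM|rM] := boolP (r \in M).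
    by have [s sM sR'] := new r rM; exists s; rewrite // sM; apply/unionP; exists r.
  by exists r; [apply: old | rewrite (negbTE rM)].
- move=> r r' x rR' r'R'; case: ifP => rM; case: ifP => r'M.
  + by move=> _ _; apply: uniq.
  + case/unionP=> m mM xm xr'; have E := q_inj q (MR _ mM) (R'R _ r'R') xm xr'.
    by rewrite -E mM in r'M.
  + move=> xr /unionP[m mM xm]; have E := q_inj q (MR _ mM) (R'R _ rR') xm xr.
    by rewrite -E mM in rM.
  + by apply: (q_inj q); apply: R'R.
- move=> r r' x y rR' r'R' nr; have rR := R'R _ rR'; have r'R := R'R _ r'R'.
  case: ifP => rM; case: ifP => r'M.
  + by move: nr; rewrite (uniq r r') ?eqxx.
  + case/unionP=> m mM xm yr'; have nm : m != r' by apply: contraFneq r'M => <-.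
    rewrite (q_adj q (MR _ mM) r'R nm xm yr') e_sym [RHS]e_sym.
    by apply: mod => //; rewrite r'M.
  + move=> xr /unionP[m mM ym]; have nm : r != m by apply: contraFneq rM => ->.
    by rewrite (q_adj q rR (MR _ mM) nm xr ym); apply: mod => //; rewrite rM.
  + exact: (q_adj q).
Qed.

Lemma union_uniform R blk M : quotient R blk -> M \subset R -> uniform e R M ->
  uniform e setT (union blk M).
Proof.
move=> q /subsetP MR mod z u v _ zM /unionP[m mM um] /unionP[m' m'M vm'].
have [r rR zr] := q_cover q z.
have rM : r \notin M by apply: contra zM => rM; apply/unionP; exists r.
have nr x : x \in M -> r != x by move=> xM; apply: contraNneq rM => ->.
rewrite (q_adj q rR (MR _ mM) (nr _ mM) zr um) (q_adj q rR (MR _ m'M) (nr _ m'M) zr vm').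
exact: mod.
Qed.

(** Search in the graph on [A] as an iterated monotone operator instead of [connect]: a program loop
    with one round per vertex computes it literally. *)
Definition reachF A a Z : {set T} :=
  [set v | [|| v == a, v \in Z | (v \in A) && [exists u in Z, e u v]]].

Definition reach_in A a : {set T} := iter #|T| (reachF A a) set0.

Lemma reach_in_fix A a : reachF A a (reach_in A a) = reach_in A a.
Proof.
apply: fixsetK => Z Z' /subsetP h; apply/subsetP => v; rewrite !inE.
case/or3P=> [->//|/h->|/andP[-> /existsP[u /andP[/h uZ uv]]]]; rewrite ?orbT //=.
by apply/or3P/Or33/existsP; exists u; rewrite uZ.
Qed.

Lemma reach_in_refl A a : a \in reach_in A a.
Proof. by rewrite -reach_in_fix inE eqxx. Qed.

Lemma reach_in_step A a u v : u \in reach_in A a -> v \in A -> e u v -> v \in reach_in A a.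
Proof.
move=> h vA uv; rewrite -reach_in_fix inE vA /=; apply/or3P/Or33/existsP.
by exists u; rewrite h.
Qed.

Lemma reach_in_ind A a (P : T -> Prop) : P a ->
  (forall u v, P u -> v \in A -> e u v -> P v) -> forall v, v \in reach_in A a -> P v.
Proof.
move=> Pa Ps; rewrite /reach_in; elim: #|T| => [|n IH] v /=; first by rewrite inE.
rewrite inE => /or3P[/eqP->//|/IH//|/andP[vA /existsP[u /andP[/IH hu uv]]]].
exact: Ps uv.
Qed.

Lemma reach_in_sub A a : a \in A -> reach_in A a \subset A.
Proof. by move=> aA; apply/subsetP; apply: reach_in_ind. Qed.

Variable p : nat.

Definition isolated A a := #|reach_in A a| == 1.

Definition feasible W A : bool :=
  [forall a in A, isolated A a || (\sum_(x in reach_in A a) W x <= p)].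

Definition cost W F M A : nat :=
  \sum_(m in M :\: A) W m + \sum_(a in A | isolated A a) F a.

Lemma isolatedP A a b : isolated A a -> b \in A -> ~~ e a b.
Proof.
move=> /cards1P[x hx] bA; apply/negP=> ab.
have := reach_in_refl A a; have := reach_in_step (reach_in_refl A a) bA ab.
by rewrite hx !inE => /eqP E /eqP E'; rewrite E E' e_irr in ab.
Qed.

Lemma not_isolatedP A a : ~~ isolated A a -> exists2 b, b \in A & e a b.
Proof.
move=> h; have [/existsP[b /andP[bA ab]]|no] := boolP [exists b in A, e a b].
  by exists b.
case/negP: h; apply/cards1P; exists a; apply/eqP; rewrite eqEsubset sub1set reach_in_refl andbT.
apply/subsetP; apply: reach_in_ind; rewrite ?set11 // => u v; rewrite !inE => /eqP-> vA av.
by case/negP: no; apply/existsP; exists v; rewrite vA.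
Qed.

(** Deleting the complement of [X] as well makes this a statement about [G[X]] alone: budget [f]
    suffices to bring all its components down to weight [p]. *)
Definition solvable X f := exists S, [/\ S \subset X, wt w S <= f &
  forall x, x \in X -> x \notin S -> wt w (component e (S :|: ~: X) x) <= p].

Lemma solvable_all X f : wt w X <= f -> solvable X f.
Proof. by move=> h; exists X; split=> // x ->. Qed.

(** Delete the blocks outside [A] and solve every isolated block inside itself. A component then
    stays within one isolated block, or within the blocks of one connected part of [A], whose weight
    [feasible] bounds. *)
Lemma solvable_merge R blk M A F : quotient R blk -> M \subset R -> A \subset M ->
  (forall m, m \in M -> solvable (blk m) (F m)) ->
  feasible (fun v => wt w (blk v)) A ->
  solvable (union blk M) (cost (fun v => wt w (blk v)) F M A).
Proof.
move=> q /subsetP MR /subsetP AM sol /forallP feas.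
have /fin_all_exists[Sf hSf] : forall m, exists S, m \in M -> [/\ S \subset blk m, wt w S <= F m &
    forall x, x \in blk m -> x \notin S -> wt w (component e (S :|: ~: blk m) x) <= p].
  by move=> m; have [/sol[S]|_] := boolP (m \in M); [exists S|exists set0].
pose S1 := union blk (M :\: A); pose S2 := \bigcup_(a in A | isolated A a) Sf a.
have inS1 m x : m \in M -> x \in blk m -> x \notin S1 -> m \in A.
  move=> mM xm; apply: contraR => mA; apply/unionP; exists m => //.
  by rewrite inE mA.
exists (S1 :|: S2); split.
- rewrite subUset; apply/andP; split; apply/subsetP => x.
    by case/unionP=> m; rewrite inE => /andP[_ mM] xm; apply/unionP; exists m.
  case/bigcupP=> a /andP[aA _] xa; apply/unionP; exists a; first exact: AM.
  by have [/subsetP h _ _] := hSf a (AM _ aA); apply: h.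
- have sub1 : M :\: A \subset R by apply/subsetP => x; rewrite inE => /andP[_ /MR].
  have wtU X Y : wt w (X :|: Y) <= wt w X + wt w Y.
    rewrite !wt_indicator -big_split /=; apply: leq_sum => x _; rewrite inE.
    by case: (_ \in _); case: (_ \in _); rewrite ?mul1n ?mul0n ?addn0 ?leq_addr.
  apply: leq_trans (wtU _ _) _; rewrite (wt_union q sub1) leq_add2l /S2.
  apply: (@leq_trans (\sum_(a in A | isolated A a) wt w (Sf a))).
    elim/big_rec2: _ => [|a f X _ h]; first by rewrite /wt big_set0.
    by apply: leq_trans (wtU _ _) _; rewrite leq_add2l.
  by apply: leq_sum => a /andP[aA _]; have [] := hSf a (AM _ aA).
move=> x /unionP[a aM xa]; rewrite inE negb_or => /andP[xS1 xS2].
have aA : a \in A := inS1 _ _ aM xa xS1.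
(* A surviving edge inside the union stays in its block or follows an edge of the quotient between
   members of [A]. *)
have next u v b : b \in M -> u \in blk b -> v \notin S1 :|: S2 :|: ~: union blk M -> e u v ->
    exists2 c, c \in A & v \in blk c /\ (c = b \/ e b c).
  move=> bM ub; rewrite !(inE, negb_or) negbK => /andP[/andP[vS1 _] /unionP[c cM vc]] uv.
  exists c; first exact: inS1 vS1.
  split=> //; have [->|bc] := eqVneq c b; first by left.
  by right; rewrite -(q_adj q (MR _ bM) (MR _ cM) _ ub vc) // eq_sym.
have [iso|niso] := boolP (isolated A a).
  have [Sa wSa hS] := hSf a aM.
  have xSa : x \notin Sf a.
    by apply: contra xS2 => h; apply/bigcupP; exists a => //; rewrite aA.
  apply: leq_trans (hS _ xa xSa); apply: wt_sub.
  have -> : component e (Sf a :|: ~: blk a) x = component e (Sf a :|: ~: blk a) x :&: blk a.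
    apply/esym/setIidPl; apply: comp_min => // u v _ _ _.
    by rewrite !inE negb_or negbK => /andP[_].
  apply: comp_min; first by rewrite in_setI comp_refl.
  move=> u v; rewrite !in_setI => /andP[hu ua] uv _ vS.
  have [c cA [vc [E|ac]]] := next _ _ _ aM ua vS uv; last first.
    by rewrite (negbTE (isolatedP iso cA)) in ac.
  rewrite {c}E in cA vc; rewrite vc andbT; have xn : x \notin Sf a :|: ~: blk a.
    by rewrite !inE negb_or xSa negbK.
  apply: comp_step hu uv (comp_notin xn hu) _; rewrite !inE negb_or negbK vc andbT.
  move: vS; rewrite !inE !negb_or => /andP[/andP[_ h] _].
  by apply: contra h => h; apply/bigcupP; exists a; rewrite // aA.
have := feas a; rewrite aA (negbTE niso) /= => le_p.
have sC : reach_in A a \subset R.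
  by apply: subset_trans (reach_in_sub aA) _; apply/subsetP => y /AM/MR.
apply: leq_trans le_p; rewrite -(wt_union q sC); apply: wt_sub.
apply: comp_min; first by apply/unionP; exists a; rewrite ?reach_in_refl.
move=> u v /unionP[b bC ub] uv _ vS.
have bM := AM _ (subsetP (reach_in_sub aA) _ bC).
have [c cA [vc [E|bc]]] := next _ _ _ bM ub vS uv; apply/unionP.
  by exists b => //; rewrite -E.
by exists c => //; apply: reach_in_step bC cA bc.
Qed.

Definition surviving S blk M : {set T} := [set m in M | ~~ (blk m \subset S)].

Lemma survivingP S blk M m : reflect (m \in M /\ exists2 x, x \in blk m & x \notin S)
  (m \in surviving S blk M).
Proof.
rewrite inE; apply: (iffP andP) => -[-> h]; split=> //; first by case/subsetPn: h => x; exists x.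
by case: h => x xm xS; apply/subsetPn; exists x.
Qed.

(** By [canonical_module] two adjacent survivors contain no deleted vertex, and they are completely
    joined; so the search from [a] never leaves the component of [x]. *)
Lemma survivor_reach S R blk M a x : canonical e S -> quotient R blk -> M \subset R ->
  a \in surviving S blk M -> x \in blk a -> x \notin S -> ~~ isolated (surviving S blk M) a ->
  forall b, b \in reach_in (surviving S blk M) a -> blk b \subset component e S x.
Proof.
move=> can q /subsetP MR aA xa xS niso.
set A := surviving S blk M in aA niso *.
have [c cA ac] := not_isolatedP niso.
have full b d : b \in A -> d \in A -> e b d -> [disjoint blk b & S].
  move=> /survivingP[bM [y yb yS]] /survivingP[dM [z zd zS]] bd.
  have nbd : b != d by apply: contraTneq bd => ->; rewrite e_irr.
  have bR := MR _ bM; have dR := MR _ dM.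
  apply: (canonical_module (z := z) (u := y) e_sym can (blk_uniform q bR)) => //.
    by apply: contra nbd => zb; apply/eqP/(q_inj q bR dR zb zd).
  by rewrite e_sym (q_adj q bR dR nbd).
have notS b d y : b \in A -> d \in A -> e b d -> y \in blk b -> y \notin S.
  by move=> bA dA bd yb; rewrite (disjointFr (full _ _ bA dA bd)).
have AR b : b \in A -> b \in R by case/survivingP => /MR.
have link b d y z : b \in A -> d \in A -> e b d -> y \in blk b -> z \in blk d ->
    y \in component e S x -> z \in component e S x.
  move=> bA dA bd yb zd hy; apply: comp_step hy _ (notS _ _ _ bA dA bd yb) _.
    rewrite (q_adj q (AR _ bA) (AR _ dA) _ yb zd) //.
    by apply: contraTneq bd => ->; rewrite e_irr.
  by apply: (notS d b) => //; rewrite e_sym.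
suff h : forall b, b \in reach_in A a -> b \in A /\ blk b \subset component e S x.
  by move=> b /h[].
apply: (reach_in_ind (P := fun b => b \in A /\ blk b \subset component e S x)) => [|b d [bA hb] dA bd].
  (* Block [a] need not be connected in itself: its vertices are linked through a vertex of the
     neighbouring block [c]. *)
  split=> //; apply/subsetP => y ya.
  have hc : c \in component e S x by apply: (link a c x c); rewrite ?(q_rep q) ?AR ?comp_refl.
  by apply: (link c a c y) hc => //; rewrite 1?e_sym ?(q_rep q) ?AR.
split=> //; apply/subsetP => z zd; have bb : b \in blk b by rewrite (q_rep q) ?AR.
by apply: (link b d b z) => //; apply: (subsetP hb).
Qed.

Lemma surviving_feasible S R blk M : canonical e S -> quotient R blk -> M \subset R ->
  maxcomp e w S <= p -> feasible (fun v => wt w (blk v)) (surviving S blk M).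
Proof.
move=> can q MR hp; set A := surviving S blk M.
apply/forallP=> a; apply/implyP=> aA; apply/orP.
have [iso|niso] := boolP (isolated A a); [by left | right].
have AR : A \subset R by apply: subset_trans MR; apply/subsetP => m; rewrite inE => /andP[].
have sC := subset_trans (reach_in_sub aA) AR.
rewrite -(wt_union q sC); have [aM [x xa xS]] := survivingP _ _ _ _ aA.
apply: leq_trans hp; apply: leq_trans (maxcomp_ge e w xS); apply: wt_sub.
apply/subsetP => y /unionP[b bC yb].
exact: (subsetP (survivor_reach can q MR aA xa xS niso bC)).
Qed.

(** The weight of [S] splits over the blocks. A block that does not survive lies in [S] entirely, an
    isolated survivor is charged by [hF], and any other survivor costs nothing. *)
Lemma surviving_cost S R blk M F : quotient R blk -> M \subset R ->
  (forall m, m \in M -> F m <= wt w (S :&: blk m)) ->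
  cost (fun v => wt w (blk v)) F M (surviving S blk M) <= wt w (S :&: union blk M).
Proof.
move=> q MR hF; set A := surviving S blk M.
have -> : S :&: union blk M = union (fun m => S :&: blk m) M.
  apply/setP => x; rewrite inE; apply/andP/unionP => [[xS /unionP[m mM xm]]|[m mM]].
    by exists m; rewrite // inE xS.
  by rewrite inE => /andP[xS xm]; split=> //; apply/unionP; exists m.
have -> : wt w (union (fun m => S :&: blk m) M) = \sum_(m in M) wt w (S :&: blk m).
  rewrite wt_indicator; under [RHS]eq_bigr do rewrite wt_indicator.
  rewrite exchange_big; apply: eq_bigr => x _; rewrite -big_distrl /=; congr muln.
  have [/unionP[a aA xa]|no] := boolP (_ \in _); last first.
    rewrite big1 // => a aA; apply/eqP; rewrite eqb0; apply: contra no => h.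
    by apply/unionP; exists a.
  rewrite (bigD1 a) //= xa big1 // => b /andP[bA ba]; apply/eqP; rewrite eqb0.
  apply: contra ba; move: xa; rewrite !inE => /andP[_ xa] /andP[_ xb].
  by apply/eqP; apply: (q_inj q) xb xa; apply: (subsetP MR).
have AM : A \subset M by apply/subsetP => m; rewrite inE => /andP[].
rewrite /cost addnC [leqRHS](big_setID A) /= (setIidPr AM); apply: leq_add.
  rewrite big_mkcondr; apply: leq_sum => a aA; case: ifP => // _; apply: hF; exact: (subsetP AM).
apply: leq_sum => m; rewrite !inE => /andP[mA mM]; rewrite mM /= negbK in mA.
by rewrite (setIidPr mA).
Qed.

(** If the component meets the merged block and also leaves it, one of its edges crosses the border.
    By [canonical_module] the merged block then has no deleted vertex, and all of it is adjacent to
    the outer end of that edge. *)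
Lemma component_union S R blk M x : canonical e S -> quotient R blk -> M \subset R ->
  uniform e R M -> x \notin S ->
  (forall r, r \in R -> [disjoint blk r & component e S x] \/ blk r \subset component e S x) ->
  (exists2 A : {set T}, A \subset M & component e S x = union blk A) \/
  ([disjoint union blk M & component e S x] \/ union blk M \subset component e S x).
Proof.
move=> can q MR mod xS hD; set X := union blk M; set D := component e S x.
have DS y : y \in D -> y \notin S by apply: comp_notin.
have [dis|/pred0Pn[y /= /andP[yX yD]]] := boolP [disjoint X & D]; first by right; left.
have [DX|] := boolP (D \subset X).
  left; exists [set m in M | blk m \subset D].
    by apply/subsetP => m; rewrite inE => /andP[].
  apply/setP => z; apply/idP/unionP => [zD|[m]]; last first.
    by rewrite inE => /andP[_ /subsetP h]; apply: h.
  have /unionP[m mM zm] := subsetP DX _ zD; exists m => //; rewrite inE mM /=.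
  case: (hD m (subsetP MR _ mM)) => // /pred0P/(_ z) /=.
  by rewrite zm zD.
case/subsetPn=> d dD dX; right; right.
have [b [c [bX cX bD cD bc]]] : exists b c, [/\ b \in X, c \notin X, b \in D, c \in D & e b c].
  pose Q b c := [&& b \in X, c \notin X, b \in D, c \in D & e b c].
  have [/existsP[b /existsP[c /and5P[]]]|no] := boolP [exists b, exists c, Q b c].
    by exists b, c.
  have : D \subset D :&: X.
    have -> : D = component e S y.
      apply/setP => z; apply/idP/idP => hz; last exact: comp_trans hz.
      by apply: comp_trans hz; rewrite comp_sym.
    apply: comp_min; first by rewrite in_setI yX comp_refl.
    move=> u v; rewrite !in_setI => /andP[hu uX] uv uS vS.
    have hv := comp_step hu uv uS vS; rewrite hv /=.
    apply: contraNT no => vX; apply/existsP; exists u; apply/existsP; exists v.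
    by rewrite /Q uX vX uv andbT /=; apply/andP; split; apply: comp_trans yD _.
  by move/subsetP/(_ d dD); rewrite in_setI (negbTE dX) andbF.
have mX := union_uniform q MR mod.
have dis : [disjoint X & S].
  by apply: (canonical_module (z := c) (u := b) e_sym can mX); rewrite ?DS // e_sym.
apply/subsetP => u uX; apply: comp_step cD _ (DS _ cD) _; last by rewrite (disjointFr dis).
by rewrite (mX c u b) // e_sym.
Qed.

End Contraction.

(** * Smallest modules by closure under splitters *)

Section Closure.
Variables (T : finType) (e : rel T).
Implicit Types (X Y M R Z : {set T}).

(** A vertex that distinguishes two elements of a module belongs to it, so the fixpoint is the least
    module of the graph on [R] containing [x] and [y]. *)
Definition closeF R x y Z : {set T} :=
  [set z | [|| z == x, z == y, z \in Z |
    (z \in R) && [exists u in Z, [exists v in Z, e z u != e z v]]]].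

Definition close R x y : {set T} := iter #|T| (closeF R x y) set0.

Lemma close_fix R x y : closeF R x y (close R x y) = close R x y.
Proof.
apply: fixsetK => Z Z' /subsetP h; apply/subsetP => z; rewrite !inE.
case/or4P=> [->|->|/h->|/andP[-> /existsP[u /andP[/h uZ /existsP[v /andP[/h vZ uv]]]]]];
  rewrite ?orbT //=.
apply/or4P/Or44/existsP; exists u; rewrite uZ; apply/existsP; exists v.
by rewrite vZ.
Qed.

Lemma close_l R x y : x \in close R x y.
Proof. by rewrite -close_fix inE eqxx. Qed.

Lemma close_r R x y : y \in close R x y.
Proof. by rewrite -close_fix inE eqxx orbT. Qed.

Lemma close_sub R x y Y : x \in Y -> y \in Y ->
  (forall z u v, z \in R -> u \in Y -> v \in Y -> e z u != e z v -> z \in Y) ->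
  close R x y \subset Y.
Proof.
move=> xY yY cl; apply/subsetP; rewrite /close; elim: #|T| => [|m IH] z /=; first by rewrite inE.
rewrite inE => /or4P[/eqP->|/eqP->|/IH|/andP[zR /existsP[u /andP[/IH uY /existsP[v /andP[/IH vY uv]]]]]] //.
exact: cl uv.
Qed.

Lemma close_uniform R x y : uniform e R (close R x y).
Proof.
move=> z u v zR zM uM vM; apply/eqP; apply: contraNT zM => uv.
rewrite -close_fix inE zR /=; apply/or4P/Or44/existsP; exists u; rewrite uM.
by apply/existsP; exists v; rewrite vM.
Qed.

Lemma close_in R x y : x \in R -> y \in R -> close R x y \subset R.
Proof. by move=> xR yR; apply: close_sub. Qed.

Lemma is_moduleP X M : reflect (M \subset X /\ uniform e X M) (is_module e X M).
Proof.
apply: (iffP andP) => -[MX h]; split=> //.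
  move=> z u v zX zM uM vM; have hz : z \in X :\: M by rewrite inE zM.
  have := implyP (forallP h z) hz; case/orP=> /forallP h'.
    by rewrite (implyP (h' u) uM) (implyP (h' v) vM).
  by rewrite (negbTE (implyP (h' u) uM)) (negbTE (implyP (h' v) vM)).
apply/forallP => z; apply/implyP; rewrite inE => /andP[zM zX].
have [->|[u uM]] := set_0Vmem M; first by apply/orP; left; apply/forallP => y; rewrite inE.
have [zu|zu] := boolP (e z u); apply/orP; [left|right]; apply/forallP=> v; apply/implyP=> vM;
  by rewrite (h z v u).
Qed.

(** If two vertices of [Y] share a part [Q], a module found in [Y :&: Q] is one of [Y], since
    vertices outside [Q] do not distinguish elements of [Q]. Otherwise [Y] has at most one vertex
    per part, hence at most [k], and is itself the module. *)
Lemma mw_small_module k X Y : mw_le e k X -> Y \subset X -> 1 < #|Y| ->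
  exists M, [/\ M \subset Y, 1 < #|M| <= k & uniform e Y M].
Proof.
move=> h; elim: h Y => {X} [X Xk|X P partP Pk modP _ IH] Y YX Y2.
  exists Y; rewrite Y2 (leq_trans (subset_leq_card YX) Xk); split=> // z u v zY.
  by rewrite zY.
have [/existsP[Q /andP[QP Q2]]|no] := boolP [exists Q in P, 1 < #|Y :&: Q|].
  have [M [MQ Mk mod]] := IH Q QP _ (subsetIr Y Q) Q2.
  exists M; split=> // [|z u v zY zM uM vM]; first exact: subset_trans MQ (subsetIl _ _).
  have [zQ|zQ] := boolP (z \in Q); first by apply: mod; rewrite // inE zY.
  have /is_moduleP[_ modQ] := modP Q QP.
  have inQ x : x \in M -> x \in Q by move/(subsetP MQ); rewrite inE => /andP[].
  by apply: modQ (subsetP YX _ zY) zQ (inQ _ uM) (inQ _ vM).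
exists Y; split=> //; last by move=> z u v zY; rewrite zY.
rewrite Y2; apply: leq_trans Pk.
have [/eqP cov triv _] := and3P partP.
have inP x : x \in Y -> pblock P x \in P /\ x \in pblock P x.
  by move/(subsetP YX); rewrite -cov => hx; rewrite pblock_mem // mem_pblock.
have inj : {in Y &, injective (pblock P)}.
  move=> x y xY yY E; have [xP xQ] := inP x xY; have [_ yQ] := inP y yY.
  apply/eqP; apply: contraNT no => xy; apply/existsP; exists (pblock P x); rewrite xP /=.
  have <- : #|[set x; y]| = 2 by rewrite cards2 xy.
  apply: subset_leq_card; apply/subsetP => z; rewrite !inE => /orP[]/eqP->.
    by rewrite xY.
  by rewrite yY E.
rewrite -(card_in_imset inj); apply: subset_leq_card; apply/subsetP => _ /imsetP[x /inP[h _] ->].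
exact: h.
Qed.

Definition better R x (acc : {set T} * nat) y :=
  let M := close R x y in
  if [&& x \in R, y \in R, x != y & #|M| < acc.2] then (M, #|M|) else acc.

(** [#|T|.+1] exceeds every size, so the first pair of distinct elements of [R] is always accepted.
    The nested folds mirror the two nested loops of the program. *)
Definition smallest_aux R : {set T} * nat :=
  foldl (fun acc x => foldl (better R x) acc (enum T)) (set0, #|T|.+1) (enum T).

(* [set0] when [R] has at most one element *)
Definition smallest R := (smallest_aux R).1.

(** [Z i] records what step [i] achieves; it persists because later steps only lower the measure. It
    is applied to the outer and to the inner fold. *)
Lemma foldl_track (U : Type) (I : eqType) (f : U -> I -> U) (Q : U -> Prop) (mes : U -> nat)
    (s : seq I) (Z : I -> nat -> Prop) a :
  (forall a i, Q a -> [/\ Q (f a i), mes (f a i) <= mes a & Z i (mes (f a i))]) ->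
  (forall i m m', m' <= m -> Z i m -> Z i m') ->
  Q a -> [/\ Q (foldl f a s), mes (foldl f a s) <= mes a &
    forall i, i \in s -> Z i (mes (foldl f a s))].
Proof.
move=> hf hZ; elim: s a => [|i s IH] a Qa //=.
have [Q1 m1 Z1] := hf a i Qa; have [Q2 m2 Z2] := IH _ Q1; split=> //.
  exact: leq_trans m2 m1.
by move=> j; rewrite inE => /orP[/eqP->|/Z2//]; apply: hZ Z1.
Qed.

Lemma smallestP R : (smallest R = set0 \/
    exists x y, [/\ x \in R, y \in R, x != y & smallest R = close R x y]) /\
  forall x y, x \in R -> y \in R -> x != y -> smallest R != set0 /\ #|smallest R| <= #|close R x y|.
Proof.
pose Q (a : {set T} * nat) := a = (set0, #|T|.+1) \/
  exists x y, [/\ x \in R, y \in R, x != y & a = (close R x y, #|close R x y|)].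
pose Zy x y m := x \in R -> y \in R -> x != y -> m <= #|close R x y|.
have [] := @foldl_track _ T (fun acc x => foldl (better R x) acc (enum T)) Q snd (enum T)
  (fun x m => forall y, Zy x y m) (set0, #|T|.+1).
- move=> a x Qa.
  have [] := @foldl_track _ T (better R x) Q snd (enum T) (Zy x) a _ _ Qa.
  + move=> b y Qb; rewrite /better /Zy; case: ifP => [/and4P[xR yR xy lt]|h]; split=> //.
    * by right; exists x, y.
    * exact: ltnW.
    * by move=> xR yR xy; move: h; rewrite xR yR xy /= => /negbT; rewrite -leqNgt.
  + by move=> y m m' lm h xR yR xy; apply: leq_trans lm (h xR yR xy).
  + by move=> h1 h2 h3; split=> // y; apply: h3; rewrite mem_enum.
- by move=> x m m' lm h y xR yR xy; apply: leq_trans lm (h y xR yR xy).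
- by left.
rewrite -/(smallest_aux R) => QM _ hM; split.
  by case: QM => [|[x [y [xR yR xy]]]] E; [left|right; exists x, y]; rewrite /smallest E.
move=> x y xR yR xy; have h := hM x (mem_enum _ _) y xR yR xy.
case: QM => [E|[x' [y' [xR' yR' xy' E]]]].
  by rewrite E /= in h; have := leq_trans h (max_card _); rewrite ltnn.
rewrite /smallest E /= in h *; split=> //; apply/set0Pn; exists x'; exact: close_l.
Qed.

Lemma smallest_sub R : smallest R \subset R.
Proof.
have [[->|[x [y [xR yR _ ->]]]] _] := smallestP R; first exact: sub0set.
exact: close_in.
Qed.

Lemma smallest_uniform R : uniform e R (smallest R).
Proof.
have [[->|[x [y [xR yR _ ->]]]] _] := smallestP R; last exact: close_uniform.
by move=> z u v _ _; rewrite inE.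
Qed.

Lemma smallest_gt1 R : 1 < #|R| -> 1 < #|smallest R|.
Proof.
case/card_gt1P=> x [y [xR yR xy]].
have [h hmin] := smallestP R; have [nz _] := hmin x y xR yR xy.
case: h => [E|[x' [y' [_ _ xy' ->]]]]; first by rewrite E eqxx in nz.
by apply/card_gt1P; exists x', y'; rewrite close_l close_r.
Qed.

Lemma smallest_le1 R : #|R| <= 1 -> smallest R = set0.
Proof.
move=> R1; have [[//|[x [y [xR yR /eqP xy _]]]] _] := smallestP R.
by case: xy; apply: (card_le1_eqP R1).
Qed.

(** The closure of two elements of a small module stays inside that module. *)
Lemma smallest_mw k R : mw_le e k setT -> #|smallest R| <= k.
Proof.
move=> hk; have [R2|/smallest_le1->] := ltnP 1 #|R|; last by rewrite cards0.
have [M [MR /andP[M2 Mk] mod]] := mw_small_module hk (subsetT R) R2.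
have /card_gt1P[x [y [xM yM xy]]] := M2.
have [_ /(_ x y)[||//|_ le]] := smallestP R; try by apply: (subsetP MR).
apply: leq_trans le (leq_trans (subset_leq_card _) Mk).
apply: close_sub => // z u v zR uM vM; apply: contraNT => zM.
by rewrite (mod z u v) // eqxx.
Qed.

End Closure.

(** * The sequence of contractions and the recursion for a fixed bound *)

Section Run.
Variables (n : nat) (e : rel 'I_n.+1) (w : 'I_n.+1 -> nat).
Hypotheses (e_sym : symmetric e) (e_irr : irreflexive e).
Notation T := 'I_n.+1.
Implicit Types (R M A S : {set T}).

(** The member of [M] with the least index represents the merged block. Hence vertex 0 is never
    dropped, and the final cost is found at a known place. *)
Definition contract R M : {set T} :=
  [set v in R | ~~ ((v \in M) && [exists u in M, (u < v)%N])].

Definition Rt t : {set T} := iter t (fun R => contract R (smallest e R)) setT.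
Definition Mt t : {set T} := smallest e (Rt t).

Fixpoint Bt (t : nat) : T -> {set T} :=
  if t is t'.+1 then merge_blk (Mt t') (Bt t') else fun v => [set v].

Definition Wt t v := wt w (Bt t v).

Lemma contract_new R M m : M \subset R -> m \in M -> exists2 r, r \in M & r \in contract R M.
Proof.
move=> MR mM; case: (@arg_minnP _ m (fun x => x \in M) (@nat_of_ord _)) => // r rM rmin.
exists r => //; rewrite inE (subsetP MR _ rM) rM /=; apply/existsP=> -[u /andP[uM]].
by rewrite ltnNge rmin.
Qed.

Lemma contract_uniq R M r r' : r \in M -> r' \in M ->
  r \in contract R M -> r' \in contract R M -> r = r'.
Proof.
move=> rM r'M; rewrite !inE rM r'M /= => /andP[_ h] /andP[_ h'].
have [lt|lt|/val_inj//] := ltngtP r r'.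
  by case/existsP: h'; exists r; rewrite rM.
by case/existsP: h; exists r'; rewrite r'M.
Qed.

Lemma quotient_Rt t : quotient e (Rt t) (Bt t).
Proof.
elim: t => [|t IH]; first exact: quotient_single.
have MR : Mt t \subset Rt t := smallest_sub _ _.
apply: (quotient_merge e_sym IH) => //.
- exact: smallest_uniform.
- by apply/subsetP => v; rewrite inE => /andP[].
- by move=> v vR vM; rewrite inE vR (negbTE vM).
- by move=> m; apply: contract_new.
- by move=> r r'; apply: contract_uniq.
Qed.

Lemma ord0_Rt t : ord0 \in Rt t.
Proof.
elim: t => [|t IH]; rewrite inE // [ord0 \in _]IH /= negb_and; apply/orP; right.
by apply/existsP=> -[u]; rewrite ltn0 andbF.
Qed.

(** A round drops a representative as long as two are left, and later rounds are idle; so one round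
    per vertex is enough. *)
Lemma card_Rt t : #|Rt t| <= (n - t).+1.
Proof.
elim: t => [|t IH]; first by rewrite cardsT card_ord subn0.
have sub : Rt t.+1 \subset Rt t by apply/subsetP => v; rewrite inE => /andP[].
have [R2|R1] := ltnP 1 #|Rt t|; last by apply: leq_trans (subset_leq_card sub) (leq_trans R1 _).
suff : #|Rt t.+1| < #|Rt t| by lia.
apply: proper_card; rewrite properE sub; apply/subsetPn.
have /card_gt1P[x [y [xM yM xy]]] := smallest_gt1 e R2.
have MR := subsetP (smallest_sub e (Rt t)).
have [xR|xR] := boolP (x \in Rt t.+1); last by exists x; rewrite // MR.
exists y; first exact: MR.
by apply: contra xy => yR; apply/eqP; apply: contract_uniq xR yR.
Qed.

Lemma Rt_last : Rt n.+1 = [set ord0].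
Proof.
apply/eqP; rewrite eq_sym eqEcard sub1set ord0_Rt cards1.
by apply: leq_trans (card_Rt _) _; lia.
Qed.

Lemma Bt_last : Bt n.+1 ord0 = setT.
Proof.
apply/setP => x; rewrite inE; have [r] := q_cover (quotient_Rt n.+1) x.
by rewrite Rt_last inE => /eqP->.
Qed.

Lemma wt_set1 v : wt w [set v] = w v.
Proof. by rewrite /wt big_set1. Qed.

(** The default is the cost of [A = set0], where no block survives. *)
Definition best p (W F : T -> nat) M : nat :=
  \big[minn/(\sum_(m in M) W m)]_(A : {set T} | (A \subset M) && feasible e p W A) cost e W F M A.

Fixpoint Ft p t (v : T) : nat :=
  if t is t'.+1 then if v \in Mt t' then best p (Wt t') (Ft p t') (Mt t') else Ft p t' v
  else if w v <= p then 0 else w v.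

Lemma Ft_solvable p t v : v \in Rt t -> solvable e w p (Bt t v) (Ft p t v).
Proof.
elim: t v => [|t IH] v vR /=.
  case: ifP => wv; last by apply: solvable_all; rewrite /wt big_set1.
  exists set0; split; rewrite ?sub0set // /wt ?big_set0 // => x; rewrite inE => /eqP-> _.
  apply: leq_trans wv; rewrite -wt_set1.
  apply: wt_sub; apply: comp_min; first by rewrite inE.
  by move=> u u' _ _ _; rewrite !inE negbK.
have vRt : v \in Rt t by move: vR; rewrite inE => /andP[].
rewrite /merge_blk; case: ifP => vM; last exact: IH.
have q := quotient_Rt t; have MR : Mt t \subset Rt t := smallest_sub _ _.
have /bigminn_leP[h|[A /andP[AM feas] h]] := leqnn (best p (Wt t) (Ft p t) (Mt t)).
  by apply: solvable_all; rewrite (wt_union w q).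
have [m mM|S [SX wS comps]] := solvable_merge e_irr q MR AM _ feas (F := Ft p t).
  by apply: IH; apply: (subsetP MR).
by exists S; split=> //; apply: leq_trans wS h.
Qed.

(** With [p] the heaviest component weight of [S], the blocks that survive [S] form one of the sets
    over which [best] minimises. *)
Lemma Ft_le S t v : canonical e S -> v \in Rt t ->
  Ft (maxcomp e w S) t v <= wt w (S :&: Bt t v).
Proof.
move=> can; elim: t v => [|t IH] v vR /=.
  case: (leqP (w v) (maxcomp e w S)) => // lt; have [vS|vS] := boolP (v \in S).
    have /setIidPr-> : [set v] \subset S by rewrite sub1set.
    by rewrite wt_set1.
  
  move: lt; rewrite ltnNge => /negP; case; apply: leq_trans (maxcomp_ge e w vS).
  rewrite -wt_set1; apply: wt_sub.
  by rewrite sub1set comp_refl.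
have vRt : v \in Rt t by move: vR; rewrite inE => /andP[].
rewrite /merge_blk; case: ifP => vM; last exact: IH.
have q := quotient_Rt t; have MR : Mt t \subset Rt t := smallest_sub _ _.
apply/bigminn_leP; right; exists (surviving S (Bt t) (Mt t)).
  rewrite (surviving_feasible e_sym e_irr can q MR) // andbT.
  by apply/subsetP => m; rewrite inE => /andP[].
by apply: (surviving_cost q MR) => m mM; apply: IH; apply: (subsetP MR).
Qed.

(** The total weight accounts for the component [V]. Being the largest entry, it also serves as the
    start of the search for the next candidate. *)
Definition candidates : seq nat :=
  wt w setT :: flatten [seq [seq \sum_(a in A) Wt t a | A <- enum (powerset (Mt t))] | t <- iota 0 n.+1].

Lemma candidate_mem t A : t <= n -> A \subset Mt t -> \sum_(a in A) Wt t a \in candidates.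
Proof.
move=> tn AM; rewrite inE; apply/orP; right; apply/flatten_mapP; exists t.
  by rewrite mem_iota.
by apply/mapP; exists A => //; rewrite mem_enum inE.
Qed.

Lemma candidates_le c : c \in candidates -> c <= wt w setT.
Proof.
rewrite inE => /orP[/eqP->//|/flatten_mapP[t _ /mapP[A]]]; rewrite mem_enum inE => AM ->.
rewrite -(wt_union w (quotient_Rt t)) ?wt_sub ?subsetT //.
exact: subset_trans AM (smallest_sub _ _).
Qed.

Lemma size_candidates Q : (forall t, t <= n -> #|Mt t| <= Q) ->
  size candidates <= (n.+1 * 2 ^ Q).+1.
Proof.
move=> hQ; rewrite /candidates; set s := flatten _; rewrite /= ltnS {}/s size_flatten /shape -map_comp sumnE big_map.
rewrite (eq_big_seq (fun t => 2 ^ #|Mt t|)); last first.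
  by move=> t _; rewrite /= size_map -cardE card_powerset.
apply: (@leq_trans (\sum_(t <- iota 0 n.+1) 2 ^ Q)); last first.
  by rewrite big_const_seq count_predT size_iota iter_addn_0 mulnC.
rewrite big_seq [leqRHS]big_seq; apply: leq_sum => t; rewrite mem_iota /= => /hQ.
by rewrite leq_exp2l.
Qed.

(** As long as every block lies inside or outside the heaviest component [D], contraction continues;
    a round that breaks this shows [D] as a union of blocks of the contracted module. If none does,
    the last block, which is [V], lies inside [D]. *)
Lemma maxcomp_candidate S : canonical e S ->
  maxcomp e w S = 0 \/ maxcomp e w S \in candidates.
Proof.
move=> can; have [h|h] := eqVneq (~: S) set0.
  by left; rewrite /maxcomp h big_set0.
have [x xS ->] : {x | x \in ~: S & maxcomp e w S = wt w (component e S x)}.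
  by apply: eq_bigmax_cond; rewrite card_gt0.
rewrite inE in xS; right; set D := component e S x.
have inv t : t <= n.+1 -> wt w D \in candidates \/
    forall r, r \in Rt t -> [disjoint Bt t r & D] \/ Bt t r \subset D.
  elim: t => [|t IH] tn.
    right=> r _ /=; rewrite sub1set; case: (boolP (r \in D)) => rD; [by right|left].
    by rewrite disjoints1.
  have [|inv] := IH (ltnW tn); first by left.
  have q := quotient_Rt t; have MR : Mt t \subset Rt t := smallest_sub _ _.
  have [[A AM E]|h'] := component_union e_sym can q MR (@smallest_uniform _ _ _) xS inv.
    left; rewrite /D E (wt_union w q) ?candidate_mem //; exact: subset_trans AM MR.
  right=> r rR; have rRt : r \in Rt t by move: rR; rewrite inE => /andP[].
  by rewrite /= /merge_blk; case: ifP => // _; apply: inv.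
have [//|/(_ ord0)] := inv n.+1 (leqnn _); rewrite Rt_last inE eqxx Bt_last => /(_ isT)[].
  by move/pred0P/(_ x); rewrite /= inE comp_refl.
rewrite subTset => /eqP ->; exact: mem_head.
Qed.

Lemma wvi_sound p k : p + Ft p n.+1 ord0 <= k -> wvi e w <= k.
Proof.
have [S [_ wS comps]] := Ft_solvable p (ord0_Rt n.+1); rewrite Bt_last in comps.
move=> h; apply/wvi_le; exists S; apply: leq_trans h; rewrite addnC; apply: leq_add => //.
apply/bigmax_leqP => x; rewrite inE => xS; have := comps x (in_setT _) xS.
by rewrite setCT setU0.
Qed.

(** [p = 0] covers the deletion of all vertices, where no component is left. *)
Lemma wvi_complete k : wvi e w <= k ->
  exists2 p, p = 0 \/ p \in candidates & p + Ft p n.+1 ord0 <= k.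
Proof.
have [S can opt] := canonical_optimum w e_sym.
case/wvi_le => S' /(leq_trans (opt S')) h.
exists (maxcomp e w S); first exact: maxcomp_candidate.
apply: leq_trans h; rewrite addnC leq_add2r; apply: leq_trans (Ft_le can (ord0_Rt _)) _.
by apply: wt_sub; apply: subsetIl.
Qed.

End Run.

(** * Enumeration of subsets by a binary counter *)

Section Counter.
Variable m : nat -> bool.
Implicit Type a : nat -> bool.

(** The members of [m] are the digit positions of a binary number, lowest first; [full] tells that a
    carry arrives from below. *)
Definition rank k := \sum_(i < k) m i.
Definition num a k := \sum_(i < k) (m i && a i) * 2 ^ rank i.
Definition full a k := ~~ [exists u : 'I_k, m u && ~~ a u].
Definition incr_bits a i := m i && (a i (+) full a i).

Lemma fullS a k : full a k.+1 = full a k && (m k ==> a k).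
Proof.
apply/idP/andP => [/existsPn h|[/existsPn h /implyP hk]].
  split; last by have := h ord_max; rewrite /= negb_and negbK -implybE.
  by apply/existsPn => u; have := h (widen_ord (leqnSn k) u).
apply/existsPn => u; have [uk|] := ltnP u k; first exact: (h (Ordinal uk)).
move=> ku; have -> : val u = k by apply/eqP; rewrite eqn_leq ku -ltnS ltn_ord.
by case: (m k) hk => // /(_ isT)->.
Qed.

(** Flipping a digit exactly when all lower ones are set adds 1, and the number with all digits set
    wraps around to 0. *)
Lemma num_incr a k : (num a k < 2 ^ rank k) /\
  (if full a k then (num a k).+1 = 2 ^ rank k /\ num (incr_bits a) k = 0
   else num (incr_bits a) k = (num a k).+1).
Proof.
elim: k => [|k [lt IH]].
  have -> : full a 0 by apply/existsPn => -[].
  by rewrite /num /rank !big_ord0.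
rewrite fullS; rewrite /num /rank !big_ord_recr -/(rank k) -/(num a k) -/(num (incr_bits a) k) /=.
have -> : incr_bits a k = m k && (a k (+) full a k) by [].
rewrite expnD; case: (m k) => /=; rewrite ?expn1.
  by case: (full a k) IH => [[E1 E2]|E]; case: (a k) => /=; lia.
by rewrite expn0 !addn0 muln1 andbT; split.
Qed.

Lemma num_inj a b k : num a k = num b k -> forall i, i < k -> m i -> a i = b i.
Proof.
elim: k => // k IH; rewrite /num !big_ord_recr -/(num a k) -/(num b k) /=.
have [la _] := num_incr a k; have [lb _] := num_incr b k.
move=> E; have Ek : (m k && a k) = (m k && b k).
  by move: E; case: (_ && _); case: (_ && _) => //=; lia.
rewrite Ek in E; have {E} E : num a k = num b k by lia.
move=> i; rewrite ltnS leq_eqVlt => /orP[/eqP-> mk|ik mi]; last exact: IH.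
by move: Ek; rewrite mk.
Qed.

End Counter.

Definition incr_set n (M A : {set 'I_n.+1}) : {set 'I_n.+1} :=
  [set v in M | (v \in A) (+) ~~ [exists u in M, (u < v)%N && (u \notin A)]].

(** Counting up from the empty set, [A] appears at the step given by its own number. *)
Lemma incr_set_all n (M A : {set 'I_n.+1}) : A \subset M ->
  exists2 j, j < 2 ^ #|M| & iter j (incr_set M) set0 = A.
Proof.
move=> AM; pose bits (B : {set 'I_n.+1}) i := inord i \in B.
pose m := bits M; pose nm B := num m (bits B) n.+1.
have rankE : rank m n.+1 = #|M|.
  rewrite /rank -sum1_card [RHS]big_mkcond; apply: eq_bigr => i _.
  by rewrite /m /bits inord_val; case: (_ \in _).
have incrE B : nm (incr_set M B) = num m (incr_bits m (bits B)) n.+1.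
  rewrite /nm /num; apply: eq_bigr => i _; congr (nat_of_bool _ * _).
  rewrite {1 2}/bits inord_val inE /incr_bits /m /bits inord_val; case: (i \in M) => //=.
  congr (_ (+) ~~ _); apply/existsP/existsP => -[u].
    by case/and3P=> uM ui uB; exists (Ordinal ui); rewrite /= inord_val uM.
  have un : u < n.+1 by apply: ltn_trans (ltn_ord u) (ltn_ord i).
  case/andP=> uM uB; exists (inord u); rewrite uM uB inordK // andbT; exact: ltn_ord.
have sub j : iter j (incr_set M) set0 \subset M.
  by case: j => [|j]; [exact: sub0set | apply/subsetP => v; rewrite inE => /andP[]].
have lt B : nm B < 2 ^ #|M| by rewrite -rankE; have [] := num_incr m (bits B) n.+1.
have cnt j : j < 2 ^ #|M| -> nm (iter j (incr_set M) set0) = j.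
  elim: j => [|j IH] hj.
    by rewrite /nm /num big1 // => i _; rewrite /bits inE andbF.
  have Ej := IH (ltnW hj); rewrite iterS incrE.
  have [_] := num_incr m (bits (iter j (incr_set M) set0)) n.+1.
  case: ifP => _; rewrite -/(nm _) Ej // rankE => -[E _]; by rewrite E ltnn in hj.
exists (nm A); first exact: lt.
have E := cnt _ (lt A); have inj := num_inj E.
apply/setP => v; have [vM|vM] := boolP (v \in M); last first.
  have no (B : {set 'I_n.+1}) : B \subset M -> v \in B = false.
    by move=> BM; apply: contraNF vM; apply: (subsetP BM).
  by rewrite !no.
by have := inj v (ltn_ord v); rewrite /m /bits inord_val => /(_ vM).
Qed.

(** * The algorithm as a program *)

Definition ENot a := EIf a (EC 0) (EC 1).
Definition EAnd a b := EIf a (EIf b (EC 1) (EC 0)) (EC 0).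
Definition EOr a b := EIf a (EC 1) (EIf b (EC 1) (EC 0)).
Definition ELt a b := EIf (ESub b a) (EC 1) (EC 0).
Definition EEq a b := EIf (ESub a b) (EC 0) (EIf (ESub b a) (EC 0) (EC 1)).
Definition EExists x a := EIf (ESum x a) (EC 1) (EC 0).
(** [CArr] may not read the array that it writes, so the new entries are built in the scratch array
    15 and copied afterwards. *)
Definition CUpd a x e := CSeq (CArr 15 x e) (CArr a x (EA 15 (EI 0))).

Infix ";;" := CSeq (at level 90, right associativity).

Lemma evalNot s r d a : eval s r d (ENot a) = (eval s r d a == 0).
Proof. by rewrite /ENot /=; case: eqP. Qed.

Lemma evalAnd s r d a b : eval s r d (EAnd a b) = (eval s r d a != 0) && (eval s r d b != 0).
Proof. by rewrite /EAnd /=; case: eqP => //= _; case: eqP. Qed.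

Lemma evalOr s r d a b : eval s r d (EOr a b) = (eval s r d a != 0) || (eval s r d b != 0).
Proof. by rewrite /EOr /=; case: eqP => //= _; case: eqP. Qed.

Lemma evalLt s r d a b : eval s r d (ELt a b) = (eval s r d a < eval s r d b).
Proof. by rewrite /ELt /= subn_eq0 -ltnNge; case: ltnP. Qed.

Lemma evalEq s r d a b : eval s r d (EEq a b) = (eval s r d a == eval s r d b).
Proof. by rewrite /EEq /= !subn_eq0 eqn_leq; case: leqP => //= _; case: leqP. Qed.

Lemma nat_neq0 (b : bool) : (b != 0 :> nat) = b. Proof. by case: b. Qed.
Lemma nat_eq0 (b : bool) : (b == 0 :> nat) = ~~ b. Proof. by case: b. Qed.

Lemma mem_neq0 (U : finType) (x : U) (A : {set U}) : (nat_of_bool (x \in A) != 0) = (x \in A).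
Proof. exact: nat_neq0. Qed.

Lemma trueNot s r d a : (eval s r d (ENot a) != 0) = (eval s r d a == 0).
Proof. by rewrite evalNot nat_neq0. Qed.

Lemma trueAnd s r d a b :
  (eval s r d (EAnd a b) != 0) = (eval s r d a != 0) && (eval s r d b != 0).
Proof. by rewrite evalAnd nat_neq0. Qed.

Lemma trueOr s r d a b :
  (eval s r d (EOr a b) != 0) = (eval s r d a != 0) || (eval s r d b != 0).
Proof. by rewrite evalOr nat_neq0. Qed.

Lemma trueLt s r d a b : (eval s r d (ELt a b) != 0) = (eval s r d a < eval s r d b).
Proof. by rewrite evalLt nat_neq0. Qed.

Lemma trueEq s r d a b : (eval s r d (EEq a b) != 0) = (eval s r d a == eval s r d b).
Proof. by rewrite evalEq nat_neq0. Qed.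

Lemma falseEq s r d a b : (eval s r d (EEq a b) == 0) = (eval s r d a != eval s r d b).
Proof. by rewrite evalEq nat_eq0. Qed.

Definition evE := (trueNot, trueAnd, trueOr, trueLt, trueEq, falseEq,
  evalNot, evalAnd, evalOr, evalLt, evalEq).

Lemma evalSum N s r d x a : sc s x = N ->
  eval s r d (ESum x a) = \sum_(i < N) eval s (upd r d i) d.+1 a.
Proof. by move=> <-. Qed.

Lemma evalEx N s r d x a : sc s x = N ->
  eval s r d (EExists x a) = [exists i : 'I_N, eval s (upd r d i) d.+1 a != 0].
Proof.
move=> <-; rewrite /EExists /= sum_nat_eq0 negb_forall.
by case: existsP.
Qed.

Lemma trueEx N s r d x a : sc s x = N ->
  (eval s r d (EExists x a) != 0) = [exists i : 'I_N, eval s (upd r d i) d.+1 a != 0].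
Proof. by move=> xN; rewrite (evalEx _ _ _ xN) nat_neq0. Qed.

(** * Frame conditions and rules for loops *)

Definition agree (X Y : seq nat) (s s' : store) : Prop :=
  (forall x, x \notin X -> sc s' x = sc s x) /\ (forall a, a \notin Y -> ar s' a = ar s a).

Lemma agree_den c s : agree (wr_sc c) (wr_ar c) s (den c s).
Proof. by split=> [x|a]; [apply: den_sc | apply: den_ar]. Qed.

(** The invariant has to ignore the counter, which [CFor] sets by itself. Each round may use that
    the store agrees with the initial one outside what the loop writes, so an invariant only
    mentions what changes. *)
Lemma for_ind i x c s (P : nat -> store -> Prop) :
  (forall j s' v, P j s' -> P j (set_sc s' i v)) -> P 0 s ->
  (forall j s', j < sc s x -> agree (i :: wr_sc c) (wr_ar c) s s' -> sc s' i = j ->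
     P j s' -> P j.+1 (den c s')) ->
  P (sc s x) (den (CFor i x c) s).
Proof.
move=> stab P0 step /=; apply: (stab); set n := sc s x in step *.
set S := fun j => foldl (fun s j => den c (set_sc s i j)) s (iota 0 j).
suff h j : j <= n -> agree (i :: wr_sc c) (wr_ar c) s (S j) /\ P j (S j) by have [] := h n.
elim: j => [|j IH] jn; first by split.
have [[A1 A2] Pj] := IH (ltnW jn).
have -> : S j.+1 = den c (set_sc (S j) i j) by rewrite /S -addn1 iotaD foldl_cat.
have A' : agree (i :: wr_sc c) (wr_ar c) s (set_sc (S j) i j).
  split=> // y hy /=; rewrite updN ?A1 //; by apply: contraNneq hy => ->; rewrite mem_head.
split; last by apply: step => //; [rewrite /= updE eqxx | apply: stab].
split=> [y hy|a ha]; first by rewrite den_sc ?A'.1 //; move: hy; rewrite inE negb_or => /andP[].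
by rewrite den_ar ?A'.2.
Qed.

(** For loops specified by a [foldl]: [Q] relates the abstract accumulator to the store. *)
Lemma for_fold N (U : Type) (f : U -> 'I_N -> U) (Q : U -> store -> Prop) i x c s u :
  sc s x = N -> (forall u s' v, Q u s' -> Q u (set_sc s' i v)) -> Q u s ->
  (forall (j : 'I_N) u s', agree (i :: wr_sc c) (wr_ar c) s s' -> sc s' i = j -> Q u s' ->
     Q (f u j) (den c s')) ->
  Q (foldl f u (enum 'I_N)) (den (CFor i x c) s).
Proof.
move=> xN stab Q0 step.
pose P j s' := Q (foldl f u (take j (enum 'I_N))) s'.
suff : P (sc s x) (den (CFor i x c) s) by rewrite /P xN take_oversize ?size_enum_ord.
apply: for_ind => [j s' v||j s' jN A ij Qj]; [exact: stab | by rewrite /P take0 |].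
rewrite xN in jN; rewrite /P in Qj *.
have jE : nth (Ordinal jN) (enum 'I_N) j = Ordinal jN by apply: val_inj; rewrite /= nth_enum_ord.
rewrite (take_nth (Ordinal jN)) ?size_enum_ord // foldl_rcons jE.
by apply: step.
Qed.

Lemma den_upd a x e s i : a != 15 ->
  ar (den (CUpd a x e) s) a i = if i < sc s x then eval s (upd r0 0 i) 1 e else ar s a i.
Proof. by move=> a15 /=; rewrite eqxx updE /= (negbTE a15); case: ifP => // ->. Qed.

Lemma upd_ord N a x e s (i : 'I_N) : sc s x = N -> a != 15 ->
  ar (den (CUpd a x e) s) a i = eval s (upd r0 0 i) 1 e.
Proof. by move=> xN a15; rewrite den_upd // xN ltn_ord. Qed.

Lemma den_seq c1 c2 s : den (c1 ;; c2) s = den c2 (den c1 s). Proof. by []. Qed.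

Lemma set_val x e s : sc (den (CSet x e) s) x = eval s r0 0 e.
Proof. by rewrite /= updE eqxx. Qed.

Definition is_set N (s : store) a (X : {set 'I_N}) : Prop := forall i : 'I_N, ar s a i = (i \in X).

Definition EAdj u v := EA 0 (EAdd (EA 1 u) v).

(* Scalars: 0 input size (finally the answer), 1 number of vertices, 2 bound on the number of
   subsets of a contracted module, 3 bound on the number of candidates, 4 reading position,
   5 reading flag, 6 number being read, 7 current power of 2, 10 current bit, 11 [k], 12 largest
   contracted module, 13 total weight, 15 16 the pair being closed, 18 size of its closure,
   19 least size so far, 20 test result, 21 [p], 22 verdict, 24 next candidate, 26 best cost,
   27 cost of the current subset, 28 its feasibility, 29 a vertex, 31 32 size and weight of its
   component, 33 weight of the current subset; 8 9 14 17 23 25 29 30 are loop counters.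
   Arrays: 0 input (from index 1), 1 offsets of the adjacency rows in array 0, 2 weights,
   3 alive representatives, 4 closure, 5 smallest closure, 6 block weights, 7 block costs for [p],
   8 current subset, 9 component, 15 scratch. *)
Definition c_close_step :=
  CUpd 4 1 (EOr (EEq (EI 0) (EV 15)) (EOr (EEq (EI 0) (EV 16)) (EOr (EA 4 (EI 0))
    (EAnd (EA 3 (EI 0)) (EExists 1 (EAnd (EA 4 (EI 1)) (EExists 1 (EAnd (EA 4 (EI 2))
      (ENot (EEq (EAdj (EI 0) (EI 1)) (EAdj (EI 0) (EI 2)))))))))))).

Definition c_close := CUpd 4 1 (EC 0) ;; CFor 17 1 c_close_step.

Definition c_better :=
  c_close ;;
  CSet 18 (ESum 1 (EA 4 (EI 0))) ;;
  CSet 20 (EAnd (EA 3 (EV 15)) (EAnd (EA 3 (EV 16))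
    (EAnd (ENot (EEq (EV 15) (EV 16))) (ELt (EV 18) (EV 19))))) ;;
  CUpd 5 1 (EIf (EV 20) (EA 4 (EI 0)) (EA 5 (EI 0))) ;;
  CSet 19 (EIf (EV 20) (EV 18) (EV 19)).

Definition c_smallest :=
  CUpd 5 1 (EC 0) ;;
  CSet 19 (EAdd (EV 1) (EC 1)) ;;
  CFor 15 1 (CFor 16 1 c_better).

Definition c_contract :=
  CUpd 3 1 (EIf (EAnd (EA 5 (EI 0)) (EExists 1 (EAnd (EA 5 (EI 1)) (ELt (EI 1) (EI 0)))))
    (EC 0) (EA 3 (EI 0))).

Definition c_reach_step :=
  CUpd 9 1 (EOr (EEq (EI 0) (EV 29)) (EOr (EA 9 (EI 0))
    (EAnd (EA 8 (EI 0)) (EExists 1 (EAnd (EA 9 (EI 1)) (EAdj (EI 1) (EI 0))))))).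

Definition c_reach := CUpd 9 1 (EC 0) ;; CFor 30 1 c_reach_step.

Definition ESumIf b a := ESum 1 (EIf b a (EC 0)).

Definition c_scan_step :=
  c_reach ;;
  CSet 31 (ESum 1 (EA 9 (EI 0))) ;;
  CSet 32 (ESumIf (EA 9 (EI 0)) (EA 6 (EI 0))) ;;
  CSet 27 (EIf (EAnd (EA 8 (EV 29)) (EEq (EV 31) (EC 1))) (EAdd (EV 27) (EA 7 (EV 29))) (EV 27)) ;;
  CSet 28 (EIf (EAnd (EA 8 (EV 29)) (EAnd (ENot (EEq (EV 31) (EC 1))) (ELt (EV 21) (EV 32))))
    (EC 0) (EV 28)).

Definition c_scan :=
  CSet 27 (ESumIf (EAnd (EA 5 (EI 0)) (ENot (EA 8 (EI 0)))) (EA 6 (EI 0))) ;;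
  CSet 28 (EC 1) ;;
  CFor 29 1 c_scan_step.

Definition c_incr :=
  CUpd 8 1 (EAnd (EA 5 (EI 0)) (EIf (EExists 1 (EAnd (EA 5 (EI 1)) (EAnd (ELt (EI 1) (EI 0))
      (ENot (EA 8 (EI 1)))))) (EA 8 (EI 0)) (ENot (EA 8 (EI 0))))).

(** The same pass over the subsets serves two minima: the cost of the module, and the least subset
    weight above [p], which is the next candidate. *)
Definition c_subset :=
  c_scan ;;
  CSet 26 (EIf (EAnd (EV 28) (ELt (EV 27) (EV 26))) (EV 27) (EV 26)) ;;
  CSet 33 (ESumIf (EA 8 (EI 0)) (EA 6 (EI 0))) ;;
  CSet 24 (EIf (EAnd (ELt (EV 21) (EV 33)) (ELt (EV 33) (EV 24))) (EV 33) (EV 24)) ;;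
  c_incr.

(** Cost and weight of the merged block are stored at all members of the module, so these updates do
    not depend on which member becomes the representative. *)
Definition c_step :=
  c_smallest ;;
  CSet 26 (ESumIf (EA 5 (EI 0)) (EA 6 (EI 0))) ;;
  CUpd 8 1 (EC 0) ;;
  CFor 25 2 c_subset ;;
  CUpd 7 1 (EIf (EA 5 (EI 0)) (EV 26) (EA 7 (EI 0))) ;;
  CUpd 6 1 (EIf (EA 5 (EI 0)) (ESum 1 (EIf (EA 5 (EI 1)) (EA 6 (EI 1)) (EC 0))) (EA 6 (EI 0))) ;;
  c_contract.

Definition c_eval :=
  CUpd 3 1 (EC 1) ;;
  CUpd 6 1 (EA 2 (EI 0)) ;;
  CUpd 7 1 (EIf (ELt (EV 21) (EA 2 (EI 0))) (EA 2 (EI 0)) (EC 0)) ;;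
  CSet 24 (EV 13) ;;
  CFor 14 1 c_step.

Definition c_try :=
  c_eval ;;
  CSet 22 (EIf (ELt (EV 11) (EAdd (EV 21) (EA 7 (EC 0)))) (EV 22) (EC 1)) ;;
  CSet 21 (EV 24).

Definition c_main :=
  CSet 21 (EC 0) ;;
  CSet 22 (EC 0) ;;
  CFor 23 3 c_try ;;
  CSet 0 (EV 22).

(** The length of a code is not known beforehand, so parsing takes as many rounds as the input is
    long. The terminator clears flag 5, after which the rounds are idle and the position stays
    put. *)
Definition c_parse_step :=
  CSet 10 (EAnd (EV 5) (EA 0 (EV 4))) ;;
  CSet 6 (EIf (EV 10) (EAdd (EV 6) (EIf (EA 0 (EAdd (EV 4) (EC 1))) (EV 7) (EC 0))) (EV 6)) ;;
  CSet 7 (EIf (EV 10) (EAdd (EV 7) (EV 7)) (EV 7)) ;;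
  CSet 4 (EAdd (EV 4) (EIf (EV 5) (EIf (EV 10) (EC 2) (EC 1)) (EC 0))) ;;
  CSet 5 (EV 10).

Definition c_parse := CSet 5 (EC 1) ;; CSet 6 (EC 0) ;; CSet 7 (EC 1) ;; CFor 9 0 c_parse_step.

Definition c_weight := c_parse ;; CUpd 2 1 (EIf (EEq (EI 0) (EV 8)) (EV 6) (EA 2 (EI 0))).

(** Position [i] counts when no position up to [i] holds a 0, which gives the length of the leading
    block of ones. *)
Definition c_size :=
  CSet 1 (ESum 0 (ENot (EExists 0 (EAnd (ENot (ELt (EI 0) (EI 1))) (ENot (EA 0 (EAdd (EI 1) (EC 1)))))))).

(** Products are sums of a constant, as the machine does not multiply. The matrix starts at index
    [N + 2]: indices begin at 1, and [N] ones and a 0 precede it. *)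
Definition c_read :=
  CUpd 1 1 (EAdd (EAdd (EV 1) (EC 2)) (ESum 1 (EIf (ELt (EI 1) (EI 0)) (EV 1) (EC 0)))) ;;
  CSet 4 (EAdd (EAdd (EV 1) (EC 2)) (ESum 1 (EV 1))) ;;
  CFor 8 1 c_weight ;;
  c_parse ;;
  CSet 11 (EV 6) ;;
  CSet 13 (ESum 1 (EA 2 (EI 0))).

Definition c_width_step :=
  c_smallest ;;
  CSet 18 (ESum 1 (EA 5 (EI 0))) ;;
  CSet 12 (EIf (ELt (EV 12) (EV 18)) (EV 18) (EV 12)) ;;
  c_contract.

(** A dry run of the contractions, without weights, finds the largest module size [q], from which
    the loop bounds [2 ^ q] and [2 + N * 2 ^ q] follow. The power comes from doubling in a loop of
    [N] rounds, idle after the first [q]. *)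
Definition c_bounds :=
  CUpd 3 1 (EC 1) ;;
  CSet 12 (EC 0) ;;
  CFor 14 1 c_width_step ;;
  CSet 2 (EC 1) ;;
  CFor 14 1 (CSet 2 (EIf (ELt (EV 14) (EV 12)) (EAdd (EV 2) (EV 2)) (EV 2))) ;;
  CSet 3 (EAdd (EC 2) (ESum 1 (EV 2))).

Definition c_setup := c_read ;; c_bounds.

Lemma wf_size : wf_c [:: 0] c_size. Proof. by []. Qed.
Lemma wf_setup : wf_c [:: 0; 1] c_setup. Proof. by []. Qed.
Lemma wf_main : wf_c [:: 1; 2; 3] c_main. Proof. by []. Qed.

Global Opaque ENot EAnd EOr ELt EEq EExists.

(** * Specifications of the commands of the algorithm *)

Section Blocks.
Variables (n : nat) (e : rel 'I_n.+1).
Notation T := 'I_n.+1.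
Implicit Types (R M A Z : {set T}) (i u v x y z : T).

Definition base (s : store) : Prop :=
  sc s 1 = n.+1 /\ forall u v, ar s 0 (ar s 1 u + v) = e u v.

Lemma base_agree X Y s s' : agree X Y s s' -> (1 \notin X) && (0 \notin Y) && (1 \notin Y) ->
  base s -> base s'.
Proof.
move=> [h1 h2] /andP[/andP[X1 Y0] Y1] [b1 b2]; split=> [|u v]; first by rewrite h1.
by rewrite !h2.
Qed.

Lemma base_den c s : (1 \notin wr_sc c) && (0 \notin wr_ar c) && (1 \notin wr_ar c) ->
  base s -> base (den c s).
Proof. exact: base_agree (agree_den c s). Qed.

Lemma close_spec s R x y : base s -> is_set s 3 R -> sc s 15 = x -> sc s 16 = y ->
  is_set (den c_close s) 4 (close e R x y).
Proof.
move=> hb hR hx hy; rewrite /c_close den_seq; set s0 := den (CUpd 4 1 (EC 0)) s.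
have b0 : base s0 by apply: base_den hb.
pose P k s' := is_set s' 4 (iter k (closeF e R x y) set0).
suff : P (sc s0 1) (den (CFor 17 1 c_close_step) s0).
  by rewrite /P b0.1 /close card_ord.
apply: for_ind => [//||k s' _ A _ Pk i].
  by move=> i; rewrite (upd_ord _ _ hb.1) // inE.
have b' : base s' by apply: base_agree A _ b0.
have [A1 A2] := A.
rewrite (upd_ord _ _ b'.1) // !evE /= A1 // A1 // /s0 den_sc // den_sc // hx hy Pk A2 //.
rewrite /s0 den_ar // hR [i \in closeF _ _ _ _ _]inE !mem_neq0; congr nat_of_bool.
do 3!(congr orb); congr andb.
rewrite (trueEx _ _ _ b'.1); apply: eq_existsb => u.
rewrite !evE /= Pk mem_neq0; congr andb.
rewrite (trueEx _ _ _ b'.1); apply: eq_existsb => v.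
rewrite !evE /= Pk mem_neq0; congr andb.
rewrite (b'.2 i u) (b'.2 i v).
by case: (e i u); case: (e i v).
Qed.

Lemma card_set s a M : base s -> is_set s a M -> eval s r0 0 (ESum 1 (EA a (EI 0))) = #|M|.
Proof.
move=> hb hM; rewrite (evalSum _ _ _ hb.1) -sum1_card [RHS]big_mkcond.
by apply: eq_bigr => i _; rewrite /= hM; case: (i \in M).
Qed.

Lemma is_set_den c s a M : a \notin wr_ar c -> is_set s a M -> is_set (den c s) a M.
Proof. by move=> ha hM i; rewrite den_ar. Qed.

Lemma is_set_agree X Y s s' a M : agree X Y s s' -> a \notin Y -> is_set s a M -> is_set s' a M.
Proof. by move=> [_ h] ha hM i; rewrite h. Qed.

Lemma better_spec s R (acc : {set T} * nat) x y : base s -> is_set s 3 R ->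
  sc s 15 = x -> sc s 16 = y -> is_set s 5 acc.1 -> sc s 19 = acc.2 ->
  let s' := den c_better s in
  is_set s' 5 (better e R x acc y).1 /\ sc s' 19 = (better e R x acc y).2.
Proof.
move=> hb hR hx hy hM hm; cbv zeta.
rewrite /c_better den_seq; set s1 := den c_close s.
have A1 : agree _ _ s s1 := agree_den _ _.
have b1 := base_agree A1 isT hb.
have h1 : is_set s1 4 (close e R x y) by apply: close_spec.
clearbody s1; rewrite den_seq; set s2 := den _ s1.
have A2 : agree _ _ s1 s2 := agree_den _ _.
have h18 : sc s2 18 = #|close e R x y| by rewrite /s2 set_val (card_set b1 h1).
have b2 := base_agree A2 isT b1.
clearbody s2; rewrite den_seq; set s3 := den _ s2.
have A3 : agree _ _ s2 s3 := agree_den _ _.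
pose g := [&& x \in R, y \in R, x != y & #|close e R x y| < acc.2].
have h20 : sc s3 20 = g.
  rewrite /s3 set_val !evE /=.
  rewrite (A2.1 15) // (A2.1 16) // (A2.1 19) // (A2.2 3) // h18.
  by rewrite (A1.1 15) // (A1.1 16) // (A1.1 19) // (A1.2 3) // hx hy hm !hR !mem_neq0.
have b3 := base_agree A3 isT b2.
clearbody s3; rewrite den_seq; set s4 := den _ s3.
have A4 : agree _ _ s3 s4 := agree_den _ _.
have h5 : is_set s4 5 (better e R x acc y).1.
  move=> i; rewrite (upd_ord _ _ b3.1) //= h20 nat_neq0 /better -/g.
  rewrite (A3.2 4) // (A2.2 4) // h1 (A3.2 5) // (A2.2 5) // (A1.2 5) // hM.
  by case: ifP.
clearbody s4; split; first exact: is_set_den.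
rewrite set_val /= (A4.1 20) // h20 nat_neq0 (A4.1 18) // (A3.1 18) // h18.
rewrite (A4.1 19) // (A3.1 19) // (A2.1 19) // (A1.1 19) // hm.
by rewrite /better -/g; case: ifP.
Qed.

Lemma smallest_spec s R : base s -> is_set s 3 R -> is_set (den c_smallest s) 5 (smallest e R).
Proof.
move=> hb hR; rewrite /c_smallest den_seq; set s1 := den _ s.
have b1 : base s1 by apply: base_den hb.
have h1 : is_set s1 5 (set0 : {set T}) by move=> i; rewrite /s1 (upd_ord _ _ hb.1) // inE.
have R1 : is_set s1 3 R by apply: is_set_den.
rewrite den_seq; set s2 := den _ s1.
have b2 : base s2 by apply: base_den b1.
have h19 : sc s2 19 = n.+2 by rewrite /s2 set_val /= b1.1 addn1.
pose Q (acc : {set T} * nat) s' := is_set s' 5 acc.1 /\ sc s' 19 = acc.2.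
have R2 : is_set s2 3 R by apply: is_set_den.
suff [//] : Q (smallest_aux e R) (den (CFor 15 1 (CFor 16 1 c_better)) s2).
apply: (for_fold b2.1) => [//||x acc s' A hx Qs].
  by split; [apply: is_set_den | rewrite h19 /= card_ord].
have b' : base s' by apply: base_agree A _ b2.
have R' : is_set s' 3 R by apply: is_set_agree A _ R2.
apply: (for_fold b'.1) => [//|//|y acc' s'' A' hy [Q1 Q2]].
apply: better_spec => //; first exact: base_agree A' _ b'.
  exact: is_set_agree A' _ R'.
by rewrite A'.1.
Qed.

Lemma contract_spec s R M : base s -> is_set s 3 R -> is_set s 5 M ->
  is_set (den c_contract s) 3 (contract R M).
Proof.
move=> hb hR hM i; rewrite (upd_ord _ _ hb.1) // [eval _ _ _ _]/= !evE (trueEx _ _ _ hb.1).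
have -> : [exists u : T, eval s (upd (upd r0 0 i) 1 u) 2 (EAnd (EA 5 (EI 1)) (ELt (EI 1) (EI 0))) != 0]
    = [exists u in M, u < i].
  by apply: eq_existsb => u; rewrite !evE /= hM mem_neq0.
by rewrite /= hM mem_neq0 hR inE; case: (_ && _); rewrite ?andbF ?andbT.
Qed.

Lemma reach_spec s A a : base s -> is_set s 8 A -> sc s 29 = nat_of_ord a ->
  is_set (den c_reach s) 9 (reach_in e A a).
Proof.
move=> hb hA ha; rewrite /c_reach den_seq; set s0 := den _ s.
have A0 : agree _ _ s s0 := agree_den _ _.
have b0 := base_agree A0 isT hb.
have h0 : is_set s0 9 (set0 : {set T}) by move=> i; rewrite /s0 (upd_ord _ _ hb.1) // inE.
clearbody s0.
pose P k s' := is_set s' 9 (iter k (reachF e A a) set0).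
suff : P (sc s0 1) (den (CFor 30 1 c_reach_step) s0) by rewrite /P b0.1 /reach_in card_ord.
apply: for_ind => [//|//|k s' _ A1 _ Pk i].
have b' := base_agree A1 isT b0.
rewrite (upd_ord _ _ b'.1) // !evE /= (A1.1 29) // (A0.1 29) // ha Pk (A1.2 8) // (A0.2 8) //.
rewrite hA [i \in reachF _ _ _ _]inE !mem_neq0; congr nat_of_bool.
do 2!(congr orb); congr andb.
rewrite (trueEx _ _ _ b'.1); apply: eq_existsb => u.
by rewrite !evE /= Pk mem_neq0 (b'.2 u i) nat_neq0.
Qed.

Lemma evalSumIf s b a (P : pred T) (G : T -> nat) : base s ->
  (forall i, (eval s (upd r0 0 i) 1 b != 0) = P i) ->
  (forall i, eval s (upd r0 0 i) 1 a = G i) ->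
  eval s r0 0 (ESumIf b a) = \sum_(i | P i) G i.
Proof.
move=> hb hP hG; rewrite /ESumIf (evalSum _ _ _ hb.1) [RHS]big_mkcond.
by apply: eq_bigr => i _; rewrite [LHS]/= hP hG.
Qed.

Lemma foldl_scan (F : T -> nat) (P1 P2 : pred T) (l : seq T) c o :
  foldl (fun co a => (if P1 a then co.1 + F a else co.1, if P2 a then 0 else co.2)) (c, o) l =
  (c + \sum_(a <- l | P1 a) F a, if has P2 l then 0 else o).
Proof.
elim: l c o => [|a l IH] c o /=; first by rewrite big_nil addn0.
rewrite IH big_cons; congr pair; first by case: (P1 a); rewrite ?addnA.
by case: (P2 a); case: (has P2 l).
Qed.

Section Scan.
Variables (M : {set T}) (W F : T -> nat) (p : nat).

Definition scannable (s : store) A : Prop :=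
  [/\ base s, is_set s 5 M, is_set s 8 A, (forall v, ar s 6 v = W v) &
    (forall v, ar s 7 v = F v) /\ sc s 21 = p].

Lemma scannable_agree X Y s s' A : agree X Y s s' ->
  [&& 1 \notin X, 21 \notin X & all (fun a => a \notin Y) [:: 0; 1; 5; 6; 7; 8]] ->
  scannable s A -> scannable s' A.
Proof.
move=> ag /and3P[X1 X21 /and5P[Y0 Y1 Y5 Y6 /and3P[Y7 Y8 _]]] [hb h5 h8 h6 [h7 hp]].
split; [|exact: is_set_agree ag _ h5|exact: is_set_agree ag _ h8| |split].
- by apply: base_agree ag _ hb; rewrite X1 Y0.
- by move=> v; rewrite ag.2.
- by move=> v; rewrite ag.2.
- by rewrite ag.1.
Qed.

Lemma scan_spec s A : scannable s A ->
  sc (den c_scan s) 27 = cost e W F M A /\ sc (den c_scan s) 28 = feasible e p W A.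
Proof.
move=> hs; have [hb h5 h8 h6 [h7 hp]] := hs; rewrite /c_scan den_seq; set s1 := den _ s.
have A1 : agree _ _ s s1 := agree_den _ _.
have e27 : sc s1 27 = \sum_(m in M :\: A) W m.
  rewrite /s1 set_val; apply: (evalSumIf hb) => i; last by rewrite /= h6.
  by rewrite !evE /= h5 h8 mem_neq0 nat_eq0 inE andbC.
have hs1 := scannable_agree A1 isT hs.
clearbody s1; rewrite den_seq; set s2 := den _ s1.
have A2 : agree _ _ s1 s2 := agree_den _ _.
have e28 : sc s2 28 = 1 by rewrite /s2 set_val.
have hs2 := scannable_agree A2 isT hs1.
have {}e27 : sc s2 27 = \sum_(m in M :\: A) W m by rewrite (A2.1 27).
clearbody s2; have b2 : base s2 by case: hs2.
pose P1 a := (a \in A) && isolated e A a.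
pose P2 a := [&& a \in A, ~~ isolated e A a & p < \sum_(x in reach_in e A a) W x].
pose f := fun (co : nat * nat) a => (if P1 a then co.1 + F a else co.1, if P2 a then 0 else co.2).
pose Q (co : nat * nat) s' := sc s' 27 = co.1 /\ sc s' 28 = co.2.
have : Q (foldl f (sc s2 27, 1) (enum T)) (den (CFor 29 1 c_scan_step) s2).
  apply: (for_fold b2.1) => [//||a [c o] s' A3 ha [Q1 Q2]]; first by split.
  have hs' := scannable_agree A3 isT hs2; rewrite /c_scan_step den_seq.
  have [b' h5' h8' h6' [h7' hp']] := hs'.
  set s3 := den _ s'; have A4 : agree _ _ s' s3 := agree_den _ _.
  have h9 : is_set s3 9 (reach_in e A a) by apply: reach_spec.
  have hs3 := scannable_agree A4 isT hs'.
  clearbody s3; rewrite den_seq; set s4 := den _ s3.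
  have [b3 _ _ h63 _] := hs3.
  have A5 : agree _ _ s3 s4 := agree_den _ _.
  have e31 : sc s4 31 = #|reach_in e A a| by rewrite /s4 set_val (card_set b3 h9).
  have hs4 := scannable_agree A5 isT hs3.
  clearbody s4; rewrite den_seq; set s5 := den _ s4.
  have [b4 _ _ h64 _] := hs4.
  have A6 : agree _ _ s4 s5 := agree_den _ _.
  have e32 : sc s5 32 = \sum_(x in reach_in e A a) W x.
    rewrite /s5 set_val; apply: (evalSumIf b4) => i; last by rewrite /= h64.
    by rewrite /= (A5.2 9) // h9 mem_neq0.
  have hs5 := scannable_agree A6 isT hs4; have [b5 h55 h85 h65 [h75 hp5]] := hs5.
  have e29 : sc s5 29 = a by rewrite (A6.1 29) // (A5.1 29) // (A4.1 29).
  have e31' : sc s5 31 = #|reach_in e A a| by rewrite (A6.1 31).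
  have e27' : sc s5 27 = c by rewrite (A6.1 27) // (A5.1 27) // (A4.1 27).
  have e28' : sc s5 28 = o by rewrite (A6.1 28) // (A5.1 28) // (A4.1 28).
  clearbody s5; rewrite den_seq; set s6 := den _ s5.
  have A7 : agree _ _ s5 s6 := agree_den _ _.
  have hs6 := scannable_agree A7 isT hs5; have [b6 h56 h86 h66 [h76 hp6]] := hs6.
  have e27'' : sc s6 27 = (f (c, o) a).1.
    by rewrite /s6 set_val /= !evE /= e29 e27' e31' h85 h75 mem_neq0.
  clearbody s6; split; first by rewrite (@den_sc (CSet 28 _)).
  rewrite set_val /= !evE /= (A7.1 29) // (A7.1 31) // (A7.1 32) // (A7.1 28) // hp6.
  by rewrite e29 h86 mem_neq0 e31' e32 e28'.
rewrite foldl_scan => -[-> ->] /=; rewrite big_enum_cond e27; split.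
  by rewrite /cost; congr addn; apply: eq_bigl => a; rewrite inE.
rewrite /feasible; case: hasP => [[a _ /and3P[aA ai lt]]|no].
  have -> // : [forall x0 in A, isolated e A x0 || (\sum_(x in reach_in e A x0) W x <= p)] = false.
  apply/negbTE/forallPn; exists a.
  by rewrite aA (negbTE ai) /= -ltnNge.
have -> // : [forall x0 in A, isolated e A x0 || (\sum_(x in reach_in e A x0) W x <= p)].
apply/forallP => a; apply/implyP => aA; have [//|ai /=] := boolP (isolated e A a).
by rewrite leqNgt; apply/negP => lt; apply: no; exists a; rewrite ?mem_enum // /P2 aA ai.
Qed.

Lemma incr_spec s A : scannable s A -> scannable (den c_incr s) (incr_set M A).
Proof.
move=> hs; have [hb h5 h8 h6 [h7 hp]] := hs.
have ag := agree_den c_incr s; split; [|exact: is_set_agree ag _ h5| | |split].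
- exact: base_agree ag _ hb.
- move=> i; rewrite (upd_ord _ _ hb.1) // !evE [eval _ _ _ (EIf _ _ _)]/= (trueEx _ _ _ hb.1).
  have -> : [exists u : T, eval s (upd (upd r0 0 i) 1 u) 2
      (EAnd (EA 5 (EI 1)) (EAnd (ELt (EI 1) (EI 0)) (ENot (EA 8 (EI 1))))) != 0]
    = [exists u in M, (u < i) && (u \notin A)].
    by apply: eq_existsb => u; rewrite !evE /= h5 h8 mem_neq0 nat_eq0.
  rewrite inE evE /= h5 h8 mem_neq0 nat_eq0; case: (i \in M) => //=.
  by case: [exists u in M, (u < i) && (u \notin A)]; rewrite ?addbF ?addbT /= nat_neq0.
- by move=> v; rewrite ag.2.
- by move=> v; rewrite ag.2.
- by rewrite ag.1.
Qed.

Variables (C : seq nat) (top : nat).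

(** [V] holds the values met so far; [top] is the initial value of the search, and [nx] may fail to
    exceed [p] only when it equals [top]. *)
Definition next_ok (V : nat -> Prop) (nx : nat) : Prop :=
  [/\ nx \in C, p < nx \/ nx = top & forall c, V c -> p < c -> nx <= c].

Lemma next_ok_upd V nx c : c \in C -> next_ok V nx ->
  next_ok (fun c' => V c' \/ c' = c) (if (p < c) && (c < nx) then c else nx).
Proof.
move=> cC [nC np nV]; case: ifP => [/andP[pc cn]|h]; split=> //.
- by left.
- by move=> c' [/nV h /h|-> _ //]; apply: leq_trans; apply: ltnW.
- by move=> c' [/nV//|-> pc]; move: h; rewrite pc /= => /negbT; rewrite -leqNgt.
Qed.

Lemma subset_spec s A : scannable s A -> let s' := den c_subset s in
  let c := \sum_(a in A) W a in
  [/\ scannable s' (incr_set M A),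
    sc s' 26 = (if feasible e p W A && (cost e W F M A < sc s 26) then cost e W F M A else sc s 26) &
    sc s' 24 = (if (p < c) && (c < sc s 24) then c else sc s 24)].
Proof.
move=> hs; cbv zeta; rewrite /c_subset den_seq; set s1 := den _ s.
have A1 : agree _ _ s s1 := agree_den _ _.
have [e27 e28] := scan_spec hs; rewrite -/s1 in e27 e28.
have hs1 := scannable_agree A1 isT hs.
clearbody s1; rewrite den_seq; set s2 := den _ s1.
have A2 : agree _ _ s1 s2 := agree_den _ _.
have hs2 := scannable_agree A2 isT hs1; have [b2 _ h82 h62 _] := hs2.
have e26 : sc s2 26 = (if feasible e p W A && (cost e W F M A < sc s 26) then cost e W F M A else sc s 26).
  by rewrite /s2 set_val /= !evE /= e27 e28 nat_neq0 (A1.1 26).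
clearbody s2; rewrite den_seq; set s3 := den _ s2.
have A3 : agree _ _ s2 s3 := agree_den _ _.
have e33 : sc s3 33 = \sum_(a in A) W a.
  rewrite /s3 set_val; apply: (evalSumIf b2) => i; last by rewrite /= h62.
  by rewrite /= h82 mem_neq0.
have hs3 := scannable_agree A3 isT hs2; have [_ _ _ _ [_ hp3]] := hs3.
clearbody s3; rewrite den_seq; set s4 := den _ s3.
have A4 : agree _ _ s3 s4 := agree_den _ _.
have e24 : sc s4 24 = (if (p < \sum_(a in A) W a) && (\sum_(a in A) W a < sc s 24)
    then \sum_(a in A) W a else sc s 24).
  by rewrite /s4 set_val /= !evE /= hp3 e33 (A3.1 24) // (A2.1 24) // (A1.1 24).
have hs4 := scannable_agree A4 isT hs3.
clearbody s4; split; first exact: incr_spec.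
  by rewrite den_sc // (A4.1 26) // (A3.1 26).
by rewrite den_sc.
Qed.

(** The length of the loop is common to all modules and may exceed [2 ^ #|M|]. The counter then
    wraps around and repeats subsets, which changes neither minimum. *)
Lemma subsets_spec s V : scannable s set0 -> 2 ^ #|M| <= sc s 2 ->
  sc s 26 = \sum_(m in M) W m -> (forall A, A \subset M -> \sum_(a in A) W a \in C) ->
  next_ok V (sc s 24) ->
  let s' := den (CFor 25 2 c_subset) s in
  [/\ exists A, scannable s' A, sc s' 26 = best e p W F M &
    next_ok (fun c => V c \/ exists2 A : {set T}, A \subset M & c = \sum_(a in A) W a) (sc s' 24)].
Proof.
move=> hs hT h26 hC hV; cbv zeta; pose At (k : nat) := iter k (incr_set M) set0.
have AM (j : nat) : At j \subset M.
  by case: j => [|j]; [exact: sub0set | apply/subsetP => v; rewrite inE => /andP[]].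
pose ok A := feasible e p W A; pose co := cost e W F M.
pose P (j : nat) s' := [/\ scannable s' (At j),
  [/\ forall i : nat, i < j -> ok (At i) -> sc s' 26 <= co (At i), sc s' 26 <= \sum_(m in M) W m &
    sc s' 26 = \sum_(m in M) W m \/ exists A, [/\ A \subset M, ok A & sc s' 26 = co A]] &
  next_ok (fun c => V c \/ exists2 i : nat, i < j & c = \sum_(a in At i) W a) (sc s' 24)].
have : P (sc s 2) (den (CFor 25 2 c_subset) s).
  apply: for_ind => [//||j s' _ A _ [h1 [h2 h3 h4] h5]].
    split=> //; first by split; [|rewrite h26|left].
    by case: hV => v1 v2 v3; split=> // c [/v3//|[]].
  have [k1 k2 k3] := subset_spec h1; rewrite /P k2 k3; split=> //; last first.
    have [v1 v2 v3] := next_ok_upd (hC _ (AM j)) h5; split=> // c [Vc|[i]].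
      by apply: v3; left; left.
    rewrite ltnS leq_eqVlt => /orP[/eqP->|ij] ->; apply: v3; first by right.
    by left; right; exists i.
  rewrite -/(ok _) -/(co _); case: ifP => [/andP[o1 o2]|no]; split=> //.
  - move=> i; rewrite ltnS leq_eqVlt => /orP[/eqP->//|ij oi].
    exact: leq_trans (ltnW o2) (h2 i ij oi).
  - exact: leq_trans (ltnW o2) h3.
  - by right; exists (At j).
  - move=> i; rewrite ltnS leq_eqVlt => /orP[/eqP->|ij oi]; last exact: h2.
    by move=> oj; move: no; rewrite oj /= => /negbT; rewrite -leqNgt.
case=> k1 [k2 k3 k4] [v1 v2 v3]; split; first by exists (At (sc s 2)).
  apply/eqP; rewrite eqn_leq; apply/andP; split; last first.
    apply/bigminn_leP; case: k4 => [->|[A [AM' oA ->]]]; [by left | right].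
    by exists A; rewrite ?AM'.
  have /bigminn_leP[|[A /andP[AM' oA]]] := leqnn (best e p W F M); first exact: leq_trans.
  have [j jM jA] := incr_set_all AM'; rewrite -jA in oA *.
  by apply: leq_trans; apply: k2 => //; apply: leq_trans hT.
split=> // c [Vc|[A AM' ->]]; first by apply: v3; left.
have [j jM jA] := incr_set_all AM'; rewrite -jA; apply: v3; right; exists j => //.
exact: leq_trans hT.
Qed.

End Scan.

Definition step_state (s : store) R (W F : T -> nat) p : Prop :=
  [/\ base s, is_set s 3 R, (forall v, ar s 6 v = W v), (forall v, ar s 7 v = F v) & sc s 21 = p].

Lemma step_spec s R (W F : T -> nat) p (C : seq nat) top V :
  let M := smallest e R in
  step_state s R W F p -> 2 ^ #|M| <= sc s 2 ->
  (forall A, A \subset M -> \sum_(a in A) W a \in C) -> next_ok p C top V (sc s 24) ->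
  let s' := den c_step s in
  step_state s' (contract R M) (fun v => if v \in M then \sum_(m in M) W m else W v)
    (fun v => if v \in M then best e p W F M else F v) p /\
  next_ok p C top (fun c => V c \/ exists2 A : {set T}, A \subset M & c = \sum_(a in A) W a) (sc s' 24).
Proof.
move=> M [hb h3 h6 h7 hp] hT hC hV; cbv zeta; rewrite /c_step den_seq; set s1 := den _ s.
have A1 : agree _ _ s s1 := agree_den _ _.
have b1 := base_agree A1 isT hb.
have h5 : is_set s1 5 M by apply: smallest_spec.
clearbody s1; rewrite den_seq; set s2 := den _ s1.
have A2 : agree _ _ s1 s2 := agree_den _ _.
have b2 := base_agree A2 isT b1.
have e26 : sc s2 26 = \sum_(m in M) W m.
  rewrite /s2 set_val; apply: (evalSumIf b1) => i; first by rewrite /= h5 mem_neq0.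
  by rewrite /= (A1.2 6) // h6.
clearbody s2; rewrite den_seq; set s3 := den _ s2.
have A3 : agree _ _ s2 s3 := agree_den _ _.
have hs3 : scannable M W F p s3 set0.
  split; [exact: base_agree A3 _ b2| | | |split].
  - by move=> i; rewrite (A3.2 5) // (A2.2 5).
  - by move=> i; rewrite /s3 (upd_ord _ _ b2.1) // inE.
  - by move=> i; rewrite (A3.2 6) // (A2.2 6) // (A1.2 6).
  - by move=> i; rewrite (A3.2 7) // (A2.2 7) // (A1.2 7).
  - by rewrite (A3.1 21) // (A2.1 21) // (A1.1 21).
have h33 : is_set s3 3 R by move=> i; rewrite (A3.2 3) // (A2.2 3) // (A1.2 3).
have e2 : sc s3 2 = sc s 2 by rewrite (A3.1 2) // (A2.1 2) // (A1.1 2).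
have e24 : sc s3 24 = sc s 24 by rewrite (A3.1 24) // (A2.1 24) // (A1.1 24).
rewrite -(A3.1 26) // in e26; rewrite -e2 in hT; rewrite -e24 in hV.
clearbody s3; rewrite den_seq; set s4 := den _ s3.
have A4 : agree _ _ s3 s4 := agree_den _ _.
have [[A [b4 h54 _ h64 [h74 hp4]]] e264 hV4] := subsets_spec hs3 hT e26 hC hV.
rewrite -/s4 in b4 h54 h64 h74 hp4 e264 hV4.
have h34 : is_set s4 3 R by move=> i; rewrite (A4.2 3).
clearbody s4; rewrite den_seq; set s5 := den _ s4.
have A5 : agree _ _ s4 s5 := agree_den _ _.
have b5 := base_agree A5 isT b4.
have h75 v : ar s5 7 v = if v \in M then best e p W F M else F v.
  by rewrite /s5 (upd_ord _ _ b4.1) //= h54 mem_neq0 e264 h74.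
clearbody s5; rewrite den_seq; set s6 := den _ s5.
have A6 : agree _ _ s5 s6 := agree_den _ _.
have b6 := base_agree A6 isT b5.
have h66 v : ar s6 6 v = if v \in M then \sum_(m in M) W m else W v.
  rewrite /s6 (upd_ord _ _ b5.1) // [LHS]/= (A5.2 5) // h54 mem_neq0 (A5.2 6) // h64.
  case: ifP => // _; rewrite b5.1 [RHS]big_mkcond; apply: eq_bigr => i _.
  by rewrite [LHS]/= h54 mem_neq0 h64.
have h56 : is_set s6 5 M by move=> i; rewrite (A6.2 5) // (A5.2 5).
have h36 : is_set s6 3 R by move=> i; rewrite (A6.2 3) // (A5.2 3).
have A46 := agree_den c_contract s6.
split; last first.
  by rewrite (A46.1 24) // (A6.1 24) // (A5.1 24).
split; [exact: base_agree A46 _ b6 | exact: contract_spec | | |].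
- by move=> v; rewrite (A46.2 6).
- by move=> v; rewrite (A46.2 7) // (A6.2 7).
- by rewrite (A46.1 21) // (A6.1 21) // (A5.1 21).
Qed.

Variable w : T -> nat.
Hypothesis (e_sym : symmetric e).

Definition ready (s : store) : Prop :=
  [/\ base s, forall v, ar s 2 v = w v, sc s 13 = wt w setT &
    forall t, t <= n -> 2 ^ #|Mt e t| <= sc s 2].

Lemma eval_spec s : ready s -> let s' := den c_eval s in let p := sc s 21 in
  ar s' 7 0 = Ft e w p n.+1 ord0 /\
  next_ok p (candidates e w) (wt w setT) (fun c => c \in candidates e w) (sc s' 24).
Proof.
move=> [hb h2 h13 hT]; cbv zeta; set p := sc s 21; rewrite /c_eval den_seq; set s1 := den _ s.
have A1 : agree _ _ s s1 := agree_den _ _.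
have b1 := base_agree A1 isT hb.
have h3 : is_set s1 3 (setT : {set T}).
  by move=> i; rewrite /s1 (upd_ord _ _ hb.1) // inE.
clearbody s1; rewrite den_seq; set s2 := den _ s1.
have A2 : agree _ _ s1 s2 := agree_den _ _.
have b2 := base_agree A2 isT b1.
have h6 v : ar s2 6 v = w v by rewrite /s2 (upd_ord _ _ b1.1) //= (A1.2 2) // h2.
clearbody s2; rewrite den_seq; set s3 := den _ s2.
have A3 : agree _ _ s2 s3 := agree_den _ _.
have b3 := base_agree A3 isT b2.
have h7 v : ar s3 7 v = if w v <= p then 0 else w v.
  rewrite /s3 (upd_ord _ _ b2.1) //= evE /= (A2.2 2) // (A1.2 2) // (A2.1 21) // (A1.1 21) // h2.
  by rewrite ltnNge; case: (_ <= _).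
clearbody s3; rewrite den_seq; set s4 := den _ s3.
have A4 : agree _ _ s3 s4 := agree_den _ _.
have e24 : sc s4 24 = wt w setT.
  by rewrite /s4 set_val /= (A3.1 13) // (A2.1 13) // (A1.1 13).
have topC : wt w setT \in candidates e w by rewrite /candidates mem_head.
pose P (t : nat) s' := step_state s' (Rt e t) (Wt e w t) (Ft e w p t) p /\
  next_ok p (candidates e w) (wt w setT)
    (fun c => c = wt w setT \/ exists (t' : nat) (A : {set T}), [/\ t' < t, A \subset Mt e t' & c = \sum_(a in A) Wt e w t' a])
    (sc s' 24).
have b4 := base_agree A4 isT b3.
have e2 : sc s4 2 = sc s 2 by rewrite (A4.1 2) // (A3.1 2) // (A2.1 2) // (A1.1 2).
have init : P 0 s4.
  split; last first.
    rewrite e24; split=> //; first by right.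
    by move=> c [->//|[t' [A []]]].
  split; first by [].
  - by move=> i; rewrite (A4.2 3) // (A3.2 3) // (A2.2 3) // h3.
  - by move=> v; rewrite (A4.2 6) // (A3.2 6) // h6 /Wt /= wt_set1.
  - by move=> v; rewrite (A4.2 7) // h7.
  - by rewrite (A4.1 21) // (A3.1 21) // (A2.1 21) // (A1.1 21).
clearbody s4.
have : P (sc s4 1) (den (CFor 14 1 c_step) s4).
  apply: for_ind => [//|//|t s' tn A5 _ [Ps nx]].
  rewrite b4.1 in tn.
  have hT' : 2 ^ #|smallest e (Rt e t)| <= sc s' 2.
    by rewrite (A5.1 2) // e2; apply: hT.
  have hC A : A \subset smallest e (Rt e t) -> \sum_(a in A) Wt e w t a \in candidates e w.
    by apply: candidate_mem.
  have [[k1 k2 k3 k4 k5] [n1 n2 n3]] := step_spec Ps hT' hC nx; split; first split=> //.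
    move=> v; rewrite k3 /Wt /= /merge_blk; case: ifP => // _.
    by rewrite (wt_union w (quotient_Rt e_sym t)) // smallest_sub.
  split=> // c [->|[t' [A [tt' AM ->]]]]; first by apply: n3; left; left.
  apply: n3; move: tt'; rewrite ltnS leq_eqVlt => /orP[/eqP Et|tt']; last first.
    by left; right; exists t', A.
  by right; rewrite Et in AM *; exists A.
rewrite b4.1 => -[[_ _ _ h7' _] [n1 n2 n3]]; split; first exact: (h7' ord0).
split=> // c; rewrite inE => /orP[/eqP-> |/flatten_mapP[t tn /mapP[A]]]; first by apply: n3; left.
rewrite mem_enum inE => AM ->; apply: n3; right; exists t, A; split=> //.
by move: tn; rewrite mem_iota.
Qed.

Lemma ready_agree X Y s s' : agree X Y s s' ->
  [&& 1 \notin X, 13 \notin X, 2 \notin X & all (fun a => a \notin Y) [:: 0; 1; 2]] ->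
  ready s -> ready s'.
Proof.
move=> ag /and4P[X1 X13 X2 /and4P[Y0 Y1 Y2 _]] [hb h2 h13 hT]; split.
- by apply: base_agree ag _ hb; rewrite X1 Y0.
- by move=> v; rewrite ag.2.
- by rewrite ag.1.
- by move=> t; rewrite ag.1 //; apply: hT.
Qed.

Definition value p := p + Ft e w p n.+1 ord0.

Lemma try_spec s : ready s -> let s' := den c_try s in let p := sc s 21 in
  sc s' 22 = (if value p <= sc s 11 then 1 else sc s 22) /\
  next_ok p (candidates e w) (wt w setT) (fun c => c \in candidates e w) (sc s' 21).
Proof.
move=> hs; cbv zeta; have [h7 hn] := eval_spec hs; rewrite /c_try den_seq.
set s1 := den _ s in h7 hn *.
have A1 : agree _ _ s s1 := agree_den _ _.
clearbody s1; rewrite den_seq; set s2 := den _ s1.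
have A2 : agree _ _ s1 s2 := agree_den _ _.
have e22 : sc s2 22 = if value (sc s 21) <= sc s 11 then 1 else sc s 22.
  rewrite /s2 set_val /= trueLt /= (A1.1 11) // (A1.1 21) // (A1.1 22) // h7.
  by rewrite ltnNge -/(value _); case: (_ <= _).
clearbody s2; split; first by rewrite den_sc.
by rewrite set_val /= (A2.1 24).
Qed.

Hypothesis e_irr : irreflexive e.

Lemma main_spec s : ready s -> (size (candidates e w)).+1 <= sc s 3 ->
  sc (den c_main s) 0 = (wvi e w <= sc s 11).
Proof.
move=> hs hcnt; rewrite /c_main den_seq; set s1 := den _ s.
have A1 : agree _ _ s s1 := agree_den _ _.
have e21 : sc s1 21 = 0 by rewrite /s1 set_val.
have hs1 := ready_agree A1 isT hs.
clearbody s1; rewrite den_seq; set s2 := den _ s1.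
have A2 : agree _ _ s1 s2 := agree_den _ _.
have e22 : sc s2 22 = 0 by rewrite /s2 set_val.
have hs2 := ready_agree A2 isT hs1.
have {}e21 : sc s2 21 = 0 by rewrite (A2.1 21).
have e11 : sc s2 11 = sc s 11 by rewrite (A2.1 11) // (A1.1 11).
have e3 : sc s2 3 = sc s 3 by rewrite (A2.1 3) // (A1.1 3).
clearbody s2; set k := sc s 11 in e11 *; set cs := candidates e w in hcnt.
(* Call [c] good when [value c <= k]. A verdict 1 is justified; under verdict 0 no good value below
   the current [p] has been passed; and either every good value already forces verdict 1, or each of
   the [j] rounds has used up a candidate. *)
pose P j s' := [/\ sc s' 22 = 1 /\ wvi e w <= k \/ sc s' 22 = 0,
  forall c, c = 0 \/ c \in cs -> value c <= k -> sc s' 22 = 0 -> sc s' 21 <= c &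
  (forall c, c = 0 \/ c \in cs -> value c <= k -> sc s' 22 = 1) \/
  count (fun c => sc s' 21 < c) cs + j <= size cs].
have : P (sc s2 3) (den (CFor 23 3 c_try) s2).
  apply: for_ind => [//||j s' _ A3 _ [h1 h2 h3]].
    by split; [right | move=> *; rewrite e21 | right; rewrite addn0 count_size].
  have hs' := ready_agree A3 isT hs2.
  have [t1 [n1 n2 n3]] := try_spec hs'; rewrite (A3.1 11) // e11 in t1.
  move: (den c_try s') t1 n1 n2 n3 => s4 t1 n1 n2 n3.
  set p := sc s' 21 in h2 h3 t1 n2 n3; split.
  - by rewrite t1; case: ifP => // h; left; split=> //; apply: (wvi_sound e_sym e_irr h).
  - move=> c cC ck; rewrite t1; case: ifP => // np e0.
    have pc : p < c.
      rewrite ltn_neqAle h2 // andbT; apply: contraFneq np => ->.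
      exact: ck.
    case: cC => [E|cC]; first by rewrite E ltn0 in pc.
    exact: n3.
  have [a1|more] := h3.
    left=> c cC ck; rewrite t1; case: ifP => // _; exact: a1 cC ck.
  (* If no candidate exceeds [p], a good value that has not been passed can only be [p] itself,
     which this round tests. *)
  have [/hasP[c cC /= pc]|/hasPn none] := boolP (has (fun c => p < c) cs); last first.
    left=> c cC ck; rewrite t1; case: ifP => // np.
    case: h1 => [[]//|e0]; have := h2 c cC ck e0; rewrite leq_eqVlt => /orP[/eqP E|].
      by move: np; rewrite E ck.
    by case: cC => [->//|/none /negbTE /= ->].
  right; set nx := sc s4 21 in n1 n2 n3 *.
  (* Even the default [top] exceeds [p] here: some candidate does, and none is above the total
     weight. *)
  have pn : p < nx.
    case: n2 => [//|->]; apply: leq_trans pc _; exact: candidates_le.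
  apply: leq_trans more; rewrite addnS -addSn leq_add2r.
  have -> : count (fun c => p < c) cs = count (fun c => nx < c) cs + count (fun c => (p < c) && (c <= nx)) cs.
    rewrite -count_predUI [count (predI _ _) _](_ : _ = 0) ?addn0; last first.
      by apply/eqP; rewrite -leqn0 leqNgt -has_count; apply/hasPn => x _ /=; case: (leqP x nx); rewrite ?andbF.
    apply: eq_count => x /=; case: (leqP x nx); rewrite ?andbT ?andbF ?orbF //=.
    by move/(ltn_trans pn) => ->.
  rewrite -addn1 leq_add2l -has_count; apply/hasP; exists nx => //=.
  by rewrite pn leqnn.
rewrite e3 den_seq; move: (den (CFor 23 3 c_try) s2) => s3 [h1 h2 h3].
rewrite set_val /=.
(* More rounds than candidates have been made, which excludes the second alternative. *)
have all1 : forall c, c = 0 \/ c \in cs -> value c <= k -> sc s3 22 = 1.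
  case: h3 => // /(leq_trans (leq_addl _ _)) /(leq_trans hcnt); by rewrite ltnn.
have [yes|no] := boolP (wvi e w <= k).
  by have [c cC ck] := wvi_complete e_sym e_irr yes; rewrite (all1 c cC ck).
by case: h1 => [[_ h]|->//]; rewrite h in no.
Qed.

End Blocks.

(** * Decoding of the input *)

(** Fuel [f >= m] is enough because halving decreases a positive number. *)
Lemma bin_auxP f m : m <= f ->
  \sum_(d < size (bin_aux f m)) nth 0 (bin_aux f m) d * 2 ^ d = m /\
  all (fun b => b < 2) (bin_aux f m).
Proof.
elim: f m => [|f IH] m /=; first by rewrite leqn0 => /eqP->; rewrite big_ord0.
case: eqP => [->|/eqP m0 mf]; first by rewrite big_ord0.
have [|h1 h2] := IH (m %/ 2).
  by rewrite -ltnS; apply: leq_trans mf; rewrite ltn_Pdiv // lt0n.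
split; last by rewrite /= ltn_mod.
rewrite big_ord_recl [nth 0 _ _]/= expn0 muln1 addnC.
rewrite [RHS](divn_eq m 2); congr addn; rewrite -[in RHS]h1 big_distrl /=.
by apply: eq_bigr => i _; rewrite /bump /= add0n add1n expnSr mulnA.
Qed.

Lemma enc_natP m : let bs := binary m in
  [/\ size (enc_nat m) = 2 * size bs + 1,
    (forall d, d < size bs -> nth 0 (enc_nat m) (2 * d) = 1),
    (forall d, d < size bs -> nth 0 (enc_nat m) (2 * d + 1) = nth 0 bs d) &
    nth 0 (enc_nat m) (2 * size bs) = 0].
Proof.
have E d : 2 * d.+1 = (2 * d).+2 by lia.
rewrite /enc_nat; elim: (binary m) => [//|b bs [h1 h2 h3 h4]].
rewrite -[flatten _ ++ _]/[:: 1, b & flatten [seq [:: 1; b] | b <- bs] ++ [:: 0]].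
rewrite -[size (b :: bs)]/(size bs).+1 E; split.
- by rewrite -[size [:: 1, b & _]]/(size _).+2 h1.
- by case=> [//|d hd]; rewrite E; apply: h2.
- by case=> [//|d hd]; rewrite E; apply: h3.
- exact: h4.
Qed.

Definition located (s : store) (q : nat) (l : seq nat) : Prop :=
  forall d, d < size l -> ar s 0 (q + d) = nth 0 l d.

Lemma parse_spec s q m : sc s 4 = q -> located s q (enc_nat m) -> size (enc_nat m) <= sc s 0 ->
  let s' := den c_parse s in sc s' 6 = m /\ sc s' 4 = q + size (enc_nat m).
Proof.
move=> h4 loc hL; cbv zeta; have [e1 e2 e3 e4] := enc_natP m.
have [hsum hbit] := bin_auxP (leqnn m).
rewrite -/(binary m) in hsum hbit; move: (binary m) e1 e2 e3 e4 hsum hbit => bs e1 e2 e3 e4 hsum hbit.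
rewrite /c_parse den_seq; set s1 := den _ s.
have A1 : agree _ _ s s1 := agree_den _ _.
have f5 : sc s1 5 = 1 by rewrite /s1 set_val.
clearbody s1; rewrite den_seq; set s2 := den _ s1.
have A2 : agree _ _ s1 s2 := agree_den _ _.
have f6 : sc s2 6 = 0 by rewrite /s2 set_val.
clearbody s2; rewrite den_seq; set s3 := den _ s2.
have A3 : agree _ _ s2 s3 := agree_den _ _.
have f7 : sc s3 7 = 1 by rewrite /s3 set_val.
rewrite -(A3.1 6) // in f6; rewrite -(A2.1 5) // -(A3.1 5) // in f5.
have f4 : sc s3 4 = q by rewrite (A3.1 4) // (A2.1 4) // (A1.1 4).
have f0 : sc s3 0 = sc s 0 by rewrite (A3.1 0) // (A2.1 0) // (A1.1 0).
have fa : ar s3 0 = ar s 0 by rewrite (A3.2 0) // (A2.2 0) // (A1.2 0).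
clearbody s3.
(* At [j = size bs] all bits are read but the flag is still set: the terminator takes one more
   round, which exists because [size (enc_nat m)] rounds are available. *)
pose P j s' := if j <= size bs then
    [/\ sc s' 5 = 1, sc s' 6 = \sum_(d < j) nth 0 bs d * 2 ^ d, sc s' 7 = 2 ^ j & sc s' 4 = q + 2 * j]
  else [/\ sc s' 5 = 0, sc s' 6 = m & sc s' 4 = q + size (enc_nat m)].
have : P (sc s3 0) (den (CFor 9 0 c_parse_step) s3); last first.
  by rewrite /P f0 leqNgt ifF => [[]|]; [|rewrite -ltnS -leqNgt; lia].
apply: for_ind => [//||j s' _ A _].
  by rewrite /P /= big_ord0 muln0 addn0.
rewrite /P; have fa' : ar s' 0 = ar s 0 by rewrite (A.2 0).
rewrite /c_parse_step !den_seq.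
set c := (sc s' 5 != 0) && (ar s' 0 (sc s' 4) != 0).
have step4 : let s4 := den (CSet 5 (EV 10)) (den (CSet 4 (EAdd (EV 4) (EIf (EV 5) (EIf (EV 10) (EC 2) (EC 1)) (EC 0))))
    (den (CSet 7 (EIf (EV 10) (EAdd (EV 7) (EV 7)) (EV 7)))
    (den (CSet 6 (EIf (EV 10) (EAdd (EV 6) (EIf (EA 0 (EAdd (EV 4) (EC 1))) (EV 7) (EC 0))) (EV 6)))
    (den (CSet 10 (EAnd (EV 5) (EA 0 (EV 4)))) s')))) in
    [/\ sc s4 5 = c, sc s4 6 = if c then sc s' 6 + (if ar s' 0 (sc s' 4 + 1) != 0 then sc s' 7 else 0) else sc s' 6,
      sc s4 7 = if c then sc s' 7 + sc s' 7 else sc s' 7 &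
      sc s4 4 = sc s' 4 + (if sc s' 5 != 0 then if c then 2 else 1 else 0)].
  by rewrite /= !updE /= evalAnd /= -/c nat_neq0.
move: (den (CSet 5 _) _) step4 => s4 [g5 g6 g7 g4].
case: ifP => [jb [i5 i6 i7 i4]|jb [i5 i6 i4]]; last first.
  rewrite ifF; last by move: jb; lia.
  have c0 : c = false by rewrite /c i5.
  by rewrite c0 i5 /= in g5 g6 g4; rewrite g5 g6 g4 addn0.
have [jlt|jge] := ltnP j (size bs).
  have c1 : c by rewrite /c i5 i4 fa' loc ?e2 //; lia.
  rewrite c1 i5 /= in g5 g6 g7 g4; rewrite g5 g6 g7 g4; split=> //.
  - rewrite big_ord_recr /= i6 i4 fa' -addnA loc; last by lia.
    rewrite e3 // i7; congr addn.
    have : nth 0 bs j < 2 by apply: (allP hbit); apply: mem_nth.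
    by case: (nth 0 bs j) => [|[|b]] // _; rewrite ?mul0n ?mul1n.
  - by rewrite i7 expnS mul2n addnn.
  - by rewrite i4; lia.
have Ej : j = size bs by apply/eqP; rewrite eqn_leq jb jge.
have c0 : c = false by rewrite /c i5 i4 fa' Ej loc ?e4 //; lia.
rewrite c0 i5 /= in g5 g6 g7 g4; rewrite g5 g6 g4; split=> //.
- by rewrite i6 Ej.
- by rewrite i4 e1 Ej; lia.
Qed.

Lemma nth_allpairs_row (A B : eqType) (f : A -> B -> nat) (s : seq A) (t : seq B) i j x0 y0 :
  i < size s -> j < size t ->
  nth 0 [seq f x y | x <- s, y <- t] (i * size t + j) = f (nth x0 s i) (nth y0 t j).
Proof.
elim: s i => //= x s IH [|i] hi hj; rewrite nth_cat size_map.
  by rewrite mul0n add0n hj (nth_map y0).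
rewrite mulSn -addnA ltnNge leq_addr /= addKn; exact: IH.
Qed.

Section Input.
Variables (n : nat) (e : rel 'I_n.+1) (w : 'I_n.+1 -> nat) (k : nat).
Notation T := 'I_n.+1.
Notation inp := (encode e w k).

Definition input_at (s : store) : Prop :=
  sc s 0 = size inp /\ forall j, 0 < j <= size inp -> ar s 0 j = nth 0 inp j.-1.

Lemma input_agree X Y s s' : agree X Y s s' -> (0 \notin X) && (0 \notin Y) ->
  input_at s -> input_at s'.
Proof.
move=> ag /andP[X0 Y0] [h1 h2]; split=> [|j]; first by rewrite ag.1.
by rewrite ag.2 //; apply: h2.
Qed.

Lemma locate s u l v : input_at s -> inp = u ++ l ++ v -> located s (size u).+1 l.
Proof.
move=> [_ h] E d hd; rewrite h; last by rewrite E !size_cat; lia.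
by rewrite E addSn nth_cat ltnNge leq_addr /= addKn nth_cat hd.
Qed.

Lemma size_spec s : input_at s -> sc (den c_size s) 1 = n.+1.
Proof.
move=> [h0 h]; rewrite set_val (evalSum _ _ _ h0).
have sN : n.+1 < size inp by rewrite /encode size_cat size_nseq /=; lia.
have inpN i : i <= n -> nth 0 inp i = 1 by move=> hi; rewrite /encode nth_cat size_nseq ltnS hi nth_nseq ltnS hi.
have inp0 : nth 0 inp n.+1 = 0 by rewrite /encode nth_cat size_nseq ltnn subnn.
transitivity (\sum_(i < size inp) nat_of_bool (i < n.+1)); last first.
  rewrite -[RHS](card_ord n.+1) -sum1_card (big_ord_widen _ (fun=> 1) (ltnW sN)) [RHS]big_mkcond.
  by apply: eq_bigr => i _; case: (_ < _).
apply: eq_bigr => i _; rewrite evalNot (evalEx _ _ _ h0) nat_eq0; congr nat_of_bool.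
apply/existsPn/idP => [no|hi j].
  have := no (Ordinal sN); rewrite !evE /= addn1 h // inp0 andbT nat_eq0 negbK; exact: id.
rewrite !evE /= addn1 h ?ltn_ord // nat_eq0 negb_and negbK.
rewrite -[upd _ _ _ 0]/(nat_of_ord i) -[upd _ _ _ 1]/(nat_of_ord j).
by have [ji|//] := leqP j i; rewrite inpN // -ltnS; apply: leq_ltn_trans ji hi.
Qed.

End Input.

Section Reading.
Variables (n : nat) (e : rel 'I_n.+1) (w : 'I_n.+1 -> nat) (k : nat).
Notation T := 'I_n.+1.
Notation inp := (encode e w k).
Notation input_at := (input_at e w k).

Definition head : seq nat :=
  (nseq n.+1 1 ++ [:: 0]) ++ [seq nat_of_bool (e i j) | i <- enum 'I_n.+1, j <- enum 'I_n.+1].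
Definition weights (l : seq T) : seq nat := flatten [seq enc_nat (w i) | i <- l].

Lemma encodeE : inp = head ++ weights (enum T) ++ enc_nat k.
Proof. by rewrite /encode /head -!catA. Qed.

Lemma size_head : size head = n.+2 + n.+1 * n.+1.
Proof. by rewrite /head !size_cat size_nseq size_allpairs -!cardE !card_ord addn1. Qed.

Lemma weights_cat l1 l2 : weights (l1 ++ l2) = weights l1 ++ weights l2.
Proof. by rewrite /weights map_cat flatten_cat. Qed.

Lemma sum_below N c u : u <= N -> \sum_(j < N) (if j < u then c else 0) = u * c.
Proof.
move=> uN; rewrite -big_mkcond -(big_ord_widen _ (fun=> c) uN) sum_nat_const card_ord.
by [].
Qed.

Lemma parse_at s u v m : input_at s -> inp = u ++ enc_nat m ++ v -> sc s 4 = (size u).+1 ->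
  let s' := den c_parse s in sc s' 6 = m /\ sc s' 4 = (size (u ++ enc_nat m)).+1.
Proof.
move=> hi E h4; rewrite size_cat -addSn; apply: parse_spec => //; first exact: locate E.
by rewrite hi.1 E !size_cat; lia.
Qed.

Lemma rows_spec s : input_at s -> sc s 1 = n.+1 ->
  base e (den (CUpd 1 1 (EAdd (EAdd (EV 1) (EC 2)) (ESum 1 (EIf (ELt (EI 1) (EI 0)) (EV 1) (EC 0))))) s).
Proof.
move=> hi h1; set c := CUpd _ _ _; have A := agree_den c s; split; first by rewrite A.1.
move=> u v; rewrite (A.2 0) // (upd_ord _ _ h1) // [eval _ _ _ _]/= h1.
have -> : \sum_(j < n.+1) (if eval s (upd (upd r0 0 u) 1 j) 2 (ELt (EI 1) (EI 0)) != 0 then n.+1 else 0)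
    = u * n.+1.
  apply: etrans (@sum_below n.+1 n.+1 u (ltnW (ltn_ord u))); apply: eq_bigr => j _.
  by rewrite trueLt.
have E : inp = (nseq n.+1 1 ++ [:: 0]) ++ [seq nat_of_bool (e i j) | i <- enum T, j <- enum T] ++
    (weights (enum T) ++ enc_nat k) by rewrite encodeE /head -!catA.
have sN : size (enum T) = n.+1 by rewrite -cardE card_ord.
have := locate hi E (d := u * n.+1 + v); rewrite size_cat size_nseq size_allpairs sN.
have -> : n.+1 + 2 + u * n.+1 + v = (n.+1 + 1).+1 + (u * n.+1 + v) by lia.
move=> -> //; last by have := ltn_ord u; have := ltn_ord v; nia.
have := @nth_allpairs_row _ _ (fun i j => nat_of_bool (e i j)) (enum T) (enum T) u v u v.
by rewrite sN !nth_ord_enum => ->.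
Qed.

Lemma weights_spec s : input_at s -> sc s 1 = n.+1 -> sc s 4 = (size head).+1 ->
  let s' := den (CFor 8 1 c_weight) s in
  (forall v : T, ar s' 2 v = w v) /\ sc s' 4 = (size (head ++ weights (enum T))).+1.
Proof.
move=> hi h1 h4; cbv zeta.
pose P (j : nat) s' := (forall v : T, v < j -> ar s' 2 v = w v) /\
  sc s' 4 = (size (head ++ weights (take j (enum T)))).+1.
have : P (sc s 1) (den (CFor 8 1 c_weight) s); last first.
  rewrite h1 /P take_oversize ?size_enum_ord // => -[hw ->]; split=> // v.
  exact/hw/ltn_ord.
apply: for_ind => [//||j s' jN A hj [hw hp]].
  by split=> [//|]; rewrite take0 cats0.
rewrite h1 in jN; set v : T := Ordinal jN.
have takeS : take j.+1 (enum T) = rcons (take j (enum T)) v.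
  rewrite (take_nth v) ?size_enum_ord //; congr rcons.
  by apply: val_inj; rewrite /= nth_enum_ord.
have W1 : weights (take j.+1 (enum T)) = weights (take j (enum T)) ++ enc_nat (w v).
  by rewrite takeS -cats1 weights_cat /weights /= cats0.
have E : inp = (head ++ weights (take j (enum T))) ++ enc_nat (w v) ++
    (weights (drop j.+1 (enum T)) ++ enc_nat k).
  rewrite encodeE -{1}(cat_take_drop j.+1 (enum T)) weights_cat W1 -!catA.
  by [].
have hi' := input_agree A isT hi.
have [p6 p4] := parse_at hi' E hp; rewrite /c_weight den_seq; set s1 := den _ s' in p6 p4 *.
have A1 : agree _ _ s' s1 := agree_den _ _.
have b1 : sc s1 1 = n.+1 by rewrite (A1.1 1) // (A.1 1).
have e8 : sc s1 8 = j by rewrite (A1.1 8).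
clearbody s1; set c := CUpd _ _ _; have A2 := agree_den c s1.
split; last by rewrite (A2.1 4) // p4 W1 catA.
move=> u uj; rewrite (upd_ord _ _ b1) // [LHS]/= trueEq /= e8.
rewrite -[upd r0 0 u 0]/(nat_of_ord u); case: eqP => [Eu|nu].
  by rewrite p6; congr w; apply: val_inj.
by rewrite (A1.2 2) // hw // ltn_neqAle -ltnS uj andbT; apply/eqP.
Qed.

Lemma read_spec s : input_at s -> sc s 1 = n.+1 -> let s' := den c_read s in
  [/\ base e s', forall v : T, ar s' 2 v = w v, sc s' 13 = wt w setT & sc s' 11 = k].
Proof.
move=> hi h1; cbv zeta; rewrite /c_read den_seq; set s1 := den _ s.
have A1 : agree _ _ s s1 := agree_den _ _.
have b1 : base e s1 by apply: rows_spec.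
have i1 := input_agree A1 isT hi.
clearbody s1; rewrite den_seq; set s2 := den _ s1.
have A2 : agree _ _ s1 s2 := agree_den _ _.
have b2 := base_agree A2 isT b1; have i2 := input_agree A2 isT i1.
have h4 : sc s2 4 = (size head).+1.
  by rewrite /s2 set_val [LHS]/= b1.1 sum_nat_const card_ord size_head; lia.
clearbody s2; rewrite den_seq; set s3 := den _ s2.
have A3 : agree _ _ s2 s3 := agree_den _ _.
have b3 := base_agree A3 isT b2; have i3 := input_agree A3 isT i2.
have [hw hp] := weights_spec i2 b2.1 h4; rewrite -/s3 in hw hp.
clearbody s3; rewrite den_seq; set s4 := den _ s3.
have A4 : agree _ _ s3 s4 := agree_den _ _.
have b4 := base_agree A4 isT b3.
have E : inp = (head ++ weights (enum T)) ++ enc_nat k ++ [::] by rewrite encodeE cats0 -catA.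
have [p6 _] := parse_at i3 E hp; rewrite -/s4 in p6.
clearbody s4; rewrite den_seq; set s5 := den _ s4.
have A5 : agree _ _ s4 s5 := agree_den _ _.
have b5 := base_agree A5 isT b4.
have h11 : sc s5 11 = k by rewrite /s5 set_val.
clearbody s5; have A6 := agree_den (CSet 13 (ESum 1 (EA 2 (EI 0)))) s5; split.
- exact: base_agree A6 isT b5.
- by move=> v; rewrite (A6.2 2) // (A5.2 2) // (A4.2 2).
- rewrite set_val (evalSum _ _ _ b5.1); apply: eq_big => [v|v _]; first by rewrite inE.
  by rewrite /= (A5.2 2) // (A4.2 2) // hw.
by rewrite (A6.1 11).
Qed.

Lemma bounds_spec s Q : base e s -> (forall v : T, ar s 2 v = w v) -> sc s 13 = wt w setT ->
  (forall t, #|Mt e t| <= Q) -> Q <= n.+1 ->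
  let s' := den c_bounds s in
  [/\ ready e w s', exists2 q, q <= Q & sc s' 2 = 2 ^ q & (size (candidates e w)).+1 <= sc s' 3
    /\ sc s' 3 = 2 + n.+1 * sc s' 2].
Proof.
move=> hb h2 h13 hQ Qn; cbv zeta; rewrite /c_bounds den_seq; set s1 := den _ s.
have A1 : agree _ _ s s1 := agree_den _ _.
have b1 := base_agree A1 isT hb.
have r1 : is_set s1 3 (setT : {set T}) by move=> i; rewrite /s1 (upd_ord _ _ hb.1) // inE.
clearbody s1; rewrite den_seq; set s2 := den _ s1.
have A2 : agree _ _ s1 s2 := agree_den _ _.
have b2 := base_agree A2 isT b1.
have e12 : sc s2 12 = 0 by rewrite /s2 set_val.
have r2 : is_set s2 3 (setT : {set T}) by move=> i; rewrite (A2.2 3).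
clearbody s2; rewrite den_seq; set s3 := den _ s2.
have A3 : agree _ _ s2 s3 := agree_den _ _.
have b3 := base_agree A3 isT b2.
pose P (t : nat) s' := [/\ is_set s' 3 (Rt e t), (forall t' : nat, t' < t -> #|Mt e t'| <= sc s' 12) &
  sc s' 12 <= Q].
have : P (sc s2 1) s3.
  apply: for_ind => [//||t s' _ A _ [p1 p2 p3]]; first by split=> //; rewrite e12.
  have b' := base_agree A isT b2; rewrite /c_width_step den_seq; set s4 := den _ s'.
  have A4 : agree _ _ s' s4 := agree_den _ _.
  have h5 : is_set s4 5 (Mt e t) by apply: smallest_spec.
  have b4 := base_agree A4 isT b'.
  have h3 : is_set s4 3 (Rt e t) by apply: is_set_agree A4 _ p1.
  have e12' : sc s4 12 = sc s' 12 by rewrite (A4.1 12).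
  clearbody s4; rewrite den_seq; set s5 := den _ s4.
  have A5 : agree _ _ s4 s5 := agree_den _ _.
  have e18 : sc s5 18 = #|Mt e t| by rewrite /s5 set_val (card_set b4 h5).
  have b5 := base_agree A5 isT b4.
  have e12'' : sc s5 12 = sc s' 12 by rewrite (A5.1 12).
  clearbody s5; rewrite den_seq; set s6 := den _ s5.
  have A6 : agree _ _ s5 s6 := agree_den _ _.
  have b6 := base_agree A6 isT b5.
  have m12 : sc s6 12 = maxn (sc s' 12) #|Mt e t|.
    by rewrite /s6 set_val [LHS]/= trueLt /= e18 e12'' /maxn.
  have h36 : is_set s6 3 (Rt e t) by move=> i; rewrite (A6.2 3) // (A5.2 3).
  have h56 : is_set s6 5 (Mt e t) by move=> i; rewrite (A6.2 5) // (A5.2 5).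
  clearbody s6; have A7 := agree_den c_contract s6; split.
  - exact: (contract_spec b6 h36 h56).
  - move=> t'; rewrite (A7.1 12) // m12 ltnS leq_eqVlt => /orP[/eqP->|/p2]; first exact: leq_maxr.
    by move/leq_trans; apply; apply: leq_maxl.
  - by rewrite (A7.1 12) // m12 geq_max p3 hQ.
rewrite b2.1 => -[_ p2 p3]; set q := sc s3 12 in p2 p3.
have s32 : forall v : T, ar s3 2 v = w v.
  by move=> v; rewrite (A3.2 2) // (A2.2 2) // (A1.2 2).
have s313 : sc s3 13 = wt w setT by rewrite (A3.1 13) // (A2.1 13) // (A1.1 13).
have Eq : sc s3 12 = q by [].
clearbody q; clearbody s3; rewrite den_seq; set s4 := den _ s3.
have A4 : agree _ _ s3 s4 := agree_den _ _.
have e2 : sc s4 2 = 1 by rewrite /s4 set_val.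
have b4 := base_agree A4 isT b3.
have E4 : sc s4 12 = q by rewrite (A4.1 12).
have s42 : forall v : T, ar s4 2 v = w v by move=> v; rewrite (A4.2 2).
have s413 : sc s4 13 = wt w setT by rewrite (A4.1 13).
clearbody s4; rewrite den_seq; set c5 := CFor _ _ _; set s5 := den _ s4.
have A5 : agree _ _ s4 s5 := agree_den _ _.
have e25 : sc s5 2 = 2 ^ q.
  pose P2 (j : nat) s' := sc s' 2 = 2 ^ minn j q.
  have : P2 (sc s4 1) s5; last by rewrite b4.1 /P2 (minn_idPr _) //; apply: leq_trans p3 Qn.
  apply: for_ind => [//||j s' _ A hj h]; first by rewrite /P2 min0n e2.
  rewrite /P2 set_val [LHS]/= trueLt /= hj (A.1 12) // E4 h.
  by case: ltnP => jq; [rewrite (minn_idPl jq) expnS mul2n addnn | rewrite (minn_idPr (leqW jq))].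
have b5 := base_agree A5 isT b4.
have s52 : forall v : T, ar s5 2 v = w v by move=> v; rewrite (A5.2 2).
have s513 : sc s5 13 = wt w setT by rewrite (A5.1 13).
clearbody s5; set c6 := CSet _ _; have A6 := agree_den c6 s5.
have e3 : sc (den c6 s5) 3 = 2 + n.+1 * 2 ^ q.
  by rewrite set_val [LHS]/= b5.1 sum_nat_const card_ord e25.
have hq t : t <= n -> #|Mt e t| <= q by move=> tn; apply: p2; rewrite ltnS.
split.
- split; [exact: base_agree A6 isT b5|by move=> v; rewrite (A6.2 2)|by rewrite (A6.1 13)|].
  by move=> t tn; rewrite (A6.1 2) // e25 leq_exp2l // hq.
- by exists q; rewrite // (A6.1 2).
rewrite (A6.1 2) // e25 e3; split=> //.
by rewrite add2n !ltnS; apply: size_candidates.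
Qed.

End Reading.

(** * The time bound and the conclusion *)

Lemma run_mono P t t' s s' : t <= t' -> run P t s = Some s' -> run P t' s = Some s'.
Proof.
elim: t t' s => [|t IH] t' s /=.
  by case E: (step P s) => [//|] _ [<-]; case: t' => [|t'] /=; rewrite E.
case: t' => // t' lt /=; case: (step P s) => // s1; exact: IH.
Qed.

(** Use [K <= 2 ^ K] and [(L + B).+1 <= L.+2 * 2 ^ mw.+1], then separate the powers of 2 from those
    of the input size. *)
Lemma time_bound K D L B mw : B <= L.+2 * 2 ^ mw ->
  K * (L + B).+1 ^ D <= 2 ^ ((K + D) * mw + (K + D)) * L.+2 ^ (K + D).
Proof.
move=> hB; have h1 : (L + B).+1 <= L.+2 * 2 ^ mw.+1.
  by rewrite expnS; have := expn_gt0 2 mw; nia.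
apply: (@leq_trans (2 ^ K * (L.+2 * 2 ^ mw.+1) ^ D)).
  by apply: leq_mul; [exact/ltnW/ltn_expl | case: D => // D; rewrite leq_exp2r].
rewrite expnMn -expnM mulnCA mulnC -expnD; apply: leq_mul.
  by rewrite leq_exp2l //; nia.
by rewrite leq_exp2l // leq_addl.
Qed.

Lemma den_setup s : den c_setup s = den c_bounds (den c_read s).
Proof. by rewrite /c_setup den_seq. Qed.

Theorem theorem13 :
  exists (P : program) (c : nat),
  forall (N : nat) (e : rel 'I_N) (w : 'I_N -> nat) (k : nat) (mw : nat),
    symmetric e -> irreflexive e -> (forall v, 0 < w v) ->
    is_modular_width e mw ->
    decides_within P (encode e w k)
      (2 ^ (c * mw + c) * (size (encode e w k)).+2 ^ c)
      (wvi e w <= k).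
Proof.
have [K [D H]] := assembleP wf_size wf_setup wf_main.
(* [K + D] is enough for nonempty graphs; the successors make the constant positive, which grants
   the two steps spent on the empty graph. *)
exists (assemble c_size c_setup c_main), (K.+1 + D.+1) => N e w k mw e_sym e_irr _ [mw_e _].
rewrite /decides_within /init; set inp := encode e w k.
pose m i := if i is j.+1 then nth 0 inp j else size inp.
case: N => [|n] in e w e_sym e_irr mw_e inp m *.
  have -> : wvi e w <= k.
    apply/wvi_le; exists setT; rewrite /integrity_cost /wt !big1 // => -[] //.
  have [s hs h0] := @assemble_empty c_size c_setup c_main m erefl.
  exists s; split; last exact: h0.
  apply: run_mono hs; apply: (@leq_trans (2 ^ 1 * 1)) => //; apply: leq_mul; last by rewrite expn_gt0.
  by rewrite leq_exp2l //; lia.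
have [s [sL sar hrun]] := H m (size inp) erefl erefl.
have hi : input_at e w k s by split=> // j hj; rewrite sar //; case: j hj.
cbv zeta in hrun; rewrite den_setup in hrun.
set L := size inp in sL sar hrun *.
have A1 := agree_den c_size s; have N1 : sc (den c_size s) 1 = n.+1 by apply: size_spec hi.
move: (den c_size s) A1 N1 hrun => s1 A1 N1 hrun.
have hi1 := input_agree A1 isT hi.
have [b r2 r13 r11] := read_spec hi1 N1.
move: (den c_read s1) b r2 r13 r11 hrun => sr b r2 r13 r11 hrun.
(* The cap [n.+1] is the number of doubling rounds available in [c_bounds]. *)
have Mmw t : #|Mt e t| <= minn mw n.+1.
  rewrite leq_min smallest_mw //=; apply: leq_trans (max_card _) _; by rewrite card_ord.
have [rdy [q qQ e2] [c3 e3]] := bounds_spec b r2 r13 Mmw (geq_minr _ _).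
have A3 := agree_den c_bounds sr.
move: (den c_bounds sr) A3 rdy e2 c3 e3 hrun => s2 A3 rdy e2 c3 e3 hrun.
have L1 : sc s1 0 = L by rewrite (A1.1 0).
have NL : n.+1 <= L by rewrite /L /inp /encode size_cat size_nseq leq_addr.
have pw : 2 ^ q <= 2 ^ mw by rewrite leq_exp2l // (leq_trans qQ) // geq_minl.
have p0 : 0 < 2 ^ mw by rewrite expn_gt0.
have s23 : sc s2 3 = 2 + n.+1 * 2 ^ q by rewrite -e2.
have s21 : sc s2 1 = n.+1 by case: rdy => -[].
(* [L.+2 * 2 ^ mw] dominates all loop lengths: [L], [n.+1], [2 ^ q] and [2 + n.+1 * 2 ^ q]. *)
have [x|x|x|s' hs h0] := hrun (L.+2 * 2 ^ mw).
- by rewrite inE => /eqP->; rewrite sL; nia.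
- by rewrite !inE => /orP[]/eqP->; rewrite ?L1 ?N1; nia.
- by rewrite !inE => /or3P[]/eqP->; rewrite ?s21 ?e2 ?s23; nia.
exists s'; split.
  apply: run_mono hs; apply: leq_trans (time_bound _ _ (leqnn _)) _.
  by apply: leq_mul; rewrite ?leq_exp2l //; nia.
rewrite h0 (main_spec e_sym e_irr rdy c3); congr nat_of_bool; congr leq.
by rewrite (A3.1 11).
Qed.
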